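(* Let $\alpha_1,\alpha_2\in H^2(X;\mathbb Z)$ be represented by circle bundles $Y_i\to X$, $i=1,2$, and let $\chi_i:Y_i^{[2]}=Y_i\times_XY_i\to\mathrm U(1)$ be the difference maps. Let $S\to\mathbb T^2=\mathrm U(1)\times\mathrm U(1)$ be the bimultiplicative fundamental line bundle. Then the pullback $$L=(\chi_1\times\chi_2)^*S\to W^{[2,2]}=Y_1^{[2]}\times_XY_2^{[2]}$$ defines a bigerbe $(L,Y_1\times_XY_2,Y_2,Y_1,X)$ with characteristic class $G(L)=\alpha_1\cup\alpha_2\in H^4(X;\mathbb Z)$.
   Context: All spaces are compactly generated Hausdorff, all maps continuous. A map is locally split if it is surjective and has continuous sections over the members of some open cover of its target. Cohomology is Čech cohomology; $H^k(\cdot;\mathbb C^* )\cong H^{k+1}(\cdot;\mathbb Z)$ by Bockstein. The difference map of a circle bundle $Y\to X$ is $\chi:Y^{[2]}\to\mathrm U(1)$, $y_2=\chi(y_1,y_2)y_1$. The bundle $S$: write $\mathbb T^2=\mathbb R^2/\mathbb Z^2$. $S$ is the quotient of $\mathbb R^2\times\mathbb C$ by the $\mathbb Z^2$-action $(n,m)\cdot(x,y,z)=(x+n,y+m,e^{2\pi imx}z)$. Its Chern class generates $H^2(\mathbb T^2;\mathbb Z)$, and it has commuting natural isomorphisms $S_{x_1+x_2,y}\cong S_{x_1,y}\otimes S_{x_2,y}$ and $S_{x,y_1+y_2}\cong S_{x,y_1}\otimes S_{x,y_2}$ induced by $(x_1,y,z_1)\times(x_2,y,z_2)\mapsto(x_1+x_2,y,z_1z_2)$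 and $(x,y_1,z_1)\times(x,y_2,z_2)\mapsto(x,y_1+y_2,z_1z_2)$. These isomorphisms pull back to the trivializations of $d_1L$, $d_2L$ below. Locally split square $(W,Y_2,Y_1,X)$: a commutative square $W\to Y_1\to X$, $W\to Y_2\to X$ with $\pi_i:Y_i\to X$ and $W\to Y_1\times_XY_2$ locally split. $W^{[m,n]}$ is the space of arrays $(w_{ij})_{1\le i\le m,1\le j\le n}$ in $W$ such that for each $i$ all $w_{ij}$ have the same image in $Y_1$ and for each $j$ all $w_{ij}$ have the same image in $Y_2$ (for $W=Y_1\times_XY_2$ this is $Y_1^{[m]}\times_XY_2^{[n]}$). For a line bundle $L\to W^{[m,n]}$, $d_1L$ on $W^{[m+1,n]}$ (resp. $d_2L$ on $W^{[m,n+1]}$) is the alternating tensor product of the pullbacks by the projections omitting the $k$th value, $k=0,1,\dots$, of the first (resp. second) index (sign $(-1)^k$); $d_i^2L$ is canonically trivial. Bigerbe $(L,W,Y_2,Y_1,X)$: a line bundle $L\to W^{[2,2]}$ with trivializing sections $s_i$ of $d_iL$ such that $d_is_i$ is the canonical trivialization of $d_i^2L$ and $d_2s_1=d_1s_2$. Characteristic class $G(L)\in H^4(X;\mathbb Z)$: choose arbitrarily fine covers of $X,Y_1,Y_2,W$ compatible with the maps and local sections of the square, inducing covers of all $W^{[m,n]}$ so that Čech cochains carry commuting differentials $\delta,d_1,d_2$ with $d_1,d_2$ exact, and local sections of $L$ whose simplicial differentials are $s_1,s_2$. The transition cocycle $c(L)\in\check C^1(W^{[2,2]};\mathbb C^*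 )$ satisfies $\delta c=d_1c=d_2c=0$, and $G(L)=[\alpha]$, $\alpha\in\check C^3(X;\mathbb C^* )$, where for some $\gamma\in\check C^1(W;\mathbb C^* )$, $\beta_i\in\check C^2(Y_i;\mathbb C^* )$ (additive notation): $c(L)=-d_1d_2\gamma$, $\delta\gamma=d_1\beta_2-d_2\beta_1$, $\delta\beta_i=\pi_i^*\alpha$. *)

(* Defs.v *)
From HB Require Import structures.
From mathcomp Require Import all_boot all_order all_algebra.
From mathcomp Require Import generic_quotient complex.
From mathcomp Require Import all_classical all_reals all_analysis.
Import Order.TTheory GRing.Theory Num.Theory.
Import numFieldNormedType.Exports.

Set Implicit Arguments.
Unset Strict Implicit.
Unset Printing Implicit Defensive.

Local Open Scope classical_set_scope.
Local Open Scope ring_scope.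
Local Open Scope complex_scope.

Definition zdisc : Type := discrete_topology int.
HB.instance Definition _ := Topological.copy zdisc (discrete_topology int).
HB.instance Definition _ := GRing.Zmodule.copy zdisc int.

Lemma zdisc_sub_continuous : continuous (fun x : zdisc * zdisc => x.1 - x.2).
Proof.
move=> x A /nbhs_singleton Ax; exists ([set x.1], [set x.2]).
  by split; rewrite [nbhs _]/(principal_filter _); apply/principal_filterP.
by move=> [a b] [/= -> ->].
Qed.
HB.instance Definition _ :=
  PreTopologicalNmodule_isTopologicalZmodule.Build zdisc zdisc_sub_continuous.

Section Circle.
Variable R : realType.

(* cis x = e^{2 pi i x} *)
Definition cis (x : R) : R[i] :=
  cos (trigo.pi *+ 2 * x) +i* sin (trigo.pi *+ 2 * x).

Lemma cisD (x y : R) : cis (x + y) = cis x * cis y.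
Proof.
rewrite /cis mulrDr cosD sinD; apply/eqP; rewrite eq_complex /=.
by rewrite eqxx /= addrC.
Qed.

Lemma cis0 : cis 0 = 1.
Proof. by rewrite /cis mulr0 cos0 sin0. Qed.

Lemma cis1 : cis 1 = 1.
Proof.
apply/eqP; rewrite /cis mulr1 cos2pi eq_complex /= eqxx /=.
by rewrite -[_ *+ 2]add0r sinD2pi sin0.
Qed.

Lemma cis_nat (n : nat) : cis n%:R = 1.
Proof.
by elim: n => [|n IH]; rewrite ?cis0// -natr1 cisD IH cis1 mulr1.
Qed.

Lemma cis_int (n : int) : cis n%:~R = 1.
Proof.
case: n => n; first exact: cis_nat.
rewrite NegzE mulrNz -[LHS]mulr1 -[X in _ * X](cis_nat n.+1) -cisD.
by rewrite addNr cis0.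
Qed.

Lemma normc_cis (x : R) : `|cis x| = 1.
Proof.
by rewrite /cis normc_def /= cos2Dsin2 sqrtr1.
Qed.

Lemma cis_neq0 (x : R) : cis x != 0.
Proof. by rewrite -normr_eq0 normc_cis oner_eq0. Qed.

Definition U1 : Type := [set z : R[i]^o | `|z| = 1].
HB.instance Definition _ :=
  Topological.copy U1 (set_type [set z : R[i]^o | `|z| = 1]).

Definition u1val (u : U1) : R[i] := set_val u.
Definition u1mk (z : R[i]) (hz : `|z| = 1) : U1 := exist _ (z : R[i]^o) (mem_set hz).

Lemma u1val_norm (u : U1) : `|u1val u| = 1.
Proof. exact: set_valP u. Qed.

Lemma u1_mul_subproof (u v : U1) : `|u1val u * u1val v| = 1.
Proof. by rewrite normrM !u1val_norm mulr1. Qed.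
Definition u1_mul (u v : U1) : U1 := u1mk (u1_mul_subproof u v).
Definition u1_one : U1 := u1mk (normr1 R[i]).
Definition u1_cis (x : R) : U1 := u1mk (normc_cis x).

(* C^* is a topological abelian group, written additively:
   x + y is the product and 0 is the number 1. *)
Definition Cstar : Type := [set z : R[i]^o | z != 0].
HB.instance Definition _ :=
  Topological.copy Cstar (set_type [set z : R[i]^o | z != 0]).

Definition csval (u : Cstar) : R[i] := set_val u.
Definition csmk (z : R[i]) (hz : z != 0) : Cstar :=
  exist _ (z : R[i]^o) (mem_set hz).

Lemma csval_neq0 (u : Cstar) : csval u != 0.
Proof. exact: set_valP u. Qed.

Lemma csval_inj : injective csval.
Proof. exact: val_inj. Qed.

Definition cs_one : Cstar := csmk (oner_neq0 R[i]).
Definition cs_mul (u v : Cstar) : Cstar :=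
  csmk (mulf_neq0 (csval_neq0 u) (csval_neq0 v)).
Lemma cs_inv_subproof (u : Cstar) : (csval u)^-1 != 0.
Proof. by rewrite invr_eq0 csval_neq0. Qed.
Definition cs_inv (u : Cstar) : Cstar := csmk (cs_inv_subproof u).

Lemma cs_mulA : associative cs_mul.
Proof. by move=> u v w; apply: csval_inj; exact: mulrA. Qed.
Lemma cs_mulC : commutative cs_mul.
Proof. by move=> u v; apply: csval_inj; exact: mulrC. Qed.
Lemma cs_mul1 : left_id cs_one cs_mul.
Proof. by move=> u; apply: csval_inj; exact: mul1r. Qed.
Lemma cs_mulV : left_inverse cs_one cs_inv cs_mul.
Proof. by move=> u; apply: csval_inj; exact: (mulVf (csval_neq0 u)). Qed.

HB.instance Definition _ :=
  GRing.isZmodule.Build Cstar cs_mulA cs_mulC cs_mul1 cs_mulV.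

Lemma csval_continuous : continuous (csval : Cstar -> R[i]^o).
Proof. exact: initial_continuous. Qed.

Lemma cs_sub_continuous : continuous (fun x : Cstar * Cstar => x.1 - x.2).
Proof.
move=> x; apply: (@continuous_comp_initial _ _ _ (set_val : Cstar -> R[i]^o)).
move=> {}x /=.
apply: (@cvgM R[i] _ _ _ (fun x : Cstar * Cstar => csval x.1)
   (fun x : Cstar * Cstar => (csval x.2)^-1)).
  apply: continuous_comp; first exact: cvg_fst.
  exact: csval_continuous.
apply: cvgV; first exact: csval_neq0.
apply: continuous_comp; first exact: cvg_snd.
exact: csval_continuous.
Qed.
HB.instance Definition _ :=
  PreTopologicalNmodule_isTopologicalZmodule.Build Cstar cs_sub_continuous.

Lemma u1_cs_subproof (u : U1) : u1val u != 0.
Proof. by rewrite -normr_eq0 u1val_norm oner_eq0. Qed.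
Definition u1_cs (u : U1) : Cstar := csmk (u1_cs_subproof u).

(* cexp a = e^{2 pi i a} for complex a *)
Lemma cexp_subproof (a : R[i]) :
  (expR (- (trigo.pi *+ 2 * complex.Im a)))%:C * cis (complex.Re a) != 0.
Proof.
rewrite mulf_neq0 ?cis_neq0// eq_complex /= eqxx andbT.
by rewrite gt_eqF ?expR_gt0.
Qed.
Definition cexp (a : R[i]) : Cstar := csmk (cexp_subproof a).

End Circle.

Definition cg_hausdorff (X : topologicalType) : Prop :=
  hausdorff_space X /\
  forall A : set X, (forall K, compact K -> closed (A `&` K)) -> closed A.

Definition locally_split (X Y : topologicalType) (f : X -> Y) : Prop :=
  [/\ continuous f, (forall y, exists x, f x = y) &
    forall y, exists U : set Y, [/\ open U, U y &
      exists2 s : Y -> X, {within U, continuous s} &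
        forall u, U u -> f (s u) = u]].

(* p : E -> B is a locally trivial bundle with fibre F, compatibly with the
   operations of G on E and on F: phi and psi are the two halves of a
   trivialization U * F ~ p^-1(U).  When F = C and G = C acts by scaling, a
   bijection commuting with scaling determines the fibrewise addition, so this
   is exactly the notion of complex line bundle; when F = G = U(1) it is that
   of principal U(1)-bundle. *)
Definition locally_trivial (G : Type) (F E B : topologicalType) (p : E -> B)
    (actF : G -> F -> F) (actE : G -> E -> E) : Prop :=
  continuous p /\
  forall b, exists U : set B, [/\ open U, U b &
    exists (phi : B * F -> E) (psi : E -> F),
      [/\ {within U `*` [set: F], continuous phi},
          {within p @^-1` U, continuous psi},
          (forall x z, U x -> p (phi (x, z)) = x /\ psi (phi (x, z)) = z),
          (forall e, U (p e) -> phi (p e, psi e) = e) &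
          (forall g x z, U x -> phi (x, actF g z) = actE g (phi (x, z)))]].

Section Bundles.
Variable R : realType.

Record circle_bundle (X : topologicalType) := CircleBundle {
  cb_tot :> topologicalType;
  cb_proj : cb_tot -> X;
  cb_act : U1 R -> cb_tot -> cb_tot;
  cb_locally_trivial : locally_trivial cb_proj (@u1_mul R) cb_act
}.

(* The difference map: y2 = chi (y1, y2) y1 (only meaningful on Y^[2]). *)
Definition difference (X : topologicalType) (Y : circle_bundle X) (y1 y2 : Y)
  : U1 R := xget (u1_one R) [set u | cb_act u y1 = y2].

Record line_data (B : topologicalType) := LineData {
  lb_tot :> topologicalType;
  lb_proj : lb_tot -> B;
  lb_scale : R[i] -> lb_tot -> lb_tot;
  lb_scale_proj : forall c v, lb_proj (lb_scale c v) = lb_proj v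
}.

Definition is_line_bundle (B : topologicalType) (L : line_data B) : Prop :=
  locally_trivial (@lb_proj B L) (fun (c : R[i]) (z : R[i]^o) => c * z : R[i]^o)
    (@lb_scale B L).

(* lb_scale 0 v <> v says that v is a nonzero vector. *)
Definition frame (B : topologicalType) (L : line_data B) (b : B) (v : L) : Prop :=
  lb_proj v = b /\ lb_scale 0 v <> v.

Definition cs_scale (B : topologicalType) (L : line_data B) (c : Cstar R) (v : L)
  : L := lb_scale (csval c) v.

(* v = (frame_ratio u v) u *)
Definition frame_ratio (B : topologicalType) (L : line_data B) (u v : L)
  : Cstar R := xget 0 [set c | cs_scale c u = v].

Section Pullback.
Variables (B' B : topologicalType) (f : B' -> B) (L : line_data B).

Definition pull_tot : topologicalType :=
  [set p : B' * L | f p.1 = lb_proj p.2].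
Definition pull_proj (v : pull_tot) : B' := (set_val v).1.
Lemma pull_scale_subproof (c : R[i]) (v : pull_tot) :
  f (set_val v).1 = lb_proj (lb_scale c (set_val v).2).
Proof. by rewrite lb_scale_proj; exact: set_valP v. Qed.
Definition pull_scale (c : R[i]) (v : pull_tot) : pull_tot :=
  exist _ ((set_val v).1, lb_scale c (set_val v).2)
    (mem_set (pull_scale_subproof c v)).
Lemma pull_scale_proj c v : pull_proj (pull_scale c v) = pull_proj v.
Proof. by []. Qed.
Definition pullback : line_data B' := LineData pull_scale_proj.
Definition pull_vector (v : pullback) : L := (set_val (v : pull_tot)).2.
End Pullback.

End Bundles.

Section FundamentalBundle.
Variable R : realType.

Definition Scover : topologicalType := (R * R * R[i]^o)%type.

Definition Sact (n m : int) (p : Scover) : Scover :=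
  (p.1.1 + n%:~R, p.1.2 + m%:~R, cis (m%:~R * p.1.1) * p.2).

Definition Sequiv (p q : Scover) : bool :=
  `[< exists n m, q = Sact n m p >].

Lemma Sact0 p : Sact 0 0 p = p.
Proof. by case: p => [[x y] z]; rewrite /Sact /= mul0r cis0 mul1r !addr0. Qed.

Lemma SactD n m n' m' p : Sact n' m' (Sact n m p) = Sact (n + n') (m + m') p.
Proof.
case: p => [[x y] z]; rewrite /Sact /=; congr ((_, _), _).
- by rewrite intrD addrA.
- by rewrite intrD addrA.
rewrite mulrA -cisD; congr (_ * _).
by rewrite mulrDr -intrM addrAC cisD cis_int mulr1 -mulrDl -intrD addrC.
Qed.

Lemma Sequiv_refl : reflexive Sequiv.
Proof. by move=> p; apply/asboolP; exists 0, 0; rewrite Sact0. Qed.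
Lemma Sequiv_sym : symmetric Sequiv.
Proof.
suff H p q : Sequiv p q -> Sequiv q p by move=> p q; apply/idP/idP; exact: H.
move=> /asboolP[n [m ->]]; apply/asboolP; exists (- n), (- m).
by rewrite SactD !subrr Sact0.
Qed.
Lemma Sequiv_trans : transitive Sequiv.
Proof.
move=> q p r /asboolP[n [m ->]] /asboolP[n' [m' ->]]; apply/asboolP.
by exists (n + n'), (m + m'); rewrite SactD.
Qed.

Definition Sequiv_equiv := EquivRel Sequiv Sequiv_refl Sequiv_sym Sequiv_trans.

Definition Stot : topologicalType :=
  quotient_topology {eq_quot Sequiv_equiv}%qT.
Definition Sclass (p : Scover) : Stot := \pi_({eq_quot Sequiv_equiv})%qT p.
Definition Srepr (s : Stot) : Scover := repr s.

Lemma Srepr_class p : exists n m, Srepr (Sclass p) = Sact n m p.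
Proof.
have /eqmodP/asboolP[n [m ->]] : (p = Srepr (Sclass p) %[mod {eq_quot Sequiv_equiv}])%qT.
  by rewrite /Srepr reprK.
by exists n, m.
Qed.

Lemma Sclass_act n m p : Sclass (Sact n m p) = Sclass p.
Proof. by apply/esym/eqmodP/asboolP; exists n, m. Qed.

Definition Sproj (s : Stot) : U1 R * U1 R :=
  (u1_cis (Srepr s).1.1, u1_cis (Srepr s).1.2).

Definition Sscale (c : R[i]) (s : Stot) : Stot :=
  Sclass ((Srepr s).1, c * (Srepr s).2).

Lemma u1_cisDz (x : R) (n : int) : u1_cis (x + n%:~R) = u1_cis x.
Proof. by apply: val_inj; rewrite /= cisD cis_int mulr1. Qed.

Lemma Sproj_class p : Sproj (Sclass p) = (u1_cis p.1.1, u1_cis p.1.2).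
Proof.
by rewrite /Sproj; have [n [m ->]] := Srepr_class p; rewrite !u1_cisDz.
Qed.

Lemma Sscale_proj c s : Sproj (Sscale c s) = Sproj s.
Proof. by rewrite /Sscale Sproj_class. Qed.

Lemma Sscale_class c p : Sscale c (Sclass p) = Sclass (p.1, c * p.2).
Proof.
rewrite /Sscale; have [n [m ->]] := Srepr_class p; rewrite -(Sclass_act n m (p.1, _)).
by congr Sclass; rewrite /Sact /= mulrCA.
Qed.

Definition Sbundle : line_data R (U1 R * U1 R)%type := LineData Sscale_proj.

(* Graphs of the multiplications S_{x1,y} (x) S_{x2,y} -> S_{x1+x2,y} and
   S_{x,y1} (x) S_{x,y2} -> S_{x,y1+y2}. *)
Definition Smul1 (u v w : Sbundle) : Prop := exists x1 x2 y z1 z2,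
  [/\ u = Sclass (x1, y, z1), v = Sclass (x2, y, z2)
    & w = Sclass (x1 + x2, y, z1 * z2)].
Definition Smul2 (u v w : Sbundle) : Prop := exists x y1 y2 z1 z2,
  [/\ u = Sclass (x, y1, z1), v = Sclass (x, y2, z2)
    & w = Sclass (x, y1 + y2, z1 * z2)].

(* A multiplication m : L_2 * L_0 -> L_1 is the trivializing section of
   L_0 (x) L_1^-1 (x) L_2 whose coordinate in the frame v_0 (x) v_1^-1 (x) v_2
   is the c in C^* with m (v_2, v_0) = c^-1 v_1. *)
Definition Striv1 (v : 'I_3 -> Sbundle) : Cstar R :=
  xget 0 [set c | Smul1 (v ord_max) (v ord0) (cs_scale (- c) (v (inord 1)))].
Definition Striv2 (v : 'I_3 -> Sbundle) : Cstar R :=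
  xget 0 [set c | Smul2 (v ord_max) (v ord0) (cs_scale (- c) (v (inord 1)))].

End FundamentalBundle.

(* For circle bundles the fibre product in topological spaces is already
   compactly generated (it is locally U * U(1) * U(1)), so no k-ification is
   applied. *)
Definition fprod (X Y1 Y2 : topologicalType) (f1 : Y1 -> X) (f2 : Y2 -> X)
  : topologicalType := [set y : Y1 * Y2 | f1 y.1 = f2 y.2].

Record square := Square {
  sq_W : topologicalType; sq_Y2 : topologicalType;
  sq_Y1 : topologicalType; sq_X : topologicalType;
  sq_p1 : sq_W -> sq_Y1; sq_p2 : sq_W -> sq_Y2;
  sq_pi1 : sq_Y1 -> sq_X; sq_pi2 : sq_Y2 -> sq_X;
  sq_comm : forall w, sq_pi1 (sq_p1 w) = sq_pi2 (sq_p2 w)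
}.

Definition sq_pair (Q : square) (w : sq_W Q) : fprod (@sq_pi1 Q) (@sq_pi2 Q) :=
  exist _ (sq_p1 w, sq_p2 w) (mem_set (sq_comm w)).

Definition locally_split_square (Q : square) : Prop :=
  [/\ locally_split (@sq_pi1 Q), locally_split (@sq_pi2 Q)
    & locally_split (@sq_pair Q)].

(* Rows i share their image in Y1, columns j share their image in Y2; this is
   used both for points and for the indices of covers. *)
Definition is_grid (W Y1 Y2 : Type) (p1 : W -> Y1) (p2 : W -> Y2) (m n : nat)
    (w : 'I_m * 'I_n -> W) : Prop :=
  (forall i j j', p1 (w (i, j)) = p1 (w (i, j'))) /\
  (forall i i' j, p2 (w (i, j)) = p2 (w (i', j))).

Definition omit1 (T : Type) (m n : nat) (k : 'I_m.+1) (w : 'I_m.+1 * 'I_n -> T)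
  : 'I_m * 'I_n -> T := fun ij => w (lift k ij.1, ij.2).
Definition omit2 (T : Type) (m n : nat) (k : 'I_n.+1) (w : 'I_m * 'I_n.+1 -> T)
  : 'I_m * 'I_n -> T := fun ij => w (ij.1, lift k ij.2).

Section Grids.
Variable Q : square.

Definition grid (m n : nat) : topologicalType :=
  [set w : {ptws ('I_m * 'I_n)%type -> sq_W Q} |
     is_grid (@sq_p1 Q) (@sq_p2 Q) w].

Definition entry m n (w : grid m n) : 'I_m * 'I_n -> sq_W Q := set_val w.

Lemma entryP m n (w : grid m n) : is_grid (@sq_p1 Q) (@sq_p2 Q) (entry w).
Proof. exact: set_valP w. Qed.

Lemma face1_subproof m n (k : 'I_m.+1) (w : grid m.+1 n) :
  is_grid (@sq_p1 Q) (@sq_p2 Q) (omit1 k (entry w)).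
Proof. by have [h1 h2] := entryP w; split=> *; [exact: h1|exact: h2]. Qed.
Definition face1 m n (k : 'I_m.+1) (w : grid m.+1 n) : grid m n :=
  exist _ (omit1 k (entry w)) (mem_set (face1_subproof k w)).

Lemma face2_subproof m n (k : 'I_n.+1) (w : grid m n.+1) :
  is_grid (@sq_p1 Q) (@sq_p2 Q) (omit2 k (entry w)).
Proof. by have [h1 h2] := entryP w; split=> *; [exact: h1|exact: h2]. Qed.
Definition face2 m n (k : 'I_n.+1) (w : grid m n.+1) : grid m n :=
  exist _ (omit2 k (entry w)) (mem_set (face2_subproof k w)).
End Grids.

Definition altsum (A : zmodType) (n : nat) (F : 'I_n -> A) : A :=
  \sum_(k < n) F k *~ (-1) ^+ k.

Section Bigerbe.
Variable R : realType.

(* A trivializing section s of the alternating tensor product over k of the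
   bundles f_k^* L on B' is given by its coordinates: s b v is the number with
   which the tensor product of the v_k^{(-1)^k} has to be multiplied, for a
   family of nonzero vectors v_k of L over f_k b.  Values of s at other v are
   irrelevant. *)
Definition trivializing_section (B' B : topologicalType) (L : line_data R B)
    (n : nat) (f : 'I_n -> B' -> B) (s : B' -> ('I_n -> L) -> Cstar R) : Prop :=
  (forall b v (c : 'I_n -> Cstar R), (forall k, frame (f k b) (v k)) ->
     s b (fun k => cs_scale (c k) (v k)) = s b v - altsum c) /\
  (forall (N : set B') (t : 'I_n -> B' -> L), open N ->
     (forall k, {within N, continuous t k}) ->
     (forall k b, N b -> frame (f k b) (t k b)) ->
     {within N, continuous (fun b => s b (fun k => t k b))}).

(* The canonical trivialization of d_i^2 L has coordinate 1 (additively, 0) in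
   every family of vectors which is chosen equal whenever two iterated faces
   coincide. *)
Definition bigerbe (Q : square) (L : line_data R (grid Q 2 2))
    (s1 : grid Q 3 2 -> ('I_3 -> L) -> Cstar R)
    (s2 : grid Q 2 3 -> ('I_3 -> L) -> Cstar R) : Prop :=
  [/\ locally_split_square Q, is_line_bundle L,
      trivializing_section (fun k : 'I_3 => face1 k) s1 /\
      trivializing_section (fun k : 'I_3 => face2 k) s2,
      (forall (w : grid Q 4 2) (v : 'I_4 -> 'I_3 -> L),
         (forall k l, frame (face1 l (face1 k w)) (v k l)) ->
         (forall (k : 'I_4) (l : 'I_3) (k' : 'I_4) (l' : 'I_3), (forall i : 'I_2,
            lift k (lift l i) = lift k' (lift l' i)) -> v k l = v k' l') ->
         altsum (fun k => s1 (face1 k w) (v k)) = 0) /\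
      (forall (w : grid Q 2 4) (v : 'I_4 -> 'I_3 -> L),
         (forall k l, frame (face2 l (face2 k w)) (v k l)) ->
         (forall (k : 'I_4) (l : 'I_3) (k' : 'I_4) (l' : 'I_3), (forall i : 'I_2,
            lift k (lift l i) = lift k' (lift l' i)) -> v k l = v k' l') ->
         altsum (fun k => s2 (face2 k w) (v k)) = 0) &
      (forall (w : grid Q 3 3) (v : 'I_3 -> 'I_3 -> L),
         (forall k l, frame (face1 k (face2 l w)) (v k l)) ->
         altsum (fun l => s1 (face2 l w) (fun k => v k l)) =
         altsum (fun k => s2 (face1 k w) (fun l => v k l)))].

End Bigerbe.

Record open_cover (X : topologicalType) := OpenCover {
  oc_idx : Type;
  oc_set :> oc_idx -> set X;
  oc_open : forall i, open (oc_set i);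
  oc_cover : forall x, exists i, oc_set i x
}.

Definition finer (X : topologicalType) (I J : Type) (V : J -> set X)
    (U : I -> set X) : Prop := forall j, exists i, V j `<=` U i.

Definition inter (X I : Type) (U : I -> set X) (n : nat) (i : 'I_n -> I) : set X :=
  [set x | forall k, U (i k) x].

Section Cochains.
Variables (X : topologicalType) (A : topologicalZmodType).

(* The value of a p-cochain at the index family i is a function on the
   intersection of the U (i k); its values elsewhere are irrelevant. *)
Definition cochain (I : Type) (p : nat) : Type := ('I_p.+1 -> I) -> X -> A.

Definition is_cochain (I : Type) (U : I -> set X) p (c : cochain I p) : Prop :=
  forall i, {within inter U i, continuous (c i)}.

Definition cdiff (I : Type) p (c : cochain I p) : cochain I p.+1 :=
  fun i x => altsum (fun k : 'I_p.+2 => c (i \o lift k) x).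

Definition is_cocycle (I : Type) (U : I -> set X) p (c : cochain I p) : Prop :=
  is_cochain U c /\ forall i x, inter U i x -> cdiff c i x = 0.

Record cech (p : nat) := Cech {
  cech_cover : open_cover X;
  cech_fun : cochain (oc_idx cech_cover) p
}.

Definition cech_cocycle p (z : cech p) : Prop :=
  is_cocycle (cech_cover z) (@cech_fun p z).

(* z' is the restriction of z along a refinement, up to a coboundary (cochains
   of degree -1 being zero). *)
Definition cech_step p (z z' : cech p) : Prop :=
  exists r : oc_idx (cech_cover z') -> oc_idx (cech_cover z),
    (forall j, cech_cover z' j `<=` cech_cover z (r j)) /\
    match p return cochain (oc_idx (cech_cover z)) p ->
                   cochain (oc_idx (cech_cover z')) p -> Prop with
    | 0 => fun c c' => forall i x, inter (cech_cover z') i x ->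
             c' i x = c (r \o i) x
    | q.+1 => fun c c' =>
             exists b : cochain (oc_idx (cech_cover z')) q,
               is_cochain (cech_cover z') b /\
               forall i x, inter (cech_cover z') i x ->
                 c' i x = c (r \o i) x + cdiff b i x
    end (@cech_fun p z) (@cech_fun p z').

(* Equality of classes in the direct limit over all open covers. *)
Inductive cohomologous p : cech p -> cech p -> Prop :=
| cohomologous_step z z' : cech_cocycle z -> cech_cocycle z' ->
    cech_step z z' -> cohomologous z z'
| cohomologous_refl z : cohomologous z z
| cohomologous_sym z z' : cohomologous z z' -> cohomologous z' z
| cohomologous_trans z z' z'' :
    cohomologous z z' -> cohomologous z' z'' -> cohomologous z z''.

(* H^p (X; A), as the collection of classes of cocycles. *)
Definition cech_class (p : nat) : Type := cech p -> Prop.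
Definition class_of p (z : cech p) : cech_class p := cohomologous z.
Definition cohomology p (a : cech_class p) : Prop :=
  exists2 z, cech_cocycle z & a = class_of z.

End Cochains.

Arguments cochain X A I p : clear implicits.

Section CupProduct.
Variable X : topologicalType.

Definition cup_cochain (I : Type) p q (a : cochain X zdisc I p)
    (b : cochain X zdisc I q) : cochain X zdisc I (p + q) :=
  fun i x => (a (fun k => i (inord k)) x : int) *
             (b (fun k => i (inord (p + k))) x : int).

Definition cup p q (a : cech_class X zdisc p) (b : cech_class X zdisc q)
  : cech_class X zdisc (p + q) :=
  fun z => exists (U : open_cover X) (f : cochain X zdisc (oc_idx U) p)
                  (g : cochain X zdisc (oc_idx U) q),
    [/\ a (Cech f), b (Cech g) & class_of (Cech (cup_cochain f g)) z].
End CupProduct.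

Section Bockstein.
Variables (R : realType) (X : topologicalType).

(* n is obtained from g by the connecting construction of
   0 -> Z -> C -> C^* -> 0, the second map being e^{2 pi i a}. *)
Definition bockstein_cochain (U : open_cover X) p
    (g : cochain X (Cstar R) (oc_idx U) p)
    (n : cochain X zdisc (oc_idx U) p.+1) : Prop :=
  exists a : cochain X R[i]^o (oc_idx U) p,
    [/\ is_cochain U a,
        (forall i x, inter U i x -> g i x = cexp (a i x)) &
        (forall i x, inter U i x -> cdiff a i x = (n i x : int)%:~R)].

(* The Bockstein isomorphism H^p (X; C^* ) ~ H^{p+1} (X; Z), as a graph, since
   logarithms of cochains need not exist over a given cover. *)
Definition bockstein p (g : cech_class X (Cstar R) p)
    (n : cech_class X zdisc p.+1) : Prop :=
  exists (U : open_cover X) (g' : cochain X (Cstar R) (oc_idx U) p)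
         (n' : cochain X zdisc (oc_idx U) p.+1),
    [/\ cech_cocycle (Cech g'), cech_cocycle (Cech n'),
        g = class_of (Cech g'), n = class_of (Cech n') &
        bockstein_cochain g' n'].

(* The circle bundle Y represents a: the transition cocycle of local sections
   of Y over an open cover is sent to a. *)
Definition chern_class (Y : circle_bundle R X) (a : cech_class X zdisc 2) : Prop :=
  exists (U : open_cover X) (sigma : oc_idx U -> X -> Y)
         (n : cochain X zdisc (oc_idx U) 2),
    [/\ (forall i, {within U i, continuous sigma i}) /\
        (forall i x, U i x -> cb_proj (sigma i x) = x),
        cech_cocycle (Cech n), a = class_of (Cech n) &
        bockstein_cochain (p := 1)
          (fun i x => u1_cs (difference (sigma (i ord0) x) (sigma (i ord_max) x)))
          n].
End Bockstein.

(* Covers of the four spaces of a square compatible with its maps and with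
   local sections.  The indices (and members) of the induced cover of W^[m,n]
   are the grids of indices (and their members) for W; the local sections,
   defined on finite intersections, provide the homotopies making the complexes
   (C^p (W^[*,n]), d_1) and (C^p (W^[m,*]), d_2) exact. *)
Record square_cover (Q : square) := SquareCover {
  sc_X : open_cover (sq_X Q);
  sc_I1 : Type; sc_I2 : Type; sc_IW : Type;
  sc_Y1 : sc_I1 -> set (sq_Y1 Q);
  sc_Y2 : sc_I2 -> set (sq_Y2 Q);
  sc_W : sc_IW -> set (sq_W Q);
  sc_r1 : sc_I1 -> oc_idx sc_X; sc_r2 : sc_I2 -> oc_idx sc_X;
  sc_q1 : sc_IW -> sc_I1; sc_q2 : sc_IW -> sc_I2;
  sc_comm : forall a, sc_r1 (sc_q1 a) = sc_r2 (sc_q2 a);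
  sc_Y1_open : forall b, open (sc_Y1 b);
  sc_Y2_open : forall b, open (sc_Y2 b);
  sc_W_open : forall a, open (sc_W a);
  sc_Y1_sub : forall b y, sc_Y1 b y -> sc_X (sc_r1 b) (sq_pi1 y);
  sc_Y2_sub : forall b y, sc_Y2 b y -> sc_X (sc_r2 b) (sq_pi2 y);
  sc_W_sub : forall a w, sc_W a w ->
    sc_Y1 (sc_q1 a) (sq_p1 w) /\ sc_Y2 (sc_q2 a) (sq_p2 w);
  sc_Y1_cover : forall x y, sc_X x (sq_pi1 y) ->
    exists2 b, sc_r1 b = x & sc_Y1 b y;
  sc_Y2_cover : forall x y, sc_X x (sq_pi2 y) ->
    exists2 b, sc_r2 b = x & sc_Y2 b y;
  sc_W_cover : forall b1 b2 w, sc_r1 b1 = sc_r2 b2 ->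
    sc_Y1 b1 (sq_p1 w) -> sc_Y2 b2 (sq_p2 w) ->
    exists a, [/\ sc_q1 a = b1, sc_q2 a = b2 & sc_W a w];
  sc_Y1_section : forall n (x : 'I_n.+1 -> oc_idx sc_X),
    exists (b : 'I_n.+1 -> sc_I1) (s : sq_X Q -> sq_Y1 Q),
      [/\ (forall k, sc_r1 (b k) = x k),
          {within inter sc_X x, continuous s} &
          forall z, inter sc_X x z -> sq_pi1 (s z) = z /\ inter sc_Y1 b (s z)];
  sc_Y2_section : forall n (x : 'I_n.+1 -> oc_idx sc_X),
    exists (b : 'I_n.+1 -> sc_I2) (s : sq_X Q -> sq_Y2 Q),
      [/\ (forall k, sc_r2 (b k) = x k),
          {within inter sc_X x, continuous s} &
          forall z, inter sc_X x z -> sq_pi2 (s z) = z /\ inter sc_Y2 b (s z)];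
  sc_W_section : forall n (b1 : 'I_n.+1 -> sc_I1) (b2 : 'I_n.+1 -> sc_I2),
    (forall k, sc_r1 (b1 k) = sc_r2 (b2 k)) ->
    exists (a : 'I_n.+1 -> sc_IW) (s : fprod (@sq_pi1 Q) (@sq_pi2 Q) -> sq_W Q),
      let D := [set y | inter sc_Y1 b1 (set_val y).1 /\
                        inter sc_Y2 b2 (set_val y).2] in
      [/\ (forall k, sc_q1 (a k) = b1 k /\ sc_q2 (a k) = b2 k),
          {within D, continuous s} &
          forall y, D y -> sq_pair (s y) = y /\ inter sc_W a (s y)]
}.

Section CharacteristicClass.
Variables (R : realType) (Q : square) (L : line_data R (grid Q 2 2)).
Variables (s1 : grid Q 3 2 -> ('I_3 -> L) -> Cstar R)
          (s2 : grid Q 2 3 -> ('I_3 -> L) -> Cstar R).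

Definition sc_grid (C : square_cover Q) m n (a : 'I_m * 'I_n -> sc_IW C) : Prop :=
  is_grid (@sc_q1 Q C) (@sc_q2 Q C) a.

Definition sc_grid_set (C : square_cover Q) m n (a : 'I_m * 'I_n -> sc_IW C)
  : set (grid Q m n) := [set w | forall ij, sc_W (a ij) (entry w ij)].

(* t is a family of local sections of L on the cover of W^[2,2] such that
   d_1 t = s_1 and d_2 t = s_2, i.e. such that s_i has coordinate 1
   (additively, 0) in the frame d_i t. *)
Definition local_sections (C : square_cover Q)
    (t : ('I_2 * 'I_2 -> sc_IW C) -> grid Q 2 2 -> L) : Prop :=
  [/\ (forall a, sc_grid a -> {within sc_grid_set a, continuous t a}),
      (forall a w, sc_grid a -> sc_grid_set a w -> frame w (t a w)),
      (forall (a : 'I_3 * 'I_2 -> sc_IW C) w, sc_grid a -> sc_grid_set a w ->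
         s1 w (fun k => t (omit1 k a) (face1 k w)) = 0) &
      (forall (a : 'I_2 * 'I_3 -> sc_IW C) w, sc_grid a -> sc_grid_set a w ->
         s2 w (fun k => t (omit2 k a) (face2 k w)) = 0)].

Definition d1d2 (C : square_cover Q) (gamma : cochain (sq_W Q) (Cstar R) (sc_IW C) 1)
    (a : 'I_2 -> 'I_2 * 'I_2 -> sc_IW C) (w : grid Q 2 2) : Cstar R :=
  altsum (fun k : 'I_2 => altsum (fun l : 'I_2 =>
    let ij : 'I_2 * 'I_2 := (lift k ord0, lift l ord0) in
    gamma (fun p => a p ij) (entry w ij))).

(* Additive notation: c(L) = - d_1 d_2 gamma, delta gamma = d_1 beta_2 -
   d_2 beta_1, delta beta_i = pi_i^* alpha, where c(L) compares the local
   sections of index a_0 and a_1 by t_{a_1} = c(L) t_{a_0}. *)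
Definition represents_class (C : square_cover Q)
    (alpha : cochain (sq_X Q) (Cstar R) (oc_idx (sc_X C)) 3) : Prop :=
  is_cocycle (sc_X C) alpha /\
  exists (t : ('I_2 * 'I_2 -> sc_IW C) -> grid Q 2 2 -> L)
         (gamma : cochain (sq_W Q) (Cstar R) (sc_IW C) 1)
         (beta1 : cochain (sq_Y1 Q) (Cstar R) (sc_I1 C) 2)
         (beta2 : cochain (sq_Y2 Q) (Cstar R) (sc_I2 C) 2),
    [/\ local_sections t,
        [/\ is_cochain (@sc_W Q C) gamma, is_cochain (@sc_Y1 Q C) beta1
          & is_cochain (@sc_Y2 Q C) beta2],
        (forall (a : 'I_2 -> 'I_2 * 'I_2 -> sc_IW C) w,
           (forall p, sc_grid (a p)) -> inter (@sc_grid_set C 2 2) a w ->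
           frame_ratio (t (a ord0) w) (t (a ord_max) w) = - d1d2 gamma a w),
        (forall a w, inter (@sc_W Q C) a w ->
           cdiff gamma a w = beta2 (@sc_q2 Q C \o a) (sq_p2 w)
                           - beta1 (@sc_q1 Q C \o a) (sq_p1 w)) &
        (forall b y, inter (@sc_Y1 Q C) b y ->
           cdiff beta1 b y = alpha (@sc_r1 Q C \o b) (sq_pi1 y)) /\
        (forall b y, inter (@sc_Y2 Q C) b y ->
           cdiff beta2 b y = alpha (@sc_r2 Q C \o b) (sq_pi2 y))].

(* The class in H^3 (X; C^* ) computed on arbitrarily fine covers: it is the
   same for all sufficiently fine ones, and there are arbitrarily fine ones on
   which it can be computed.  At most one g has this property.  Fineness is
   imposed on X, Y1, Y2 only: the members of the cover of W lie over products
   of those of Y1 and Y2. *)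
Definition dd_class (g : cech_class (sq_X Q) (Cstar R) 3) : Prop :=
  (exists (UX : open_cover (sq_X Q)) (UY1 : open_cover (sq_Y1 Q))
          (UY2 : open_cover (sq_Y2 Q)),
     forall (C : square_cover Q) alpha,
       finer (sc_X C) UX -> finer (@sc_Y1 Q C) UY1 -> finer (@sc_Y2 Q C) UY2 ->
       represents_class (C := C) alpha -> g = class_of (Cech alpha)) /\
  (forall (UX : open_cover (sq_X Q)) (UY1 : open_cover (sq_Y1 Q))
          (UY2 : open_cover (sq_Y2 Q)),
     exists (C : square_cover Q) alpha,
       [/\ finer (sc_X C) UX, finer (@sc_Y1 Q C) UY1, finer (@sc_Y2 Q C) UY2 &
           represents_class (C := C) alpha]).

(* G(L) = G in H^4 (X; Z) *)
Definition characteristic_class (G : cech_class (sq_X Q) zdisc 4) : Prop :=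
  exists2 g, dd_class g & bockstein g G.

End CharacteristicClass.

Section Decomposable.
Variables (R : realType) (X : topologicalType) (Y1 Y2 : circle_bundle R X).

Definition bundle_fprod : topologicalType := fprod (@cb_proj R X Y1) (@cb_proj R X Y2).

Definition bundle_square : square :=
  @Square bundle_fprod Y2 Y1 X (fun w => (set_val w).1) (fun w => (set_val w).2)
    (@cb_proj R X Y1) (@cb_proj R X Y2) (fun w => set_valP w).

(* chi_1 * chi_2 : W^[2,2] = Y1^[2] *_X Y2^[2] -> U(1) * U(1) *)
Definition chi12 (w : grid bundle_square 2 2) : U1 R * U1 R :=
  let y ij : bundle_fprod := entry w ij in
  (difference (set_val (y (ord0, ord0))).1 (set_val (y (ord_max, ord0))).1,
   difference (set_val (y (ord0, ord0))).2 (set_val (y (ord0, ord_max))).2).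

Definition cup_bundle : line_data R (grid bundle_square 2 2) :=
  pullback chi12 (Sbundle R).

(* The pullbacks of the bimultiplicative structure of S. *)
Definition cup_triv1 (_ : grid bundle_square 3 2) (v : 'I_3 -> cup_bundle)
  : Cstar R := Striv1 (fun k => pull_vector (v k)).
Definition cup_triv2 (_ : grid bundle_square 2 3) (v : 'I_3 -> cup_bundle)
  : Cstar R := Striv2 (fun k => pull_vector (v k)).

End Decomposable.

(* Main.v *)
(* Logarithms linearize everything. If y = e^{2 pi i l} sigma(x) expresses a point
   y of a circle bundle in a local section sigma, a is a logarithm of the
   transition functions and n = delta a the integral Chern cocycle, then
   N = delta l + a is integral with delta N = n.  With these data for Y_1 and Y_2,
   the points (d_1 l_1, d_2 l_2, 1) of R^2 x C define local sections of L
   compatible with the bimultiplicative structure, because multiplication in S is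
   addition of the first two coordinates.  Changing charts moves these points by
   the integers (d_1 N_1, d_2 N_2), and the Z^2-action on R^2 x C gives the
   transition cocycle - d_1 d_2 gamma with gamma = l_1 cup N_2 mod Z.  The Leibniz
   rule then yields beta_1 = - l_1 cup n_2, beta_2 = - a_1 cup N_2 and
   alpha = a_1 cup n_2 mod Z, whose Bockstein is n_1 cup n_2.

   Independence of the choices on a given square cover is a diagram chase: two
   systems of local sections differ by a d_1- and d_2-closed function on
   W^[2,2], hence by d_1 d_2 of a function on W, and the remaining differences
   descend successively to Y_1, Y_2 and X. *)

Require Import Defs.
From mathcomp Require Import all_boot all_order all_algebra.
From mathcomp Require Import generic_quotient complex.
From mathcomp Require Import all_classical all_reals all_analysis.
From mathcomp Require Import ring lra zify.
Import Order.TTheory GRing.Theory Num.Theory.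
Import numFieldNormedType.Exports.

Set Implicit Arguments.
Unset Strict Implicit.
Unset Printing Implicit Defensive.

Local Open Scope classical_set_scope.
Local Open Scope ring_scope.
Local Open Scope complex_scope.

(** Multiplication in S is multiplication of fibre coordinates only over lifts to R^2 that add up
    exactly; lifts that add up modulo integers introduce factors e^{2 pi i m x}. So each grid
    receives one simultaneous choice of logarithms for all its rows and columns, relative to the
    first ones or to local sections, and the bigerbe identities become cancellations in iterated
    alternating sums. The factor e^{2 pi i m x} pairs an integral shift m in the second direction
    with a real coordinate x in the first. This is why gamma keeps l_1 real next to the integral
    N_2, and why alpha is a_1 cup n_2 and not the reverse. Two different square covers are never
    compared directly. One cocycle, over the cover that carries the Chern data, restricts to a
    representative on every sufficiently fine square cover, so that uniqueness is needed only on a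
    fixed one. Exactness there comes from the local sections of the square, which allow a row and a
    column to be adjoined to any grid. *)

(** * Alternating sums *)

Lemma altsum0 (M : zmodType) (f : 'I_0 -> M) : altsum f = 0.
Proof. exact: big_ord0. Qed.

Lemma altsum_recl (M : zmodType) n (f : 'I_n.+1 -> M) :
  altsum f = f ord0 - altsum (fun k => f (lift ord0 k)).
Proof.
rewrite /altsum big_ord_recl expr0 mulr1z -sumrN; congr (_ + _).
by apply: eq_bigr => k _; rewrite /= exprS mulN1r mulrNz.
Qed.

Lemma eq_altsum (M : zmodType) n (f g : 'I_n -> M) : f =1 g -> altsum f = altsum g.
Proof. by move=> fg; apply: eq_bigr => k _; rewrite fg. Qed.

Section AlternatingSums.
Variable M : zmodType.

Lemma ord3_1 : inord 1 = lift ord0 ord0 :> 'I_3.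
Proof. by apply: val_inj; rewrite /= inordK. Qed.

Lemma ord_max_lift n : ord_max = lift ord0 ord_max :> 'I_n.+2.
Proof. exact: val_inj. Qed.

Lemma altsum2 (f : 'I_2 -> M) : altsum f = f ord0 - f ord_max.
Proof.
rewrite !altsum_recl altsum0 subr0; congr (_ - f _); exact: val_inj.
Qed.

Lemma altsum3 (f : 'I_3 -> M) : altsum f = f ord0 - f (inord 1) + f ord_max.
Proof.
rewrite altsum_recl altsum2 opprB -ord_max_lift -ord3_1.
by rewrite [f ord_max - _]addrC addrA.
Qed.

Lemma altsumN n (f : 'I_n -> M) : altsum (fun k => - f k) = - altsum f.
Proof. by rewrite /altsum -sumrN; apply: eq_bigr => k _; rewrite mulNrz. Qed.

Lemma altsumD n (f g : 'I_n -> M) :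
  altsum (fun k => f k + g k) = altsum f + altsum g.
Proof. by rewrite /altsum -big_split; apply: eq_bigr => k _; rewrite mulrzDl. Qed.

Lemma altsumB n (f g : 'I_n -> M) :
  altsum (fun k => f k - g k) = altsum f - altsum g.
Proof. by rewrite altsumD altsumN. Qed.

Lemma altsum_eq0 n (f : 'I_n -> M) : (forall k, f k = 0) -> altsum f = 0.
Proof. by move=> f0; apply: big1 => k _; rewrite f0 mul0rz. Qed.

Lemma altsum_exchange m n (f : 'I_m -> 'I_n -> M) :
  altsum (fun k => altsum (f k)) = altsum (fun l => altsum (f^~ l)).
Proof.
elim: m f => [|m IH] f.
  by rewrite altsum0 altsum_eq0 // => l; rewrite altsum0.
rewrite altsum_recl IH -altsumB; apply: eq_altsum => l.
by rewrite [RHS]altsum_recl.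
Qed.

(** The cancellation behind d^2 = 0: the pairs [(k, l)] with [k <= l] and [(l + 1, k)] carry
    opposite signs and exhaust the index set. The induction peels off row 0, which cancels column
    0. *)
Lemma altsum_altsum n (f : 'I_n.+1 -> 'I_n -> M) :
  (forall (k : 'I_n.+1) (l : 'I_n) (k' : 'I_n.+1) (l' : 'I_n),
     (k <= l)%N -> k' = l.+1 :> nat -> l' = k :> nat ->
     f k l = f k' l') ->
  altsum (fun k => altsum (f k)) = 0.
Proof.
elim: n f => [|n IH] f H; first by rewrite altsum_recl !altsum0 subr0.
rewrite altsum_recl.
have -> : altsum (fun k => altsum (f (lift ord0 k))) =
    altsum (fun k => f (lift ord0 k) ord0 - altsum (fun l => f (lift ord0 k) (lift ord0 l))).
  by apply: eq_altsum => k; exact: altsum_recl.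
rewrite altsumB (@eq_altsum _ _ (f ord0) (fun l => f (lift ord0 l) ord0)) => [|l].
  rewrite opprB addrC subrK; apply: IH => k l k' l' kl ek el.
  by apply: H; rewrite /= /bump /= ?add1n ?ek ?el.
exact: H.
Qed.

End AlternatingSums.

(** The simplicial identity in the shape of the hypothesis of [altsum_altsum]: both composites skip
    the positions [k] and [l + 1]. *)
Lemma lift_lift n (k : 'I_n.+2) (l : 'I_n.+1) (k' : 'I_n.+2) (l' : 'I_n.+1) (i : 'I_n) :
  (k <= l)%N -> k' = l.+1 :> nat -> l' = k :> nat ->
  lift k (lift l i) = lift k' (lift l' i).
Proof.
move=> kl ek el; apply: val_inj; rewrite /= ek el /bump.
by case: (leqP l i) => li; case: (leqP k i) => ki; rewrite /= ?add0n ?add1n; lia.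
Qed.

(** * Continuity within a subset *)

Section WithinContinuity.
Implicit Types X Y Z : topologicalType.

Lemma withinP X Y (A : set X) (f : X -> Y) :
  {within A, continuous f} <->
  forall x, A x -> forall U, nbhs (f x) U -> nbhs x [set y | A y -> U (f y)].
Proof.
split=> [/subspace_continuousP cf x Ax U Ux|cf]; first exact: (cf x Ax U Ux).
by apply/subspace_continuousP => x Ax U Ux; exact: (cf x Ax U Ux).
Qed.

Lemma within_subset X Y (A B : set X) (f : X -> Y) :
  A `<=` B -> {within B, continuous f} -> {within A, continuous f}.
Proof. exact: continuous_subspaceW. Qed.

Lemma within_eq X Y (A : set X) (f g : X -> Y) :
  (forall x, A x -> f x = g x) ->
  {within A, continuous f} -> {within A, continuous g}.
Proof. by move=> fg; apply: subspace_eq_continuous => x; rewrite inE => /fg. Qed.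

Lemma within_continuous X Y (A : set X) (f : X -> Y) :
  continuous f -> {within A, continuous f}.
Proof. exact: continuous_subspaceT. Qed.

Lemma within_id X (A : set X) : {within A, continuous (fun x : X => x)}.
Proof. by apply: within_continuous => x; exact: cvg_id. Qed.

Lemma within_cst X Y (A : set X) (y : Y) : {within A, continuous (fun _ : X => y)}.
Proof. by apply: within_continuous; exact: cst_continuous. Qed.

Lemma within_comp X Y Z (A : set X) (B : set Y) (f : X -> Y) (g : Y -> Z) :
  (forall x, A x -> B (f x)) -> {within A, continuous f} ->
  {within B, continuous g} -> {within A, continuous (fun x => g (f x))}.
Proof.
move=> AB /withinP cf /withinP cg; apply/withinP => x Ax U Ux.
have := cf _ Ax _ (cg _ (AB _ Ax) _ Ux).
by apply: filterS => y h Ay; exact: h (AB _ Ay).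
Qed.

Lemma within_comp_continuous X Y Z (A : set X) (f : X -> Y) (g : Y -> Z) :
  continuous g -> {within A, continuous f} ->
  {within A, continuous (fun x => g (f x))}.
Proof.
by move=> cg cf; apply: (@within_comp _ _ _ _ setT _ _ _ cf) => //; exact: within_continuous.
Qed.

Lemma within_pair X Y Z (A : set X) (f : X -> Y) (g : X -> Z) :
  {within A, continuous f} -> {within A, continuous g} ->
  {within A, continuous (fun x => (f x, g x))}.
Proof.
move=> /subspace_continuousP cf /subspace_continuousP cg.
by apply/subspace_continuousP => x Ax; apply: cvg_pair; [exact: cf|exact: cg].
Qed.

Lemma within_fst X Y Z (A : set X) (f : X -> (Y * Z)%type) :
  {within A, continuous f} -> {within A, continuous (fun x => (f x).1)}.
Proof. by apply: within_comp_continuous => x; exact: cvg_fst. Qed.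

Lemma within_snd X Y Z (A : set X) (f : X -> (Y * Z)%type) :
  {within A, continuous f} -> {within A, continuous (fun x => (f x).2)}.
Proof. by apply: within_comp_continuous => x; exact: cvg_snd. Qed.

Lemma within_local X Y (A : set X) (f : X -> Y) :
  (forall x, A x -> exists U, [/\ open U, U x & {within A `&` U, continuous f}]) ->
  {within A, continuous f}.
Proof.
move=> loc; apply/withinP => x Ax V Vfx.
have [U [oU Ux /withinP/(_ x (conj Ax Ux) V Vfx)]] := loc x Ax.
have : nbhs x U by exact: open_nbhs_nbhs.
by apply: filterS2 => y Uy h Ay; exact: h (conj Ay Uy).
Qed.

Lemma within_val X Y (A : set X) (B : set Y) (f : X -> B) :
  {within A, continuous (fun x => set_val (f x))} -> {within A, continuous f}.
Proof. exact: (@continuous_comp_initial _ (subspace A) Y (set_val : B -> Y)). Qed.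

Lemma set_val_continuous Y (B : set Y) : continuous (set_val : B -> Y).
Proof. exact: initial_continuous. Qed.

Lemma within_ptws X (I : eqType) Y (A : set X) (f : X -> {ptws I -> Y}) :
  (forall i, {within A, continuous (fun x => f x i)}) -> {within A, continuous f}.
Proof.
move=> cf; apply/subspace_continuousP => x Ax; apply/cvg_sup => i.
move=> U [_ [[V oV <-] Vfx VU]].
move/withinP : (cf i) => /(_ x Ax V (open_nbhs_nbhs (conj oV Vfx))).
by apply: filterS => y h Ay; exact: VU (h Ay).
Qed.

Lemma ptws_continuous (I : eqType) Y (i : I) :
  continuous (fun f : {ptws I -> Y} => f i).
Proof. exact: (@proj_continuous I (fun=> Y) i). Qed.

Lemma open_preimage_within X Y (A : set X) (f : X -> Y) (V : set Y) :
  open A -> {within A, continuous f} -> open V -> open (A `&` f @^-1` V).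
Proof.
move=> oA cf; move: V; apply/(continuous_inP _ oA).
by rewrite -continuous_open_subspace.
Qed.

Lemma open_setX X Y (A : set X) (B : set Y) : open A -> open B -> open (A `*` B).
Proof.
move=> oA oB; rewrite (_ : A `*` B = fst @^-1` A `&` snd @^-1` B) //.
by apply: openI; apply: open_comp => // p _; [exact: cvg_fst|exact: cvg_snd].
Qed.

End WithinContinuity.

Section WithinAlgebra.
Variables (X : topologicalType) (A : set X).

Lemma withinD (M : topologicalZmodType) (f g : X -> M) :
  {within A, continuous f} -> {within A, continuous g} ->
  {within A, continuous (fun x => f x + g x)}.
Proof.
move=> cf cg; apply: (@within_comp_continuous _ _ _ A (fun x => (f x, g x)) (fun p => p.1 + p.2)).
  exact: add_continuous.
exact: within_pair.
Qed.

Lemma withinN (M : topologicalZmodType) (f : X -> M) :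
  {within A, continuous f} -> {within A, continuous (fun x => - f x)}.
Proof. by apply: within_comp_continuous; exact: opp_continuous. Qed.

Lemma withinB (M : topologicalZmodType) (f g : X -> M) :
  {within A, continuous f} -> {within A, continuous g} ->
  {within A, continuous (fun x => f x - g x)}.
Proof. by move=> cf cg; apply: withinD => //; exact: withinN. Qed.

Lemma within_altsum (M : topologicalZmodType) n (f : 'I_n -> X -> M) :
  (forall k, {within A, continuous (f k)}) ->
  {within A, continuous (fun x => altsum (fun k => f k x))}.
Proof.
elim: n f => [|n IH] f cf.
  by under eq_fun do rewrite altsum0; exact: within_cst.
under eq_fun do rewrite altsum_recl.
by apply: withinB; [exact: cf|exact: (IH (fun k => f (lift ord0 k)))].
Qed.

Lemma withinM (K : numFieldType) (f g : X -> K^o) :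
  {within A, continuous f} -> {within A, continuous g} ->
  {within A, continuous (fun x => f x * g x : K^o)}.
Proof.
move=> /subspace_continuousP cf /subspace_continuousP cg.
by apply/subspace_continuousP => x Ax; apply: cvgM; [exact: cf|exact: cg].
Qed.

Lemma withinV (K : numFieldType) (f : X -> K^o) : (forall x, A x -> f x != 0) ->
  {within A, continuous f} -> {within A, continuous (fun x => (f x)^-1 : K^o)}.
Proof.
move=> f0 /subspace_continuousP cf.
by apply/subspace_continuousP => x Ax; apply: cvgV; [exact: f0|exact: cf].
Qed.

End WithinAlgebra.

(** * The circle group and logarithms *)

Section ComplexContinuity.
Variable R : realType.

Lemma norm_real_complex (x : R) : `|x%:C| = `|x|%:C :> R[i].
Proof. by rewrite normc_def /= expr0n addr0 sqrtr_sqr. Qed.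

Lemma real_complex_continuous : continuous (fun x : R => x%:C : R[i]^o).
Proof.
(* A positive [e] in [R[i]] is real, so its imaginary part is eliminated first. *)
move=> x; apply/cvgrPdist_lt => /= e; case: e => e e'; rewrite ltcE /= => /andP[/eqP -> e0].
near=> t; rewrite -[_ - _]/(x%:C - t%:C) -rmorphB norm_real_complex ltcR.
by near: t; exact: (@cvgr_dist_lt _ _ _ (nbhs x) _ id x cvg_id).
Unshelve. all: by end_near. Qed.

Lemma near_dist_lt (z : R[i]^o) (e : R) : 0 < e ->
  nbhs z [set t : R[i]^o | `|z - t| < e%:C].
Proof. by move=> e0; apply: nbhsx_ballx; rewrite ltcR. Qed.

Lemma Re_continuous : continuous (fun z : R[i]^o => complex.Re z : R).
Proof.
move=> z U /= /nbhs_ballP[e /= e0 eU].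
apply: (@filterS _ (nbhs z) (nbhs_filter z) _ _ _ (near_dist_lt z e0)) => t /= zt.
apply: eU; rewrite /ball /= -ltcR -raddfB.
exact: le_lt_trans (normc_ge_Re (z - t)) zt.
Qed.

Lemma Im_continuous : continuous (fun z : R[i]^o => complex.Im z : R).
Proof.
move=> z U /= /nbhs_ballP[e /= e0 eU].
apply: (@filterS _ (nbhs z) (nbhs_filter z) _ _ _ (near_dist_lt z e0)) => t /= zt.
apply: eU; rewrite /ball /= -ltcR -raddfB /=; have -> : complex.Im (z - t) = complex.Re (- 'i%C * (z - t)).
  by case: (z - t) => a b /=; simpc.
apply: le_lt_trans (normc_ge_Re _) _.
by rewrite normrM normrN normc_def /= expr0n expr1n add0r sqrtr1 mul1r.
Qed.

Lemma within_Complex (X : topologicalType) (A : set X) (f g : X -> R) :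
  {within A, continuous f} -> {within A, continuous g} ->
  {within A, continuous (fun x => f x +i* g x : R[i]^o)}.
Proof.
move=> cf cg; apply: (@within_eq _ _ A (fun x => (f x)%:C + 'i * (g x)%:C : R[i]^o)).
  by move=> x _; rewrite [RHS]complexE.
apply: (@withinD _ _ R[i]^o).
  exact: within_comp_continuous real_complex_continuous cf.
apply: withinM; first exact: within_cst.
exact: within_comp_continuous real_complex_continuous cg.
Qed.

Lemma cis_continuous : continuous (@cis R : R -> R[i]^o).
Proof.
apply/continuous_subspace_setT/within_Complex; apply: within_comp_continuous.
- exact: continuous_cos.
- by apply: within_continuous; exact: mulrl_continuous.
- exact: continuous_sin.
- by apply: within_continuous; exact: mulrl_continuous.
Qed.

Lemma u1val_continuous : continuous (@u1val R : U1 R -> R[i]^o).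
Proof. exact: set_val_continuous. Qed.

Lemma u1_cis_continuous : continuous (@u1_cis R).
Proof.
apply/continuous_subspace_setT/within_val; apply: within_continuous.
exact: cis_continuous.
Qed.

Lemma u1val_inj : injective (@u1val R).
Proof. exact: val_inj. Qed.

Lemma u1_mulA : associative (@u1_mul R).
Proof. by move=> u v w; apply: u1val_inj; exact: mulrA. Qed.

Lemma u1_mulC : commutative (@u1_mul R).
Proof. by move=> u v; apply: u1val_inj; exact: mulrC. Qed.

Lemma u1_mul1 : left_id (u1_one R) (@u1_mul R).
Proof. by move=> u; apply: u1val_inj; exact: mul1r. Qed.

Lemma u1_inv_subproof (u : U1 R) : `|(u1val u)^-1| = 1.
Proof. by rewrite normfV u1val_norm invr1. Qed.
Definition u1_inv (u : U1 R) : U1 R := u1mk (u1_inv_subproof u).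

Lemma u1val_neq0 (u : U1 R) : u1val u != 0.
Proof. by rewrite -normr_eq0 u1val_norm oner_eq0. Qed.

Lemma u1_mulV (u : U1 R) : u1_mul u (u1_inv u) = u1_one R.
Proof. by apply: u1val_inj; exact: (mulfV (u1val_neq0 u)). Qed.

Lemma u1_mulK (u v : U1 R) : u1_mul (u1_mul v (u1_inv u)) u = v.
Proof. by rewrite -u1_mulA [u1_mul _ u]u1_mulC u1_mulV u1_mulC u1_mul1. Qed.

Lemma u1_mulI (w u v : U1 R) : u1_mul u w = u1_mul v w -> u = v.
Proof.
move=> e; have := congr1 (fun z => u1_mul z (u1_inv w)) e.
by rewrite -!u1_mulA u1_mulV !(u1_mulC _ (u1_one R)) !u1_mul1.
Qed.

Lemma within_u1_mul (X : topologicalType) (A : set X) (f g : X -> U1 R) :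
  {within A, continuous f} -> {within A, continuous g} ->
  {within A, continuous (fun x => u1_mul (f x) (g x))}.
Proof.
move=> cf cg; apply: within_val; apply: withinM.
  exact: within_comp_continuous u1val_continuous cf.
exact: within_comp_continuous u1val_continuous cg.
Qed.

Lemma within_u1_inv (X : topologicalType) (A : set X) (f : X -> U1 R) :
  {within A, continuous f} -> {within A, continuous (fun x => u1_inv (f x))}.
Proof.
move=> cf; apply: within_val; apply: withinV => [x _|]; first exact: u1val_neq0.
exact: within_comp_continuous u1val_continuous cf.
Qed.

Lemma within_u1_cs (X : topologicalType) (A : set X) (f : X -> U1 R) :
  {within A, continuous f} -> {within A, continuous (fun x => u1_cs (f x))}.
Proof.
move=> cf; apply: within_val.
exact: within_comp_continuous u1val_continuous cf.
Qed.

Lemma u1_cisD (x y : R) : u1_cis (x + y) = u1_mul (u1_cis x) (u1_cis y).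
Proof. by apply: u1val_inj; exact: cisD. Qed.

Lemma twopi_neq0 : (trigo.pi *+ 2 : R) != 0.
Proof. by rewrite mulrn_eq0 /= gt_eqF // pi_gt0. Qed.

Lemma u1_cis_surj (u : U1 R) : exists x, u1_cis x = u.
Proof.
case E : (u1val u) => [a b].
have n1 : a ^+ 2 + b ^+ 2 = 1.
  have := u1val_norm u; rewrite E normc_def /= => /complexI h.
  by rewrite -[LHS]sqr_sqrtr ?h ?expr1n // addr_ge0 ?sqr_ge0 //.
have ra : -1 <= a <= 1.
  by rewrite -ler_norml -(@expr_le1 _ 2) // -normrX ger0_norm ?sqr_ge0 // -n1 lerDl sqr_ge0.
pose t := acos a.
have ct : cos t = a by apply: acosK; rewrite in_itv /=.
have st : sin t = `|b|.
  by rewrite /t sin_acos // (_ : 1 - a ^+ 2 = b ^+ 2) ?sqrtr_sqr // -n1 addrC addKr.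
(* [acos] gives an angle in the upper half circle and the sign of [b] selects the half. For [b = 0]
   that sign vanishes, and the second summand supplies the angle 0 or pi. *)
exists (Num.sg b * t / (trigo.pi *+ 2) + (b == 0)%:R * (t / (trigo.pi *+ 2))).
apply: u1val_inj; rewrite E [LHS]/(cis _) /cis mulrDr.
rewrite mulrC divfK ?twopi_neq0 //.
have [b0|b0] := eqVneq b 0.
  by rewrite b0 sgr0 mul0r add0r mul1r mulrC divfK ?twopi_neq0 // ct st b0 normr0.
rewrite mul0r mulr0 addr0; congr (_ +i* _); first by rewrite cos_sg.
by rewrite sin_sg st mulr_sg_norm.
Qed.

(** Rotation by the inverse of [u0] moves a neighbourhood of [u0] into the right half plane, where
    [atan] of the slope is a continuous argument; a logarithm [x0] of [u0] is then added back. *)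
Lemma u1_local_log (u0 : U1 R) : exists A : set (U1 R), [/\ open A, A u0 &
  exists2 l : U1 R -> R, {within A, continuous l} &
    forall u, A u -> u1_cis (l u) = u].
Proof.
have [x0 hx0] := u1_cis_surj u0.
pose rot u := u1_mul u (u1_inv u0).
have crot A : {within A, continuous rot}.
  by apply: within_u1_mul; [exact: within_id|exact: within_cst].
pose re u : R := complex.Re (u1val (rot u)); pose im u : R := complex.Im (u1val (rot u)).
have cre A : {within A, continuous re}.
  apply: within_comp_continuous Re_continuous _.
  exact: within_comp_continuous u1val_continuous (crot A).
have cim A : {within A, continuous im}.
  apply: within_comp_continuous Im_continuous _.
  exact: within_comp_continuous u1val_continuous (crot A).
pose A := [set u | 0 < re u].
have oA : open A.
  rewrite (_ : A = setT `&` re @^-1` [set r | 0 < r]); last by rewrite setTI.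
  by apply: (open_preimage_within openT) => //; exact: open_gt.
exists A; split => //; first by rewrite /A /= /re /rot u1_mulV ltr01.
exists (fun u => x0 + atan (im u / re u) / (trigo.pi *+ 2)).
  apply: (@withinD _ _ R); first exact: within_cst.
  apply: (@withinM _ _ R); last exact: within_cst.
  apply: within_comp_continuous; first by move=> x; exact: continuous_atan.
  apply: (@withinM _ _ R) => //; apply: (@withinV _ _ R) => // u.
  by rewrite /A /= => /gt_eqF ->.
move=> u Au; rewrite u1_cisD hx0 -[RHS](u1_mulK u0) u1_mulC; congr u1_mul.
apply: u1val_inj; rewrite [LHS]/(cis _) /cis mulrC divfK ?twopi_neq0 //.
have n1 : re u ^+ 2 + im u ^+ 2 = 1.
  have := u1val_norm (rot u); rewrite normc_def /= => /complexI h.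
  by rewrite -[LHS]sqr_sqrtr ?h ?expr1n // addr_ge0 ?sqr_ge0.
have r0 : re u != 0 by rewrite gt_eqF.
have ca : cos (atan (im u / re u)) = re u.
  rewrite cos_atan (_ : 1 + _ = (re u)^-1 ^+ 2).
    by rewrite sqrtr_sqr gtr0_norm ?invr_gt0 // invrK.
  rewrite expr_div_n -{1}(@divff _ (re u ^+ 2)) ?expf_neq0 // -mulrDl n1.
  by rewrite mul1r exprVn.
have sa : sin (atan (im u / re u)) = im u.
  have := atanK (im u / re u); rewrite /tan ca => /(congr1 ( *%R^~ (re u))).
  by rewrite !divfK.
by rewrite ca sa /re /im; case: (u1val (rot u)).
Qed.

End ComplexContinuity.

Section CstarLemmas.
Variable R : realType.

Lemma csvalD (u v : Cstar R) : csval (u + v) = csval u * csval v.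
Proof. by []. Qed.

Definition ccis (x : R) : Cstar R := u1_cs (u1_cis x).

Lemma ccisD x y : ccis (x + y) = ccis x + ccis y.
Proof. by apply: csval_inj; exact: cisD. Qed.

Lemma ccis_int (n : int) : ccis n%:~R = 0.
Proof. by apply: csval_inj; exact: cis_int. Qed.

Lemma ccisN x : ccis (- x) = - ccis x.
Proof.
by apply/eqP; rewrite -subr_eq0 opprK -ccisD addNr; apply/eqP; exact: (ccis_int 0).
Qed.

Lemma ccisB x y : ccis (x - y) = ccis x - ccis y.
Proof. by rewrite ccisD ccisN. Qed.

Lemma ccis0 : ccis 0 = 0. Proof. exact: (ccis_int 0). Qed.

Lemma ccis_altsum n (f : 'I_n -> R) :
  ccis (altsum f) = altsum (fun k => ccis (f k)).
Proof.
elim: n f => [|n IH] f; first by rewrite !altsum0 ccis0.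
by rewrite !altsum_recl ccisB IH.
Qed.

Lemma csval_cexp (a : R[i]) : csval (cexp a) =
  (expR (- (trigo.pi *+ 2 * complex.Im a)))%:C * cis (complex.Re a).
Proof. by []. Qed.

Lemma cexp_real (x : R) : cexp x%:C = ccis x.
Proof.
by apply: csval_inj; rewrite csval_cexp mulr0 oppr0 expR0 mul1r.
Qed.

(** The Bockstein uses complex logarithms. Since [u] has modulus 1, the positive real factor of
    [cexp a] equals 1, and the real part of [a] is already a logarithm. *)
Lemma u1_cs_cexp (u : U1 R) (a : R[i]) :
  u1_cs u = cexp a -> u = u1_cis (complex.Re a).
Proof.
move=> /(congr1 (@csval R)); rewrite csval_cexp [LHS]/(u1val u) => E.
apply: u1val_inj; rewrite [LHS]E [RHS]/(cis _).
have := congr1 (fun z => `|z|) E; rewrite u1val_norm normrM normc_cis mulr1.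
rewrite norm_real_complex gtr0_norm ?expR_gt0 // => <-.
by rewrite mul1r.
Qed.

Lemma within_ccis (X : topologicalType) (A : set X) (f : X -> R) :
  {within A, continuous f} -> {within A, continuous (fun x => ccis (f x))}.
Proof.
by move=> cf; apply: within_u1_cs; exact: within_comp_continuous (@u1_cis_continuous R) cf.
Qed.

End CstarLemmas.

(** * Circle bundles and line bundles *)

Section CircleBundles.
Variable R : realType.

(** Subtracting the integral part leaves [r] in [0, 1). Then cos (2 pi r) = 1 forces sin (pi r) = 0,
    whereas the sine is positive on the open interval from 0 to pi. *)
Lemma u1_cis_eq1 (x : R) : u1_cis x = u1_one R -> exists n : int, x = n%:~R.
Proof.
move=> /(congr1 (@u1val R)) e; exists (Num.floor x); apply/eqP; rewrite -subr_eq0.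
set r := x - _.
have r0 : 0 <= r by rewrite subr_ge0; exact: floor_le_tmp.
have r1 : r < 1 by rewrite ltrBlDl; have := lt_succ_floor x; rewrite intrD.
have : cis r = 1 by rewrite /r -mulrNz cisD cis_int mulr1; exact: e.
rewrite /cis mulrnAl => /(congr1 (@complex.Re R)) /=.
rewrite cos_mulr2n cos2sin2 => e1.
have s0 : sin (trigo.pi * r) = 0.
  by apply/eqP; rewrite -sqrf_eq0; apply/eqP; move: e1; rewrite mulr2n; lra.
rewrite eq_le r0 andbT leNgt; apply/negP => rp.
suff : 0 < sin (trigo.pi * r) by rewrite s0 ltxx.
apply: sin_gt0_pi; rewrite mulr_gt0 ?pi_gt0 //=.
by rewrite -[ltRHS]mulr1 ltr_pM2l ?pi_gt0.
Qed.

Lemma u1_cis_inj (x y : R) : u1_cis x = u1_cis y -> exists n : int, x = y + n%:~R.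
Proof.
move=> e; have [n nE] : exists n : int, x - y = n%:~R.
  apply: u1_cis_eq1; apply: (@u1_mulI _ (u1_cis y)).
  by rewrite -u1_cisD subrK u1_mul1.
by exists n; rewrite -nE addrC subrK.
Qed.

Variables (X : topologicalType) (Y : circle_bundle R X).
Implicit Types y : Y.

Lemma cb_proj_continuous : continuous (@cb_proj R X Y).
Proof. by case: (cb_locally_trivial Y). Qed.

Lemma cb_chart (b : X) : exists U : set X, [/\ open U, U b &
    exists (phi : X * U1 R -> Y) (psi : Y -> U1 R),
      [/\ {within U `*` [set: U1 R], continuous phi},
          {within @cb_proj R X Y @^-1` U, continuous psi},
          (forall x z, U x -> cb_proj (phi (x, z)) = x /\ psi (phi (x, z)) = z),
          (forall y, U (cb_proj y) -> phi (cb_proj y, psi y) = y) &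
          (forall u y, U (cb_proj y) -> cb_act u y = phi (cb_proj y, u1_mul u (psi y)))]].
Proof.
have [_ /(_ b)[U [oU Ub [phi [psi [h1 h2 h3 h4 h5]]]]]] := cb_locally_trivial Y.
exists U; split=> //; exists phi, psi; split=> // u y Uy.
by rewrite h5 // h4.
Qed.

Lemma cb_act_proj u y : cb_proj (cb_act u y) = cb_proj y.
Proof.
have [U [oU Uy [phi [psi [_ _ h3 _ h5]]]]] := cb_chart (cb_proj y).
by rewrite h5 //; case: (h3 (cb_proj y) (u1_mul u (psi y)) Uy).
Qed.

(** The action laws are not fields of [circle_bundle]; they are transported through a chart from the
    translations of U(1). *)
Lemma cb_actM u v y : cb_act (u1_mul u v) y = cb_act u (cb_act v y).
Proof.
have [U [oU Uy [phi [psi [_ _ h3 _ h5]]]]] := cb_chart (cb_proj y).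
rewrite (h5 (u1_mul u v)) // (h5 u) ?cb_act_proj // (h5 v) // -u1_mulA.
by have [_ ->] := h3 (cb_proj y) (u1_mul v (psi y)) Uy.
Qed.

Lemma difference_spec y1 y2 : cb_proj y1 = cb_proj y2 ->
  cb_act (difference y1 y2) y1 = y2.
Proof.
move=> e; rewrite /difference; case: xgetP => [u _ //|] h.
have [U [oU Uy [phi [psi [_ _ h3 h4 h5]]]]] := cb_chart (cb_proj y1).
case: (h (u1_mul (psi y2) (u1_inv (psi y1)))) => /=.
by rewrite h5 // u1_mulK e h4 // -e.
Qed.

Lemma cb_act_inj u v y : cb_act u y = cb_act v y -> u = v.
Proof.
have [U [oU Uy [phi [psi [_ _ h3 _ h5]]]]] := cb_chart (cb_proj y).
rewrite !h5 // => /(congr1 psi).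
have [_ ->] := h3 (cb_proj y) (u1_mul u (psi y)) Uy.
have [_ ->] := h3 (cb_proj y) (u1_mul v (psi y)) Uy.
exact: u1_mulI.
Qed.

Lemma difference_act u y : difference y (cb_act u y) = u.
Proof. by apply: (@cb_act_inj _ _ y); rewrite difference_spec ?cb_act_proj. Qed.

Lemma differenceM y0 y1 y2 : cb_proj y0 = cb_proj y1 -> cb_proj y0 = cb_proj y2 ->
  u1_mul (difference y0 y1) (difference y1 y2) = difference y0 y2.
Proof.
move=> e1 e2; apply: (@cb_act_inj _ _ y0).
by rewrite u1_mulC cb_actM !difference_spec // -e1.
Qed.

(** [difference] is defined by choice, but in a chart it equals the quotient of [psi (g z)] by
    [psi (f z)], which is visibly continuous. *)
Lemma within_difference (Z : topologicalType) (A : set Z) (f g : Z -> Y) :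
  (forall z, A z -> cb_proj (f z) = cb_proj (g z)) ->
  {within A, continuous f} -> {within A, continuous g} ->
  {within A, continuous (fun z => difference (f z) (g z))}.
Proof.
move=> fg cf cg; apply/withinP => z Az.
have [U [oU Uz [phi [psi [_ c2 h3 h4 h5]]]]] := cb_chart (cb_proj (f z)).
have cpf : {within A, continuous (fun z => cb_proj (f z))}.
  by apply: within_comp_continuous cf; exact: cb_proj_continuous.
pose B := A `&` [set z | U (cb_proj (f z))].
have cB : {within B, continuous (fun z => u1_mul (psi (g z)) (u1_inv (psi (f z))))}.
  apply: within_u1_mul; last apply: within_u1_inv.
    apply: within_comp c2; last by apply: within_subset cg => ? [].
    by move=> t [At /=]; rewrite fg.
  apply: within_comp c2; last by apply: within_subset cf => ? [].
  by move=> t [].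
have dE t : B t -> u1_mul (psi (g t)) (u1_inv (psi (f t))) = difference (f t) (g t).
  move=> [At Ut]; apply: (@cb_act_inj _ _ (f t)); rewrite difference_spec ?fg //.
  by rewrite h5 // u1_mulK fg // h4 // -fg.
move=> V; rewrite -dE // => hV.
have := (withinP _ _).1 cB z (conj Az Uz) V hV.
have := (withinP _ _).1 cpf z Az U (open_nbhs_nbhs (conj oU Uz)).
apply: filterS2 => t Ut Vt At; have Bt : B t by split=> //; exact: Ut.
by rewrite -dE //; exact: Vt.
Qed.

Lemma cb_locally_split : locally_split (@cb_proj R X Y).
Proof.
split; first exact: cb_proj_continuous.
  move=> x; have [U [oU Ux [phi [psi [_ _ h3 _ _]]]]] := cb_chart x.
  by exists (phi (x, u1_one R)); case: (h3 x (u1_one R) Ux).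
move=> x; have [U [oU Ux [phi [psi [c1 _ h3 _ _]]]]] := cb_chart x.
exists U; split=> //; exists (fun x => phi (x, u1_one R)) => [|u Uu].
  apply: within_comp c1; first by move=> t Ut; split.
  by apply: within_pair; [exact: within_id|exact: within_cst].
by case: (h3 u (u1_one R) Uu).
Qed.

End CircleBundles.

Section LineBundles.
Variables (R : realType) (B : topologicalType) (L : line_data R B).
Hypothesis Lb : is_line_bundle L.
Implicit Types u v : L.

Lemma lb_proj_continuous : continuous (@lb_proj R B L).
Proof. by case: Lb. Qed.

Lemma lb_chart (b : B) : exists U : set B, [/\ open U, U b &
    exists (phi : B * R[i]^o -> L) (psi : L -> R[i]^o),
      [/\ {within U `*` [set: R[i]^o], continuous phi},
          {within @lb_proj R B L @^-1` U, continuous psi},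
          (forall x z, U x -> lb_proj (phi (x, z)) = x /\ psi (phi (x, z)) = z),
          (forall v, U (lb_proj v) -> phi (lb_proj v, psi v) = v) &
          (forall c v, U (lb_proj v) -> lb_scale c v = phi (lb_proj v, c * psi v))]].
Proof.
have [_ /(_ b)[U [oU Ub [phi [psi [h1 h2 h3 h4 h5]]]]]] := Lb.
exists U; split=> //; exists phi, psi; split=> // c v Uv.
by rewrite h5 // h4.
Qed.

Lemma frame_chart (U : set B) (phi : B * R[i]^o -> L) (psi : L -> R[i]^o) b v :
  (forall x z, U x -> lb_proj (phi (x, z)) = x /\ psi (phi (x, z)) = z) ->
  (forall c v, U (lb_proj v) -> lb_scale c v = phi (lb_proj v, c * psi v)) ->
  (forall v, U (lb_proj v) -> phi (lb_proj v, psi v) = v) ->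
  U b -> lb_proj v = b -> frame b v <-> psi v != 0.
Proof.
move=> h3 h5 h4 Ub vb; rewrite /frame vb h5 ?vb // mul0r; split.
  move=> [_ h]; apply/eqP => e; apply: h; rewrite -e -vb h4 // vb //.
move=> v0; split=> // e; move: v0; rewrite -e.
by have [_ ->] := h3 b 0 Ub; rewrite eqxx.
Qed.

Lemma frame_scale b u (c : Cstar R) : frame b u -> frame b (cs_scale c u).
Proof.
move=> fu; have [U [oU Ub [phi [psi [_ _ h3 h4 h5]]]]] := lb_chart b.
have u0 := (frame_chart h3 h5 h4 Ub fu.1).1 fu.
apply/(frame_chart h3 h5 h4 Ub); first by rewrite lb_scale_proj fu.1.
rewrite /cs_scale h5 ?fu.1 //; have [_ ->] := h3 b (csval c * psi u) Ub.
by rewrite mulf_neq0 ?csval_neq0.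
Qed.

Lemma frame_ratioP b u v : frame b u -> frame b v ->
  cs_scale (frame_ratio u v) u = v.
Proof.
move=> fu fv; rewrite /frame_ratio; case: xgetP => [c _ //|] h.
have [U [oU Ub [phi [psi [_ _ h3 h4 h5]]]]] := lb_chart b.
have u0 := (frame_chart h3 h5 h4 Ub fu.1).1 fu.
have v0 := (frame_chart h3 h5 h4 Ub fv.1).1 fv.
have c0 : psi v / psi u != 0 by rewrite mulf_neq0 ?invr_eq0.
case: (h (csmk c0)); rewrite /cs_scale /= h5 ?fu.1 //.
by rewrite [csval _]/(psi v / psi u) divfK // -fv.1 h4 // fv.1.
Qed.

Lemma cs_scale_inj b u c d : frame b u -> cs_scale c u = cs_scale d u -> c = d.
Proof.
move=> fu; have [U [oU Ub [phi [psi [_ _ h3 h4 h5]]]]] := lb_chart b.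
have u0 := (frame_chart h3 h5 h4 Ub fu.1).1 fu.
rewrite /cs_scale !h5 ?fu.1 // => /(congr1 psi).
have [_ ->] := h3 b (csval c * psi u) Ub; have [_ ->] := h3 b (csval d * psi u) Ub.
by move=> /(mulIf u0) /csval_inj.
Qed.

Lemma frame_ratio_eq b u c : frame b u -> frame b (cs_scale c u) ->
  frame_ratio u (cs_scale c u) = c.
Proof. by move=> fu fc; apply: (cs_scale_inj fu); exact: frame_ratioP fu fc. Qed.

Lemma cs_scaleD u c d : cs_scale (c + d) u = cs_scale c (cs_scale d u).
Proof.
have [U [oU Ub [phi [psi [_ _ h3 h4 h5]]]]] := lb_chart (lb_proj u).
rewrite /cs_scale (h5 (csval (c + d))) // (h5 (csval c)) ?lb_scale_proj //.
rewrite (h5 (csval d)) // csvalD -mulrA.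
by have [_ ->] := h3 (lb_proj u) (csval d * psi u) Ub.
Qed.

Lemma frame_ratioD b u v w : frame b u -> frame b v -> frame b w ->
  frame_ratio u w = frame_ratio u v + frame_ratio v w.
Proof.
move=> fu fv fw; apply: (cs_scale_inj fu).
by rewrite (frame_ratioP fu fw) addrC cs_scaleD (frame_ratioP fu fv) (frame_ratioP fv fw).
Qed.

(** As for circle bundles, the chosen scalar is in a chart the quotient of [psi (t z)] by
    [psi (s z)]; the denominator is nonzero because [s z] is a frame. *)
Lemma within_frame_ratio (Z : topologicalType) (A : set Z) (h : Z -> B) (s t : Z -> L) :
  (forall z, A z -> frame (h z) (s z)) -> (forall z, A z -> frame (h z) (t z)) ->
  {within A, continuous s} -> {within A, continuous t} ->
  {within A, continuous (fun z => frame_ratio (s z) (t z))}.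
Proof.
move=> fs ft cs ct; apply: within_val; apply/withinP => z Az.
have [U [oU Uz [phi [psi [_ c2 h3 h4 h5]]]]] := lb_chart (h z).
pose D := A `&` [set z | U (lb_proj (s z))].
have sD r : D r -> U (h r) by move=> [Ar]; rewrite /= (fs _ Ar).1.
have ps0 r : D r -> psi (s r) != 0.
  by move=> Dt; case: (Dt) => At _; apply: (frame_chart h3 h5 h4 (sD _ Dt) (fs _ At).1).1; exact: fs.
have cD : {within D, continuous (fun z => psi (t z) / psi (s z) : R[i]^o)}.
  apply: withinM; last apply: withinV => //.
    apply: within_comp c2; last by apply: within_subset ct => ? [].
    by move=> r Dr; rewrite /= (ft _ Dr.1).1; exact: sD.
  apply: within_comp c2; last by apply: within_subset cs => ? [].
  by move=> r [].
have dE r : D r -> psi (t r) / psi (s r) = csval (frame_ratio (s r) (t r)).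
  move=> Dr; have := frame_ratioP (fs _ Dr.1) (ft _ Dr.1).
  rewrite /cs_scale h5 ?(fs _ Dr.1).1 //; last exact: sD.
  move=> /(congr1 psi).
  have [_ ->] := h3 (h r) (csval (frame_ratio (s r) (t r)) * psi (s r)) (sD _ Dr).
  by move=> <-; rewrite mulfK // ps0.
have Dz : D z by split=> //=; rewrite (fs _ Az).1.
move=> V; rewrite -[set_val _]/(csval _) -dE // => hV.
have := (withinP _ _).1 cD z Dz V hV.
have cp : {within A, continuous (fun z => lb_proj (s z))}.
  by apply: within_comp_continuous cs; exact: lb_proj_continuous.
have nU := (withinP _ _).1 cp z Az U (open_nbhs_nbhs (conj oU Dz.2)).
apply: filterS2 nU => r Ur Vr Ar.
have Dr : D r by split=> //; exact: Ur.
by rewrite -[set_val _]/(csval _) -dE //; exact: Vr.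
Qed.

End LineBundles.

Section PullbackBundle.
Variables (R : realType) (B' B : topologicalType) (f : B' -> B) (L : line_data R B).

Lemma pullP (v : pullback f L) : f (lb_proj v) = lb_proj (pull_vector v).
Proof. exact: (set_valP (v : pull_tot f L)). Qed.

Lemma pull_vector_continuous : continuous (@pull_vector R B' B f L).
Proof.
apply/continuous_subspace_setT/within_snd/within_continuous.
exact: set_val_continuous.
Qed.

Lemma pull_proj_continuous : continuous (@pull_proj R B' B f L).
Proof.
apply/continuous_subspace_setT/within_fst/within_continuous.
exact: set_val_continuous.
Qed.

Lemma pullback_inj (v w : pullback f L) :
  lb_proj v = lb_proj w -> pull_vector v = pull_vector w -> v = w.
Proof.
move=> e1 e2; apply: (@val_inj _ _ (pull_tot f L)).
exact: injective_projections.
Qed.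

Lemma pull_vector_scale (c : Cstar R) (v : pullback f L) :
  pull_vector (cs_scale c v) = cs_scale c (pull_vector v).
Proof. by []. Qed.

Lemma frame_pull b (v : pullback f L) :
  frame b v -> frame (f b) (pull_vector v).
Proof.
move=> [vb v0]; split; first by rewrite -pullP vb.
by move=> e; apply: v0; apply: pullback_inj; rewrite ?lb_scale_proj.
Qed.

Lemma pullback_line_bundle : continuous f -> is_line_bundle L ->
  is_line_bundle (pullback f L).
Proof.
move=> cf Lb; split; first exact: pull_proj_continuous.
move=> b; have [U [oU Ub [phi [psi [c1 c2 h3 h4 h5]]]]] := lb_chart Lb (f b).
have ePU (x : B') z : U (f x) -> f x = lb_proj (phi (f x, z)).
  by move=> Ux; have [-> _] := h3 _ z Ux.
(* [Phi] must be a total map into the pullback; outside the preimage of [U] it takes the junk value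
   [d]. *)
pose d : pull_tot f L := exist _ (b, phi (f b, 0)) (mem_set (ePU b 0 Ub)).
pose Phi (p : B' * R[i]^o) : pull_tot f L := insubd d (p.1, phi (f p.1, p.2)).
have PhiE x z : U (f x) -> set_val (Phi (x, z)) = (x, phi (f x, z)).
  by move=> Ux; rewrite [set_val _]val_insubd /= mem_set //=; exact (ePU _ _ Ux).
exists (f @^-1` U); split=> //.
  by apply: open_comp => // x _; exact: cf.
exists Phi, (fun v => psi (pull_vector v)); split.
- apply: within_val; apply: (@within_eq _ _ _ (fun p => (p.1, phi (f p.1, p.2)))).
    by move=> [x z] [Ux _]; rewrite PhiE.
  have c1' : {within f @^-1` U `*` [set: R[i]^o], continuous (fun p : B' * R[i]^o => p.1)}.
    by apply: within_fst; exact: within_id.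
  apply: within_pair => //.
  apply: within_comp c1; first by move=> [x z] [].
  by apply: within_pair; [exact: within_comp_continuous cf _|apply: within_snd; exact: within_id].
- apply: within_comp c2; last by apply: within_continuous; exact: pull_vector_continuous.
  by move=> v /= Uv; rewrite -pullP.
- move=> x z Ux; split; first by rewrite /= /pull_proj PhiE.
  by rewrite /pull_vector PhiE //=; have [_ ->] := h3 _ z Ux.
- move=> v Uv; apply: pullback_inj.
    by rewrite /= /pull_proj PhiE.
  by rewrite /pull_vector PhiE //= [f _]pullP h4 // -pullP.
- move=> c x z Ux; apply: pullback_inj.
    by rewrite /= /pull_proj PhiE //= PhiE.
  rewrite /pull_vector PhiE //= PhiE //= h5; last by rewrite -ePU.
  by have [-> ->] := h3 _ z Ux.
Qed.

End PullbackBundle.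

(** * The fundamental bundle and its pullback *)

Section FundamentalBundleLemmas.
Variable R : realType.
Implicit Types (x y : R) (z : R[i]^o) (s : Sbundle R).

Lemma Sclass_eq (p q : Scover R) :
  Sclass p = Sclass q <-> exists n m, q = Sact n m p.
Proof.
split=> [/eqmodP/asboolP//|[n [m ->]]]; by rewrite Sclass_act.
Qed.

Lemma Srepr_surj s : Sclass (Srepr s) = s.
Proof. exact: reprK. Qed.

(** Equality of the second coordinates forces [m = 0], and then the phase e^{2 pi i m x} is 1. Hence
    fibre coordinates over a fixed lift are well defined. *)
Lemma Sclass_inj x y z z' : Sclass (x, y, z) = Sclass (x, y, z') -> z = z'.
Proof.
move=> /Sclass_eq[n [m [_ /eqP ey ->]]].
move: ey; rewrite -subr_eq0 opprD addrA subrr add0r oppr_eq0 intr_eq0 => /eqP ->.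
by rewrite /= mul0r cis0 mul1r.
Qed.

Lemma Sclass_surj s x y : lb_proj s = (u1_cis x, u1_cis y) ->
  exists z, s = Sclass (x, y, z).
Proof.
rewrite -(Srepr_surj s); case: (Srepr s) => [[x0 y0] z0].
rewrite [lb_proj _]Sproj_class => e.
have ex := esym (congr1 fst e); have ey := esym (congr1 snd e).
have [n ->] := u1_cis_inj ex; have [m ->] := u1_cis_inj ey.
by exists (cis (m%:~R * x0) * z0); rewrite -(Sclass_act n m (x0, y0, z0)).
Qed.

(* The coordinate of s over the point (x, y) of the universal cover of T^2. *)
Definition Scoord x y s : R[i]^o := xget 0 [set z | s = Sclass (x, y, z)].

Lemma ScoordK x y s : lb_proj s = (u1_cis x, u1_cis y) ->
  Sclass (x, y, Scoord x y s) = s.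
Proof.
move=> /Sclass_surj[z sE]; rewrite /Scoord; case: xgetP => [z' _ //|/(_ z)].
by case.
Qed.

Lemma Scoord_class x y z : Scoord x y (Sclass (x, y, z)) = z.
Proof.
by apply: (@Sclass_inj x y); rewrite ScoordK //; exact: Sproj_class.
Qed.

(** The factor of automorphy of S: another lift of the same point of the torus changes the fibre
    coordinate only through [m] and [x]. *)
Lemma Scoord_shift x y s n m : lb_proj s = (u1_cis x, u1_cis y) ->
  Scoord (x + n%:~R) (y + m%:~R) s = cis (m%:~R * x) * Scoord x y s.
Proof.
move=> e; rewrite -{1}(ScoordK e) -(Sclass_act n m); exact: Scoord_class.
Qed.

Lemma Sclass_continuous : continuous (@Sclass R : Scover R -> Stot R).
Proof. exact: pi_continuous. Qed.

(** The preimage of an open set of the quotient is open and saturated, so openness within it can be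
    tested on the cover. *)
Lemma within_quotient (Z : topologicalType) (U : set (Stot R)) (f : Stot R -> Z) :
  open U -> {within @Sclass R @^-1` U, continuous (fun p => f (Sclass p))} ->
  {within U, continuous f}.
Proof.
move=> oU cf; rewrite continuous_open_subspace //; apply/(continuous_inP _ oU) => V oV.
apply: (open_preimage_within _ cf oV).
by apply: open_comp => // ? _; exact: Sclass_continuous.
Qed.

Lemma Sproj_continuous : continuous (@Sproj R).
Proof.
apply/quotient_continuous/continuous_subspace_setT.
apply: (@within_eq _ _ _ (fun p : Scover R => (u1_cis p.1.1, u1_cis p.1.2))).
  by move=> p _ /=; rewrite -Sproj_class.
have c1 := within_fst (@within_id (Scover R) setT).
by apply: within_pair; apply: within_comp_continuous (@u1_cis_continuous R) _;
  [exact: within_fst|exact: within_snd].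
Qed.

Lemma within_Scoord_log (A1 A2 : set (U1 R)) (l1 l2 : U1 R -> R) :
  open A1 -> open A2 -> {within A1, continuous l1} -> {within A2, continuous l2} ->
  (forall u, A1 u -> u1_cis (l1 u) = u) -> (forall u, A2 u -> u1_cis (l2 u) = u) ->
  {within @Sproj R @^-1` (A1 `*` A2),
    continuous (fun s => Scoord (l1 (Sproj s).1) (l2 (Sproj s).2) s)}.
Proof.
move=> o1 o2 c1 c2 h1 h2; apply: within_quotient.
  apply: open_comp; last exact: open_setX.
  by move=> ? _; exact: Sproj_continuous.
set D := _ @^-1` _.
have DE p : D p -> A1 (u1_cis p.1.1) /\ A2 (u1_cis p.1.2).
  by rewrite /D /preimage /mkset Sproj_class.
have w1 : {within D, continuous (fun p : Scover R => p.1.1)}.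
  by do 2 apply: within_fst; exact: within_id.
have w2 : {within D, continuous (fun p : Scover R => p.1.2)}.
  by apply: within_snd; apply: within_fst; exact: within_id.
have wl1 : {within D, continuous (fun p : Scover R => l1 (u1_cis p.1.1))}.
  apply: within_comp c1; first by move=> p /DE[].
  exact: within_comp_continuous (@u1_cis_continuous R) w1.
have wl2 : {within D, continuous (fun p : Scover R => l2 (u1_cis p.1.2))}.
  apply: within_comp c2; first by move=> p /DE[].
  exact: within_comp_continuous (@u1_cis_continuous R) w2.
(* The local logarithms of the exponentials of [x] and [y] are [x + n] and [y + m]. The integer m is
   written as the continuous function [l2 - y], and [x] is replaced by [x + n], which leaves e^{2 pi
   i m x} unchanged because m n is an integer. *)
apply: (@within_eq _ _ _ (fun p : Scover R =>
    cis ((l2 (u1_cis p.1.2) - p.1.2) * l1 (u1_cis p.1.1)) * p.2 : R[i]^o)).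
  move=> p Dp; rewrite Sproj_class /=; case: (DE _ Dp) => Ax Ay.
  case: p Dp Ax Ay => [[x y] z] /= _ Ax Ay.
  have [n xE] := u1_cis_inj (h1 _ Ax); have [m yE] := u1_cis_inj (h2 _ Ay).
  rewrite xE yE Scoord_shift ?Scoord_class; last exact: Sproj_class.
  by rewrite addrAC subrr add0r mulrDr -intrM cisD cis_int mulr1.
apply: withinM; last by apply: within_snd; exact: within_id.
apply: within_comp_continuous (@cis_continuous R) _.
by apply: (@withinM _ _ R) => //; exact: withinB.
Qed.

Lemma Sbundle_line_bundle : is_line_bundle (Sbundle R).
Proof.
split; first exact: Sproj_continuous.
move=> [u v]; have [A1 [oA1 Au [l1 c1 h1]]] := u1_local_log u.
have [A2 [oA2 Av [l2 c2 h2]]] := u1_local_log v.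
have pE s : (A1 `*` A2) (lb_proj s) ->
    lb_proj s = (u1_cis (l1 (lb_proj s).1), u1_cis (l2 (lb_proj s).2)).
  by move=> [? ?]; rewrite h1 // h2 //; case: (lb_proj s).
exists (A1 `*` A2); split; [exact: open_setX|by []|].
exists (fun p => Sclass (l1 p.1.1, l2 p.1.2, p.2)).
exists (fun s => Scoord (l1 (Sproj s).1) (l2 (Sproj s).2) s); split.
- apply: within_comp_continuous Sclass_continuous _.
  have w := @within_id ((U1 R * U1 R) * R[i]^o)%type ((A1 `*` A2) `*` setT).
  apply: within_pair; last exact: within_snd.
  apply: within_pair; [apply: within_comp c1|apply: within_comp c2].
  + by move=> p [] [].
  + by apply: within_fst; exact: within_fst.
  + by move=> p [] [].
  + by apply: within_snd; exact: within_fst.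
- exact: within_Scoord_log.
- move=> [a b] z [/= Aa Ab]; pose s : Stot R := Sclass (l1 a, l2 b, z).
  have e : Sproj s = (a, b) by rewrite Sproj_class /= h1 // h2.
  split; first exact: e.
  by change (Scoord (l1 (Sproj s).1) (l2 (Sproj s).2) s = z); rewrite e Scoord_class.
- by move=> s As; apply: ScoordK; exact: pE.
- by move=> c [a b] z _; rewrite [RHS]Sscale_class.
Qed.

(** A given continuous lift differs from the one by local logarithms by integers. The resulting
    factor of automorphy is again continuous once its integer is written as
    [y t - l2 (u1_cis (y t))]. *)
Lemma within_Scoord (Z : topologicalType) (A : set Z) (x y : Z -> R) (s : Z -> Stot R) :
  (forall t, A t -> Sproj (s t) = (u1_cis (x t), u1_cis (y t))) ->
  {within A, continuous x} -> {within A, continuous y} -> {within A, continuous s} ->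
  {within A, continuous (fun t => Scoord (x t) (y t) (s t))}.
Proof.
move=> sE cx cy cs; apply/withinP => t At.
have [A1 [oA1 Au [l1 c1 h1]]] := u1_local_log (u1_cis (x t)).
have [A2 [oA2 Av [l2 c2 h2]]] := u1_local_log (u1_cis (y t)).
have cis_cont (g : Z -> R) (D : set Z) :
    {within D, continuous g} -> {within D, continuous (fun t => u1_cis (g t))}.
  exact: within_comp_continuous (@u1_cis_continuous R).
pose D := A `&` [set t | A1 (u1_cis (x t)) /\ A2 (u1_cis (y t))].
have DA (T : topologicalType) (g : Z -> T) :
    {within A, continuous g} -> {within D, continuous g}.
  by apply: within_subset => ? [].
have cD : {within D, continuous (fun t => cis ((y t - l2 (u1_cis (y t))) * l1 (u1_cis (x t)))
    * Scoord (l1 (Sproj (s t)).1) (l2 (Sproj (s t)).2) (s t) : R[i]^o)}.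
  apply: withinM.
    apply: within_comp_continuous (@cis_continuous R) _; apply: (@withinM _ _ R).
      apply: (@withinB _ _ R); first exact: DA.
      by apply: within_comp c2; [move=> ? [_ []]|apply: cis_cont; exact: DA].
    by apply: within_comp c1; [move=> ? [_ []]|apply: cis_cont; exact: DA].
  apply: within_comp (within_Scoord_log oA1 oA2 c1 c2 h1 h2); last exact: DA.
  by move=> r [Ar [? ?]]; rewrite /preimage /mkset sE.
have DE r : D r -> cis ((y r - l2 (u1_cis (y r))) * l1 (u1_cis (x r)))
    * Scoord (l1 (Sproj (s r)).1) (l2 (Sproj (s r)).2) (s r) = Scoord (x r) (y r) (s r).
  move=> [Ar [Ax Ay]]; rewrite sE //=.
  have [n xE] := u1_cis_inj (esym (h1 _ Ax)); have [m yE] := u1_cis_inj (esym (h2 _ Ay)).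
  have -> : y r - l2 (u1_cis (y r)) = m%:~R by rewrite {1}yE addrAC subrr add0r.
  rewrite -(Scoord_shift n); first by rewrite -xE -yE.
  by rewrite h1 // h2 //; exact: sE.
have Dt : D t by [].
move=> V; rewrite -DE // => hV.
have := (withinP _ _).1 cD t Dt V hV.
have := (withinP _ _).1 (cis_cont _ _ cx) t At _ (open_nbhs_nbhs (conj oA1 Au)).
have := (withinP _ _).1 (cis_cont _ _ cy) t At _ (open_nbhs_nbhs (conj oA2 Av)).
apply: filterS3 => r r2 r1 rV Ar.
have Dr : D r by split=> //; split; [exact: r1|exact: r2].
by rewrite -DE //; exact: rV.
Qed.

Lemma Sframe_coord x y s : frame (u1_cis x, u1_cis y) s -> Scoord x y s != 0.
Proof.
move=> [sp s0]; apply/eqP => e; apply: s0.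
rewrite -(ScoordK sp) [lb_scale _ _]Sscale_class e; congr Sclass.
by congr pair; rewrite mul0r.
Qed.

Lemma Sclass_frame x y (c : Cstar R) : frame (u1_cis x, u1_cis y) (Sclass (x, y, csval c) : Sbundle R).
Proof.
split; first exact: Sproj_class.
rewrite [lb_scale _ _]Sscale_class /= => /Sclass_inj /eqP.
by rewrite mul0r eq_sym (negbTE (csval_neq0 c)).
Qed.

(* Junk value 0 when s is not a frame. *)
Definition Scs x y s : Cstar R := xget 0 [set c | csval c = Scoord x y s].

Lemma csval_Scs x y s : frame (u1_cis x, u1_cis y) s ->
  csval (Scs x y s) = Scoord x y s.
Proof.
move=> /Sframe_coord s0; rewrite /Scs; case: xgetP => [c _ //|/(_ (csmk s0))].
by case.
Qed.

Lemma ScsK x y s : frame (u1_cis x, u1_cis y) s -> Sclass (x, y, csval (Scs x y s)) = s.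
Proof. by move=> fs; rewrite csval_Scs // ScoordK //; case: fs. Qed.

Lemma Scs_class x y (c : Cstar R) : Scs x y (Sclass (x, y, csval c)) = c.
Proof.
apply: csval_inj; rewrite csval_Scs; first exact: Scoord_class.
exact: Sclass_frame.
Qed.

Lemma Scs_scale c x y s : frame (u1_cis x, u1_cis y) s ->
  Scs x y (cs_scale c s) = c + Scs x y s.
Proof.
move=> fs; rewrite -{1}(ScsK fs) [cs_scale _ _]Sscale_class.
exact: (Scs_class x y (c + Scs x y s)).
Qed.

Lemma within_Scs (Z : topologicalType) (A : set Z) (x y : Z -> R) (s : Z -> Sbundle R) :
  (forall t, A t -> frame (u1_cis (x t), u1_cis (y t)) (s t)) ->
  {within A, continuous x} -> {within A, continuous y} -> {within A, continuous s} ->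
  {within A, continuous (fun t => Scs (x t) (y t) (s t))}.
Proof.
move=> fs cx cy cs; apply: within_val.
apply: within_eq (within_Scoord (fun t At => (fs t At).1) cx cy cs).
by move=> t At; rewrite -csval_Scs //; exact: fs.
Qed.

End FundamentalBundleLemmas.

(** * The bimultiplicative structure of S in coordinates *)

Section BimultiplicativeSections.
Variable R : realType.
Implicit Types (u v w : Sbundle R) (x y : R).

(** Independence of representatives: the common second coordinate forces [m' = m], and e^{2 pi i m
    x} is multiplicative in [x]. *)
Lemma Smul1_fun u v w w' : Smul1 u v w -> Smul1 u v w' -> w = w'.
Proof.
move=> [x1 [x2 [y [z1 [z2 [-> -> ->]]]]]] [x1' [x2' [y' [z1' [z2' [e1 e2 ->]]]]]].
have /Sclass_eq[n [m [-> ey ->]]] := e1; have /Sclass_eq[n' [m' [-> ey' ->]]] := e2.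
have -> : m' = m.
  by apply/eqP; rewrite -(eqr_int R) -(inj_eq (addrI y)) -ey' ey.
rewrite /= in ey *; apply/Sclass_eq; exists (n + n'), m.
rewrite /Sact /= ey intrD mulrDr cisD; congr (_, _, _); first by rewrite addrACA.
by rewrite mulrACA.
Qed.

(** Here the first coordinate is common, and e^{2 pi i m x} is multiplicative in [m]. *)
Lemma Smul2_fun u v w w' : Smul2 u v w -> Smul2 u v w' -> w = w'.
Proof.
move=> [x [y1 [y2 [z1 [z2 [-> -> ->]]]]]] [x' [y1' [y2' [z1' [z2' [e1 e2 ->]]]]]].
have /Sclass_eq[n [m [ex -> ->]]] := e1; have /Sclass_eq[n' [m' [ex' -> ->]]] := e2.
rewrite /= in ex *; apply/Sclass_eq; exists n, (m + m').
rewrite /Sact /= ex intrD mulrDl cisD; congr (_, _, _); first by rewrite addrACA.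
by rewrite mulrACA.
Qed.

Lemma cs_scale_Sclass x y z (c : Cstar R) :
  cs_scale c (Sclass (x, y, z) : Sbundle R) = Sclass (x, y, csval c * z).
Proof. exact: Sscale_class. Qed.

(** Because [x2 + x0 = x1] holds in [R] and not only modulo integers, the product of the two vectors
    has the product of their coordinates. This determines the scalar chosen in [Striv1]; it is minus
    an alternating sum of coordinates. *)
Lemma Striv1E (v : 'I_3 -> Sbundle R) x0 x1 x2 y :
  frame (u1_cis x0, u1_cis y) (v ord0) ->
  frame (u1_cis x1, u1_cis y) (v (inord 1)) ->
  frame (u1_cis x2, u1_cis y) (v ord_max) -> x2 + x0 = x1 ->
  Striv1 v = Scs x1 y (v (inord 1)) - Scs x2 y (v ord_max) - Scs x0 y (v ord0).
Proof.
move=> f0 f1 f2 xE; set c := RHS.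
have Hc : Smul1 (v ord_max) (v ord0) (cs_scale (- c) (v (inord 1))).
  exists x2, x0, y, (csval (Scs x2 y (v ord_max))), (csval (Scs x0 y (v ord0))).
  rewrite !ScsK //; split=> //; rewrite -{1}(ScsK f1) cs_scale_Sclass xE -!csvalD.
  rewrite (_ : - c + _ = Scs x2 y (v ord_max) + Scs x0 y (v ord0)) //.
  by rewrite /c !opprD !opprK addrC !addrA subrr add0r.
rewrite /Striv1; case: xgetP => [d _ /= Hd|/(_ c) //].
apply: oppr_inj; apply: (cs_scale_inj (Sbundle_line_bundle R) f1).
exact: Smul1_fun Hd Hc.
Qed.

Lemma Striv2E (v : 'I_3 -> Sbundle R) x y0 y1 y2 :
  frame (u1_cis x, u1_cis y0) (v ord0) ->
  frame (u1_cis x, u1_cis y1) (v (inord 1)) ->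
  frame (u1_cis x, u1_cis y2) (v ord_max) -> y2 + y0 = y1 ->
  Striv2 v = Scs x y1 (v (inord 1)) - Scs x y2 (v ord_max) - Scs x y0 (v ord0).
Proof.
move=> f0 f1 f2 yE; set c := RHS.
have Hc : Smul2 (v ord_max) (v ord0) (cs_scale (- c) (v (inord 1))).
  exists x, y2, y0, (csval (Scs x y2 (v ord_max))), (csval (Scs x y0 (v ord0))).
  rewrite !ScsK //; split=> //; rewrite -{1}(ScsK f1) cs_scale_Sclass yE -!csvalD.
  rewrite (_ : - c + _ = Scs x y2 (v ord_max) + Scs x y0 (v ord0)) //.
  by rewrite /c !opprD !opprK addrC !addrA subrr add0r.
rewrite /Striv2; case: xgetP => [d _ /= Hd|/(_ c) //].
apply: oppr_inj; apply: (cs_scale_inj (Sbundle_line_bundle R) f1).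
exact: Smul2_fun Hd Hc.
Qed.

End BimultiplicativeSections.


(** * The bigerbe structure on the pullback of S *)

Section CupBundle.
Variables (R : realType) (X : topologicalType) (Y1 Y2 : circle_bundle R X).
Local Notation Q := (bundle_square Y1 Y2).

Definition grow m n (w : grid Q m n.+1) (i : 'I_m) : Y1 :=
  (set_val (entry w (i, ord0) : bundle_fprod Y1 Y2)).1.
Definition gcol m n (w : grid Q m.+1 n) (j : 'I_n) : Y2 :=
  (set_val (entry w (ord0, j) : bundle_fprod Y1 Y2)).2.

Lemma growE m n (w : grid Q m n.+1) i j :
  (set_val (entry w (i, j) : bundle_fprod Y1 Y2)).1 = grow w i.
Proof. exact: (entryP w).1. Qed.

Lemma gcolE m n (w : grid Q m.+1 n) i j :
  (set_val (entry w (i, j) : bundle_fprod Y1 Y2)).2 = gcol w j.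
Proof. exact: (entryP w).2. Qed.

Lemma grow_face1 m n k (w : grid Q m.+1 n.+1) i : grow (face1 k w) i = grow w (lift k i).
Proof. by []. Qed.

Lemma grow_face2 m n k (w : grid Q m n.+2) i : grow (face2 k w) i = grow w i.
Proof. exact: (growE w i (lift k ord0)). Qed.

Lemma gcol_face1 m n k (w : grid Q m.+2 n) j : gcol (face1 k w) j = gcol w j.
Proof. exact: (gcolE w (lift k ord0) j). Qed.

Lemma gcol_face2 m n k (w : grid Q m.+1 n.+1) j : gcol (face2 k w) j = gcol w (lift k j).
Proof. by []. Qed.

Lemma grow_proj m n (w : grid Q m.+1 n.+1) i j :
  cb_proj (grow w i) = cb_proj (gcol w j).
Proof.
by rewrite -(growE w i j) -(gcolE w i j); exact: (set_valP (entry w (i, j))).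
Qed.

Lemma grow_proj_eq m n (w : grid Q m.+1 n.+1) i i' :
  cb_proj (grow w i) = cb_proj (grow w i').
Proof. by rewrite !(grow_proj w _ ord0). Qed.

Lemma gcol_proj_eq m n (w : grid Q m.+1 n.+1) j j' :
  cb_proj (gcol w j) = cb_proj (gcol w j').
Proof. by rewrite -!(grow_proj w ord0). Qed.

Lemma entry_continuous m n ij : continuous (fun w : grid Q m n => entry w ij).
Proof.
apply/continuous_subspace_setT.
apply: within_comp_continuous (@ptws_continuous _ _ ij) _.
by apply: within_continuous; exact: set_val_continuous.
Qed.

Lemma grow_continuous m n i : continuous (fun w : grid Q m n.+1 => grow w i).
Proof.
apply/continuous_subspace_setT/within_fst.
apply: within_comp_continuous (@set_val_continuous _ _) _.
by apply: within_continuous; exact: entry_continuous.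
Qed.

Lemma gcol_continuous m n j : continuous (fun w : grid Q m.+1 n => gcol w j).
Proof.
apply/continuous_subspace_setT/within_snd.
apply: within_comp_continuous (@set_val_continuous _ _) _.
by apply: within_continuous; exact: entry_continuous.
Qed.

Lemma chi12E (w : grid Q 2 2) : chi12 w =
  (difference (grow w ord0) (grow w ord_max), difference (gcol w ord0) (gcol w ord_max)).
Proof. by []. Qed.

Lemma chi12_continuous : continuous (@chi12 R X Y1 Y2).
Proof.
apply/continuous_subspace_setT/within_pair; apply: within_difference.
- by move=> w _; exact: grow_proj_eq.
- by apply: within_continuous; exact: grow_continuous.
- by apply: within_continuous; exact: grow_continuous.
- by move=> w _; exact: gcol_proj_eq.
- by apply: within_continuous; exact: gcol_continuous.
- by apply: within_continuous; exact: gcol_continuous.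
Qed.

Lemma cup_bundle_line_bundle : is_line_bundle (cup_bundle Y1 Y2).
Proof.
exact: pullback_line_bundle chi12_continuous (Sbundle_line_bundle R).
Qed.

Lemma bundle_square_locally_split : locally_split_square Q.
Proof.
split; [exact: cb_locally_split|exact: cb_locally_split|].
have pairE (w : bundle_fprod Y1 Y2) : @sq_pair Q w = w.
  case: w => [[a b] h]; exact: val_inj.
split.
- apply/continuous_subspace_setT; apply: (@within_eq _ _ _ idfun); last exact: within_id.
  by move=> w _; exact/esym/pairE.
- by move=> w; exists w; exact: pairE.
- move=> w; exists setT; split=> //; first exact: openT.
  by exists id => [|u _]; [exact: within_id|exact: pairE].
Qed.

(* Logarithms of the positions of the rows and columns of a grid relative to
   the first ones; the value of chi_i on any two rows or columns is then the
   exponential of an additive difference. *)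
Definition row_log m n (w : grid Q m.+1 n.+1) (xi : 'I_m.+1 -> R) :=
  forall i, u1_cis (xi i) = difference (grow w ord0) (grow w i).
Definition col_log m n (w : grid Q m.+1 n.+1) (eta : 'I_n.+1 -> R) :=
  forall j, u1_cis (eta j) = difference (gcol w ord0) (gcol w j).

Lemma row_log_exists m n (w : grid Q m.+1 n.+1) : exists xi, row_log w xi.
Proof.
have [xi h] := boolp.choice (fun i => u1_cis_surj (difference (grow w ord0) (grow w i))).
by exists xi.
Qed.

Lemma col_log_exists m n (w : grid Q m.+1 n.+1) : exists eta, col_log w eta.
Proof.
have [eta h] := boolp.choice (fun j => u1_cis_surj (difference (gcol w ord0) (gcol w j))).
by exists eta.
Qed.

Lemma row_logB m n (w : grid Q m.+1 n.+1) xi i i' : row_log w xi ->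
  difference (grow w i) (grow w i') = u1_cis (xi i' - xi i).
Proof.
move=> h; apply: (@u1_mulI _ (u1_cis (xi i))); rewrite -u1_cisD subrK h u1_mulC.
by rewrite !h; apply: differenceM; exact: grow_proj_eq.
Qed.

Lemma col_logB m n (w : grid Q m.+1 n.+1) eta j j' : col_log w eta ->
  difference (gcol w j) (gcol w j') = u1_cis (eta j' - eta j).
Proof.
move=> h; apply: (@u1_mulI _ (u1_cis (eta j))); rewrite -u1_cisD subrK h u1_mulC.
by rewrite !h; apply: differenceM; exact: gcol_proj_eq.
Qed.

(** For three rows this is the logarithm of chi on the face omitting row [k]: the two remaining rows
    are subtracted. [gapD] is the telescoping that makes these lifts add up exactly. *)
Definition gap n (xi : 'I_n.+3 -> R) (k : 'I_n.+3) : R :=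
  xi (lift k ord_max) - xi (lift k ord0).

Lemma gapD (xi : 'I_3 -> R) : gap xi ord_max + gap xi ord0 = gap xi (inord 1).
Proof.
rewrite /gap.
have -> : lift ord_max ord_max = inord 1 :> 'I_3 by apply: val_inj; rewrite /= inordK.
have -> : lift ord0 ord0 = inord 1 :> 'I_3 by apply: val_inj; rewrite /= inordK.
have -> : lift (inord 1) ord_max = ord_max :> 'I_3.
  by apply: val_inj; rewrite /= inordK.
have -> : lift (inord 1) ord0 = ord0 :> 'I_3 by apply: val_inj; rewrite /= inordK.
have -> : lift ord_max ord0 = ord0 :> 'I_3 by apply: val_inj.
by rewrite -ord_max_lift addrC addrA subrK.
Qed.

Lemma chi12_face1 (w : grid Q 3 2) xi eta k : row_log w xi -> col_log w eta ->
  chi12 (face1 k w) = (u1_cis (gap xi k), u1_cis (eta ord_max - eta ord0)).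
Proof.
move=> hx hy; rewrite chi12E !grow_face1 !gcol_face1.
by rewrite (row_logB _ _ hx) (col_logB _ _ hy).
Qed.

Lemma chi12_face2 (w : grid Q 2 3) xi eta k : row_log w xi -> col_log w eta ->
  chi12 (face2 k w) = (u1_cis (xi ord_max - xi ord0), u1_cis (gap eta k)).
Proof.
move=> hx hy; rewrite chi12E !grow_face2 !gcol_face2.
by rewrite (row_logB _ _ hx) (col_logB _ _ hy).
Qed.

(** With lifts given by gaps, the trivialization is an alternating sum of fibre coordinates, so that
    d-closedness and compatibility become statements about iterated alternating sums. *)
Lemma cup_triv1E (w : grid Q 3 2) xi y (v : 'I_3 -> cup_bundle Y1 Y2) :
  (forall k, chi12 (face1 k w) = (u1_cis (gap xi k), u1_cis y)) ->
  (forall k, frame (face1 k w) (v k)) ->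
  cup_triv1 w v = - altsum (fun k => Scs (gap xi k) y (pull_vector (v k))).
Proof.
move=> hw fv; have fv' k := frame_pull (fv k).
rewrite /cup_triv1 (@Striv1E _ _ (gap xi ord0) (gap xi (inord 1)) (gap xi ord_max) y);
  last exact: gapD.
- by rewrite altsum3 !opprD opprK addrAC; congr (_ - _); exact: addrC.
- by rewrite -hw.
- by rewrite -hw.
- by rewrite -hw.
Qed.

Lemma cup_triv2E (w : grid Q 2 3) x eta (v : 'I_3 -> cup_bundle Y1 Y2) :
  (forall k, chi12 (face2 k w) = (u1_cis x, u1_cis (gap eta k))) ->
  (forall k, frame (face2 k w) (v k)) ->
  cup_triv2 w v = - altsum (fun k => Scs x (gap eta k) (pull_vector (v k))).
Proof.
move=> hw fv; have fv' k := frame_pull (fv k).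
rewrite /cup_triv2 (@Striv2E _ _ x (gap eta ord0) (gap eta (inord 1)) (gap eta ord_max));
  last exact: gapD.
- by rewrite altsum3 !opprD opprK addrAC; congr (_ - _); exact: addrC.
- by rewrite -hw.
- by rewrite -hw.
- by rewrite -hw.
Qed.

Lemma row_log_local m n (w0 : grid Q m.+1 n.+1) :
  exists (U : set (grid Q m.+1 n.+1)) (xi : 'I_m.+1 -> grid Q m.+1 n.+1 -> R),
  [/\ open U, U w0, (forall i, {within U, continuous (xi i)}) &
      forall w, U w -> row_log w (xi^~ w)].
Proof.
pose d i (w : grid Q m.+1 n.+1) := difference (grow w ord0) (grow w i).
have cd i : continuous (d i).
  apply/continuous_subspace_setT; apply: within_difference.
  - by move=> w _; exact: grow_proj_eq.
  - by apply: within_continuous; exact: grow_continuous.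
  - by apply: within_continuous; exact: grow_continuous.
have [A hA] := boolp.choice (fun i => u1_local_log (d i w0)).
have [i|l hl] := @boolp.choice _ _ (fun i (l : U1 R -> R) =>
    {within A i, continuous l} /\ forall u, A i u -> u1_cis (l u) = u).
  by have [_ _ [l l1 l2]] := hA i; exists l.
have : nbhs w0 [set w | forall i, A i (d i w)].
  apply: (@filter_forall _ _ (fun i w => A i (d i w)) (nbhs w0) _) => i; have [oA Ai _] := hA i.
  by apply: (cd i); exact: open_nbhs_nbhs.
rewrite nbhsE => -[U [oU Uw] UA]; exists U, (fun i w => l i (d i w)); split=> // [i|w Uw' i].
  apply: within_comp (hl i).1; first by move=> w /UA.
  exact: within_continuous.
by rewrite (hl i).2 //; exact: UA.
Qed.

Lemma col_log_local m n (w0 : grid Q m.+1 n.+1) :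
  exists (U : set (grid Q m.+1 n.+1)) (eta : 'I_n.+1 -> grid Q m.+1 n.+1 -> R),
  [/\ open U, U w0, (forall j, {within U, continuous (eta j)}) &
      forall w, U w -> col_log w (eta^~ w)].
Proof.
pose d j (w : grid Q m.+1 n.+1) := difference (gcol w ord0) (gcol w j).
have cd j : continuous (d j).
  apply/continuous_subspace_setT; apply: within_difference.
  - by move=> w _; exact: gcol_proj_eq.
  - by apply: within_continuous; exact: gcol_continuous.
  - by apply: within_continuous; exact: gcol_continuous.
have [A hA] := boolp.choice (fun i => u1_local_log (d i w0)).
have [i|l hl] := @boolp.choice _ _ (fun i (l : U1 R -> R) =>
    {within A i, continuous l} /\ forall u, A i u -> u1_cis (l u) = u).
  by have [_ _ [l l1 l2]] := hA i; exists l.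
have : nbhs w0 [set w | forall i, A i (d i w)].
  apply: (@filter_forall _ _ (fun i w => A i (d i w)) (nbhs w0) _) => i; have [oA Ai _] := hA i.
  by apply: (cd i); exact: open_nbhs_nbhs.
rewrite nbhsE => -[U [oU Uw] UA]; exists U, (fun i w => l i (d i w)); split=> // [i|w Uw' i].
  apply: within_comp (hl i).1; first by move=> w /UA.
  exact: within_continuous.
by rewrite (hl i).2 //; exact: UA.
Qed.

(** The coordinate formula serves twice: homogeneity holds pointwise with any logarithms, while
    continuity needs logarithms that are continuous near the given grid. *)
Lemma cup_triv1_trivializing :
  trivializing_section (fun k : 'I_3 => face1 k) (@cup_triv1 R X Y1 Y2).
Proof.
split=> [w v c fv|N t oN ct ft].
  have [xi hx] := row_log_exists w; have [eta hy] := col_log_exists w.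
  have hw k := chi12_face1 k hx hy.
  have fcv k : frame (face1 k w) (cs_scale (c k) (v k)).
    by apply: frame_scale; [exact: cup_bundle_line_bundle|exact: fv].
  rewrite (cup_triv1E hw fcv) (cup_triv1E hw fv) -opprD -altsumD; congr (- _).
  apply: eq_altsum => k; rewrite [RHS]addrC pull_vector_scale; apply: Scs_scale.
  by rewrite -hw; exact: frame_pull.
apply: within_local => w0 Nw0.
have [U [xi [oU Uw0 cxi hx]]] := row_log_local w0.
have [V [eta [oV Vw0 ceta hy]]] := col_log_local w0.
exists (U `&` V); split=> //; first exact: openI.
set D := N `&` _.
pose x k w := gap (xi^~ w) k; pose y w := eta ord_max w - eta ord0 w.
apply: (@within_eq _ _ _ (fun w => - altsum (fun k => Scs (x k w) (y w) (pull_vector (t k w))))).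
  move=> w [Nw [Uw Vw]]; rewrite (cup_triv1E (xi := xi^~ w) (y := y w)) // => k.
    exact: chi12_face1 (hx _ Uw) (hy _ Vw).
  exact: ft.
apply: withinN; apply: within_altsum => k; apply: within_Scs.
- move=> w [Nw [Uw Vw]]; rewrite -(chi12_face1 k (hx _ Uw) (hy _ Vw)).
  by apply: frame_pull; exact: ft.
- by apply: (@withinB _ _ R); [apply: within_subset (cxi _)|apply: within_subset (cxi _)]
    => ? [_ []].
- by apply: (@withinB _ _ R); [apply: within_subset (ceta _)|apply: within_subset (ceta _)]
    => ? [_ []].
- apply: within_comp_continuous (@pull_vector_continuous _ _ _ _ _) _.
  by apply: within_subset (ct k) => ? [].
Qed.

Lemma cup_triv2_trivializing :
  trivializing_section (fun k : 'I_3 => face2 k) (@cup_triv2 R X Y1 Y2).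
Proof.
split=> [w v c fv|N t oN ct ft].
  have [xi hx] := row_log_exists w; have [eta hy] := col_log_exists w.
  have hw k := chi12_face2 k hx hy.
  have fcv k : frame (face2 k w) (cs_scale (c k) (v k)).
    by apply: frame_scale; [exact: cup_bundle_line_bundle|exact: fv].
  rewrite (cup_triv2E hw fcv) (cup_triv2E hw fv) -opprD -altsumD; congr (- _).
  apply: eq_altsum => k; rewrite [RHS]addrC pull_vector_scale; apply: Scs_scale.
  by rewrite -hw; exact: frame_pull.
apply: within_local => w0 Nw0.
have [U [xi [oU Uw0 cxi hx]]] := row_log_local w0.
have [V [eta [oV Vw0 ceta hy]]] := col_log_local w0.
exists (U `&` V); split=> //; first exact: openI.
set D := N `&` _.
pose x w := xi ord_max w - xi ord0 w; pose y k w := gap (eta^~ w) k.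
apply: (@within_eq _ _ _ (fun w => - altsum (fun k => Scs (x w) (y k w) (pull_vector (t k w))))).
  move=> w [Nw [Uw Vw]]; rewrite (cup_triv2E (x := x w) (eta := eta^~ w)) // => k.
    exact: chi12_face2 (hx _ Uw) (hy _ Vw).
  exact: ft.
apply: withinN; apply: within_altsum => k; apply: within_Scs.
- move=> w [Nw [Uw Vw]]; rewrite -(chi12_face2 k (hx _ Uw) (hy _ Vw)).
  by apply: frame_pull; exact: ft.
- by apply: (@withinB _ _ R); [apply: within_subset (cxi _)|apply: within_subset (cxi _)]
    => ? [_ []].
- by apply: (@withinB _ _ R); [apply: within_subset (ceta _)|apply: within_subset (ceta _)]
    => ? [_ []].
- apply: within_comp_continuous (@pull_vector_continuous _ _ _ _ _) _.
  by apply: within_subset (ct k) => ? [].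
Qed.

(** One family of logarithms is chosen for all rows and columns of the largest grid. Coinciding
    iterated faces then have equal lifts and equal coordinates, so [altsum_altsum] gives the
    closedness of the sections, and d_2 s_1 = d_1 s_2 is an exchange of two sums. *)
Lemma cup_bigerbe : bigerbe (@cup_triv1 R X Y1 Y2) (@cup_triv2 R X Y1 Y2).
Proof.
split; first exact: bundle_square_locally_split.
- exact: cup_bundle_line_bundle.
- by split; [exact: cup_triv1_trivializing|exact: cup_triv2_trivializing].
- split=> w v fv vE.
    have [xi hx] := row_log_exists w; have [eta hy] := col_log_exists w.
    have hw k l : chi12 (face1 l (face1 k w)) =
        (u1_cis (gap (fun i => xi (lift k i)) l), u1_cis (eta ord_max - eta ord0)).
      rewrite chi12E !grow_face1 !gcol_face1.
      by rewrite (row_logB _ _ hx) (col_logB _ _ hy).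
    under eq_altsum => k do rewrite (cup_triv1E (hw k) (fv k)).
    rewrite altsumN altsum_altsum ?oppr0 // => k l k' l' kl ek el.
    by rewrite /gap !(lift_lift _ kl ek el) (vE _ _ k' l') // => i; exact: lift_lift.
  have [xi hx] := row_log_exists w; have [eta hy] := col_log_exists w.
  have hw k l : chi12 (face2 l (face2 k w)) =
      (u1_cis (xi ord_max - xi ord0), u1_cis (gap (fun i => eta (lift k i)) l)).
    rewrite chi12E !grow_face2 !gcol_face2.
    by rewrite (row_logB _ _ hx) (col_logB _ _ hy).
  under eq_altsum => k do rewrite (cup_triv2E (hw k) (fv k)).
  rewrite altsumN altsum_altsum ?oppr0 // => k l k' l' kl ek el.
  by rewrite /gap !(lift_lift _ kl ek el) (vE _ _ k' l') // => i; exact: lift_lift.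
- move=> w v fv.
  have [xi hx] := row_log_exists w; have [eta hy] := col_log_exists w.
  have hw k l : chi12 (face1 k (face2 l w)) = (u1_cis (gap xi k), u1_cis (gap eta l)).
    rewrite chi12E !grow_face1 !gcol_face1 !grow_face2 !gcol_face2.
    by rewrite (row_logB _ _ hx) (col_logB _ _ hy).
  have faceC k l : face1 k (face2 l w) = face2 l (face1 k w) by exact: val_inj.
  under eq_altsum => l do rewrite (cup_triv1E (hw^~ l) (fv^~ l)).
  have hw' k l : chi12 (face2 l (face1 k w)) = (u1_cis (gap xi k), u1_cis (gap eta l)).
    by rewrite -faceC.
  have fv' k l : frame (face2 l (face1 k w)) (v k l) by rewrite -faceC.
  under [RHS]eq_altsum => k do rewrite (cup_triv2E (hw' k) (fv' k)).
  by rewrite !altsumN altsum_exchange.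
Qed.

End CupBundle.

(** * Cech cochains and cup products *)

Section Leibniz.
Variables (K : pzRingType) (I : Type).

(** The Leibniz rule. Families are indexed through a function on natural numbers, where omitting [k]
    is composition with [bump k] whatever the lengths; the faces split into those with [k <= p],
    which affect the first factor, and the others. *)
Lemma altsum_cup_nat p q (F : ('I_p.+1 -> I) -> K) (G : ('I_q.+1 -> I) -> K)
    (j : nat -> I) :
  altsum (fun k : 'I_(p + q).+2 =>
    F (fun a => j (bump k a)) * G (fun b => j (bump k (p + b)))) =
  altsum (fun k : 'I_p.+2 => F (fun a => j (bump k a))) * G (fun b => j (p.+1 + b)%N) +
  (F (fun a => j a) * altsum (fun k : 'I_q.+2 => G (fun b => j (p + bump k b)%N))) *~ (-1) ^+ p.
Proof.
pose T (k : nat) := (F (fun a => j (bump k a)) * G (fun b => j (bump k (p + b)))) *~ (-1) ^+ k.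
have -> : altsum (fun k : 'I_(p + q).+2 =>
    F (fun a => j (bump k a)) * G (fun b => j (bump k (p + b)))) =
    \sum_(k < p.+1) T k + \sum_(k < q.+1) T (p.+1 + k)%N.
  have e : (p + q).+2 = (p.+1 + q.+1)%N by rewrite addnS addSn.
  by rewrite /altsum -(big_mkord xpredT T) e big_mkord big_split_ord.
rewrite /altsum [X in _ = X * _ + _]big_ord_recr [X in _ = _ + _ * X *~ _]big_ord_recl /=.
rewrite expr0 mulr1z.
rewrite mulrDl mulrDr mulrzDl -!addrA; congr (_ + _).
  rewrite mulr_suml; apply: eq_bigr => k _; rewrite /T mulrzAl; congr (_ * G _ *~ _).
   apply: funext => b; rewrite /bump.
  by rewrite (leq_trans _ (leq_addr b p)) ?add1n ?addSn // -ltnS.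
(* The right-hand side has two extra terms: the last face of [F] and the face 0 of [G]. Both are the
   full [F] times the full [G], with opposite signs. *)
rewrite addrA -[LHS]add0r; congr (_ + _).
  rewrite mulrzAl exprS mulN1r mulrNz.
  have -> : (fun a : 'I_p.+1 => j (bump p.+1 a)) = (fun a => j a).
    by apply: funext => a; rewrite /bump ltnNge -ltnS ltn_ord.
  have -> : (fun b : 'I_q.+1 => j (p + bump 0 b)%N) = (fun b => j (p.+1 + b)%N).
    by apply: funext => b; rewrite /bump /= add1n addnS addSn.
  by rewrite addNr.
rewrite mulr_sumr mulrz_suml; apply: eq_bigr => k _; rewrite /T.
rewrite mulrzAr mulrzA_C -exprD /bump add1n -addSnnS; congr (F _ * G _ *~ _).
  apply: funext => a; rewrite leqNgt.
  by rewrite (leq_trans (ltn_ord a)) ?leq_addr // addSn ltnS leq_addr.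
apply: funext => b; congr j.
by rewrite /bump addSn -addnS leq_add2l addnCA.
Qed.

End Leibniz.

Lemma altsum_cup (K : pzRingType) (I : Type) p q (F : ('I_p.+1 -> I) -> K)
    (G : ('I_q.+1 -> I) -> K) (i : 'I_(p + q).+2 -> I) :
  altsum (fun k : 'I_(p + q).+2 =>
    F (fun a => i (lift k (inord a))) * G (fun b => i (lift k (inord (p + b))))) =
  altsum (fun k : 'I_p.+2 => F ((fun a : 'I_p.+2 => i (inord a)) \o lift k)) *
    G (fun b => i (inord (p.+1 + b))) +
  (F (fun a => i (inord a)) *
   altsum (fun k : 'I_q.+2 => G ((fun b : 'I_q.+2 => i (inord (p + b))) \o lift k)))
  *~ (-1) ^+ p.
Proof.
rewrite -(altsum_cup_nat F G (fun m => i (inord m))); apply: eq_altsum => k.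
(* All positions that occur are at most [p + q], so [inord] takes them to themselves on both
   sides. *)
have e m : (m <= p + q)%N -> i (lift k (inord m)) = i (inord (bump k m)).
  move=> mpq; congr i; apply: val_inj; rewrite /= !inordK //.
  by rewrite /bump; case: (k <= m)%N; rewrite ?add0n ?add1n ltnS // ltnW.
congr (_ * _); [congr F|congr G]; apply: funext => a; rewrite e //.
  by rewrite (leq_trans _ (leq_addr _ _)) // -ltnS.
by rewrite leq_add2l -ltnS.
Qed.

Section CechGeneral.
Variables (X : topologicalType) (A : topologicalZmodType).

Lemma cdiff_comp (I J : Type) (r : J -> I) p (c : cochain X A I p) i x :
  cdiff (fun i => c (r \o i)) i x = cdiff c (r \o i) x.
Proof. by []. Qed.

Lemma cdiff_cdiff (I : Type) p (c : cochain X A I p) i x : cdiff (cdiff c) i x = 0.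
Proof.
rewrite /cdiff; apply: altsum_altsum => k l k' l' kl ek el.
by congr (c _ x); apply: funext => a /=; rewrite (lift_lift _ kl ek el).
Qed.

Lemma inter_refine (I J : Type) (U : I -> set X) (V : J -> set X) (r : J -> I) n
    (i : 'I_n -> J) : (forall j, V j `<=` U (r j)) -> inter V i `<=` inter U (r \o i).
Proof. by move=> VU x Vx k; exact: VU. Qed.

Lemma inter_comp (I : Type) (U : I -> set X) m n (s : 'I_m -> 'I_n) (i : 'I_n -> I) :
  inter U i `<=` inter U (i \o s).
Proof. by move=> x Ux k; exact: Ux. Qed.

Lemma is_cochain_cdiff (I : Type) (U : I -> set X) p (c : cochain X A I p) :
  is_cochain U c -> is_cochain U (cdiff c).
Proof.
move=> cc i; apply: within_altsum => k.
by apply: within_subset (cc (i \o lift k)); exact: inter_comp.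
Qed.

Lemma is_cochain_refine (I J : Type) (U : I -> set X) (V : J -> set X) (r : J -> I) p
    (c : cochain X A I p) : (forall j, V j `<=` U (r j)) ->
  is_cochain U c -> is_cochain V (fun i => c (r \o i)).
Proof. by move=> VU cc i; apply: within_subset (cc (r \o i)); exact: inter_refine. Qed.

Lemma is_cocycle_refine (I J : Type) (U : I -> set X) (V : J -> set X) (r : J -> I) p
    (c : cochain X A I p) : (forall j, V j `<=` U (r j)) ->
  is_cocycle U c -> is_cocycle V (fun i => c (r \o i)).
Proof.
move=> VU [cc dc]; split; first exact: is_cochain_refine VU cc.
by move=> i x Vx; rewrite cdiff_comp dc //; exact: inter_refine Vx.
Qed.

Lemma cohomologous_cocycle p (z z' : cech X A p) :
  cohomologous z z' -> cech_cocycle z <-> cech_cocycle z'.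
Proof.
elim=> {z z'} // [z z' _ h|z1 z2 z3 _ h1 _ h2]; first by split=> /h.
exact: iff_trans h1 h2.
Qed.

Lemma cohomologous_refine p (U V : open_cover X) (r : oc_idx V -> oc_idx U)
    (c : cochain X A (oc_idx U) p.+1) : (forall j, V j `<=` U (r j)) ->
  is_cocycle U c -> cohomologous (Cech c) (Cech (fun i => c (r \o i))).
Proof.
move=> VU cc; apply: cohomologous_step => //; first exact: is_cocycle_refine cc.
exists r; split=> //; exists (fun _ _ => 0); split.
  by move=> i; exact: within_cst.
by move=> i x _; rewrite /cdiff altsum_eq0 ?addr0.
Qed.

Lemma cohomologous_cdiff p (U : open_cover X) (c c' : cochain X A (oc_idx U) p.+1) b :
  is_cocycle U c -> is_cocycle U c' -> is_cochain U b ->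
  (forall i x, inter U i x -> c' i x = c i x + cdiff b i x) ->
  cohomologous (Cech c) (Cech c').
Proof.
move=> cc cc' cb e; apply: cohomologous_step => //.
by exists id; split=> [j x //|]; exists b; split.
Qed.

Lemma class_of_eq p (z z' : cech X A p) : cohomologous z z' -> class_of z = class_of z'.
Proof.
move=> h; apply/funext => y; apply/propext; split; apply: cohomologous_trans => //.
exact: cohomologous_sym.
Qed.

End CechGeneral.

Section ProductCover.
Variable X : topologicalType.

Lemma prod_cover_open (U V : open_cover X) (ij : oc_idx U * oc_idx V) :
  open (U ij.1 `&` V ij.2).
Proof. by apply: openI; exact: oc_open. Qed.

Lemma prod_cover_cover (U V : open_cover X) (x : X) :
  exists ij : oc_idx U * oc_idx V, (U ij.1 `&` V ij.2) x.
Proof.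
by have [i Ui] := oc_cover U x; have [j Vj] := oc_cover V x; exists (i, j).
Qed.

Definition prod_cover (U V : open_cover X) : open_cover X :=
  OpenCover (@prod_cover_open U V) (@prod_cover_cover U V).

End ProductCover.

Section Cup.
Variable X : topologicalType.

Lemma within_zdisc2 (op : int -> int -> int) (D : set X) (f g : X -> zdisc) :
  {within D, continuous f} -> {within D, continuous g} ->
  {within D, continuous (fun x => op (f x) (g x) : zdisc)}.
Proof.
move=> cf cg.
apply: (@within_comp_continuous _ _ _ D (fun x => (f x, g x))
  (fun x : zdisc * zdisc => op x.1 x.2 : zdisc)); last exact: within_pair.
move=> x B /nbhs_singleton Bx; exists ([set x.1], [set x.2]).
  by split; rewrite [nbhs _]/(principal_filter _); apply/principal_filterP.
by move=> [a b] [/= -> ->].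
Qed.

Lemma is_cochain_cup (I : Type) (U : I -> set X) p q (f : cochain X zdisc I p)
    (g : cochain X zdisc I q) :
  is_cochain U f -> is_cochain U g -> is_cochain U (cup_cochain f g).
Proof.
move=> cf cg i; apply: (within_zdisc2 (op := *%R)).
  by apply: within_subset (cf _) => x Ux k; exact: Ux.
by apply: within_subset (cg _) => x Ux k; exact: Ux.
Qed.

Lemma cdiff_cup (I : Type) p q (f : cochain X zdisc I p) (g : cochain X zdisc I q) i x :
  cdiff (cup_cochain f g) i x =
  (cdiff f (fun a : 'I_p.+2 => i (inord a)) x : int) * (g (fun b => i (inord (p.+1 + b))) x : int) +
  ((f (fun a => i (inord a)) x : int) *
   (cdiff g (fun b : 'I_q.+2 => i (inord (p + b))) x : int)) *~ (-1) ^+ p :> int.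
Proof.
exact: (altsum_cup (fun j => f j x : int) (fun j => g j x : int)).
Qed.

Lemma is_cocycle_cup (I : Type) (U : I -> set X) p q (f : cochain X zdisc I p)
    (g : cochain X zdisc I q) :
  is_cocycle U f -> is_cocycle U g -> is_cocycle U (cup_cochain f g).
Proof.
move=> [cf df] [cg dg]; split; first exact: is_cochain_cup.
move=> i x Ux; rewrite cdiff_cup df => [|k]; last exact: Ux.
by rewrite dg => [|k]; [rewrite mul0r mulr0 mul0rz|exact: Ux].
Qed.

(* Taking the product over the product cover lets each factor be refined on its
   own, so that no homotopy between refinement maps is needed below. *)
Definition cross p q (z : cech X zdisc p) (z' : cech X zdisc q) : cech X zdisc (p + q) :=
  @Cech X zdisc (p + q) (prod_cover (cech_cover z) (cech_cover z'))
    (cup_cochain (fun i => @cech_fun _ _ p z (fst \o i)) (fun i => @cech_fun _ _ q z' (snd \o i))).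

Lemma cross_cocycle p q (z : cech X zdisc p) (z' : cech X zdisc q) :
  cech_cocycle z -> cech_cocycle z' -> cech_cocycle (cross z z').
Proof.
move=> cz cz'; apply: is_cocycle_cup.
  by apply: (is_cocycle_refine (r := fst)) cz => -[j j'] x [].
by apply: (is_cocycle_refine (r := snd)) cz' => -[j j'] x [].
Qed.

(** Since [z'] is a cocycle, the Leibniz rule makes (delta b) cup [z'] the coboundary of b cup
    [z']. *)
Lemma cross_cohomologous_l (z1 z2 z' : cech X zdisc 2) : cech_cocycle z' ->
  cohomologous z1 z2 -> cohomologous (cross z1 z') (cross z2 z').
Proof.
move=> cz'; elim=> {z1 z2} [z1 z2 c1 c2 [r [sub [b [cb bE]]]]|z|z1 z2 _ h|z1 z2 z3 _ h1 _ h2].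
- apply: cohomologous_step; try exact: cross_cocycle.
  exists (fun j => (r j.1, j.2)); split; first by move=> [j j'] x [/sub].
  exists (cup_cochain (fun i => b (fst \o i)) (fun i => @cech_fun _ _ 2 z' (snd \o i))); split.
    apply: is_cochain_cup.
      by apply: (is_cochain_refine (r := fst)) cb => -[j j'] x [].
    by apply: (is_cochain_refine (r := snd)) cz'.1 => -[j j'] x [].
  move=> i x Ux; rewrite (@cdiff_cup _ 1 2) (cdiff_comp snd) cz'.2; last first.
    by move=> k; case: (Ux (inord (1 + k))).
  rewrite mulr0 mul0rz addr0 [LHS]/(_ * _) bE; last by move=> k; case: (Ux (inord k)).
  exact: (@mulrDl int).
- exact: cohomologous_refl.
- exact: cohomologous_sym.
- exact: cohomologous_trans h1 h2.
Qed.

Lemma cross_cohomologous_r (z z1 z2 : cech X zdisc 2) : cech_cocycle z ->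
  cohomologous z1 z2 -> cohomologous (cross z z1) (cross z z2).
Proof.
move=> cz; elim=> {z1 z2} [z1 z2 c1 c2 [r [sub [b [cb bE]]]]|z'|z1 z2 _ h|z1 z2 z3 _ h1 _ h2].
- apply: cohomologous_step; try exact: cross_cocycle.
  exists (fun j => (j.1, r j.2)); split; first by move=> [j j'] x [? /sub].
  exists (cup_cochain (fun i => @cech_fun _ _ 2 z (fst \o i)) (fun i => b (snd \o i))); split.
    apply: (@is_cochain_cup _ _ 2 1).
      by apply: (is_cochain_refine (r := fst)) cz.1 => -[j j'] x [].
    by apply: (is_cochain_refine (r := snd)) cb => -[j j'] x [].
  move=> i x Ux; rewrite (@cdiff_cup _ 2 1) (cdiff_comp fst) cz.2; last first.
    by move=> k; case: (Ux (inord k)).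
  (* The Leibniz sign is (-1)^2 because [z] has degree 2, so b needs no sign. *)
  rewrite (cdiff_comp snd) mul0r add0r expr2 mulrNN mulr1 mulr1z [LHS]/(_ * _) bE; last first.
    by move=> k; case: (Ux (inord (2 + k))).
  exact: (@mulrDr int).
- exact: cohomologous_refl.
- exact: cohomologous_sym.
- exact: cohomologous_trans h1 h2.
Qed.

Lemma cup_class (z z' : cech X zdisc 2) : cech_cocycle z -> cech_cocycle z' ->
  cup (class_of z) (class_of z') = class_of (cross z z').
Proof.
move=> cz cz'; apply/funext => y; apply/propext; split; last first.
  move=> h; exists (prod_cover (cech_cover z) (cech_cover z')),
    (fun i => @cech_fun _ _ 2 z (fst \o i)), (fun i => @cech_fun _ _ 2 z' (snd \o i)).
  split=> //.
    case: z cz {h} => U f cz.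
    apply: (@cohomologous_refine _ _ 1 U (prod_cover U (cech_cover z')) fst f) cz.
    by move=> [j j'] x [].
  case: z' cz' {h} => U f cz'.
  apply: (@cohomologous_refine _ _ 1 U (prod_cover (cech_cover z) U) snd f) cz'.
  by move=> [j j'] x [].
move=> [U [f [g [hf hg]]]]; apply: cohomologous_trans.
have cf := (cohomologous_cocycle hf).1 cz; have cg := (cohomologous_cocycle hg).1 cz'.
apply: cohomologous_trans (cross_cohomologous_l cz' hf) _.
(* Once both factors have been replaced, the product over [prod_cover U U] is restricted along the
   diagonal to the product over [U]. *)
apply: cohomologous_trans (cross_cohomologous_r cf hg) _.
apply: (@cohomologous_refine _ _ 3 (prod_cover U U) U (fun j => (j, j)) _ _
  (cross_cocycle cf cg)).
by move=> j x.
Qed.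

End Cup.

(** * Exactness of the bisimplicial Cech complex of a square cover *)

Section SquareCoverExactness.
Variables (Q : square) (C : square_cover Q) (A : topologicalZmodType).
Hypothesis Qsplit : locally_split_square Q.
Hypothesis pair_inj : forall w w' : sq_W Q,
  sq_p1 w = sq_p1 w' -> sq_p2 w = sq_p2 w' -> w = w'.

Local Notation W := (sq_W Q).
Local Notation Y1 := (sq_Y1 Q).
Local Notation Y2 := (sq_Y2 Q).
Local Notation p1 := (@sq_p1 Q).
Local Notation p2 := (@sq_p2 Q).
Local Notation pi1 := (@sq_pi1 Q).
Local Notation pi2 := (@sq_pi2 Q).
Local Notation q1 := (@sc_q1 Q C).
Local Notation q2 := (@sc_q2 Q C).
Local Notation r1 := (@sc_r1 Q C).
Local Notation r2 := (@sc_r2 Q C).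

Lemma sq_pi1_continuous : continuous pi1.
Proof. by case: Qsplit => -[]. Qed.

Lemma sq_pi2_continuous : continuous pi2.
Proof. by case: Qsplit => _ []. Qed.

Lemma sq_pair_val_continuous : continuous (fun w => set_val (@sq_pair Q w)).
Proof.
apply/continuous_subspace_setT; apply: within_comp_continuous (@set_val_continuous _ _) _.
by apply: within_continuous; case: Qsplit => _ _ [].
Qed.

Lemma sq_p1_continuous : continuous p1.
Proof.
by apply/continuous_subspace_setT; apply: (within_fst (within_continuous sq_pair_val_continuous)).
Qed.

Lemma sq_p2_continuous : continuous p2.
Proof.
by apply/continuous_subspace_setT; apply: (within_snd (within_continuous sq_pair_val_continuous)).
Qed.

Lemma sq_lift (y1 : Y1) (y2 : Y2) : pi1 y1 = pi2 y2 ->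
  exists w, p1 w = y1 /\ p2 w = y2.
Proof.
move=> e; have [_ _ [_ surj _]] := Qsplit.
have [w we] := surj (exist _ (y1, y2) (mem_set e)).
have we' : (p1 w, p2 w) = (y1, y2) by exact: (congr1 set_val we).
by exists w; case: we'.
Qed.

Lemma sq_over1 (y1 : Y1) : exists w, p1 w = y1.
Proof.
have [_ [_ surj _] _] := Qsplit; have [y2 e] := surj (pi1 y1).
by have [w [<- _]] := sq_lift (esym e); exists w.
Qed.

Lemma sq_over2 (y2 : Y2) : exists w, p2 w = y2.
Proof.
have [[_ surj _] _ _] := Qsplit; have [y1 e] := surj (pi2 y2).
by have [w [_ <-]] := sq_lift e; exists w.
Qed.

(* The point of W over (y1, y2), or the default d if y1 and y2 lie over
   different points of X. *)
Definition sq_pt (d : W) (y1 : Y1) (y2 : Y2) : W :=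
  xget d [set w | p1 w = y1 /\ p2 w = y2].

Lemma sq_ptP d y1 y2 : pi1 y1 = pi2 y2 ->
  p1 (sq_pt d y1 y2) = y1 /\ p2 (sq_pt d y1 y2) = y2.
Proof.
by move=> /sq_lift[w hw]; rewrite /sq_pt; case: xgetP => [w' -> //|/(_ w)].
Qed.

Lemma sq_pt_eq d w y1 y2 : p1 w = y1 -> p2 w = y2 -> sq_pt d y1 y2 = w.
Proof.
move=> e1 e2; have [|h1 h2] := @sq_ptP d y1 y2; first by rewrite -e1 -e2 sq_comm.
by apply: pair_inj; rewrite ?h1 ?h2.
Qed.

Definition Y1_index n (x : 'I_n.+1 -> oc_idx (sc_X C)) : 'I_n.+1 -> sc_I1 C :=
  proj1_sig (cid (sc_Y1_section x)).
Definition Y1_sec n (x : 'I_n.+1 -> oc_idx (sc_X C)) : sq_X Q -> Y1 :=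
  proj1_sig (cid (proj2_sig (cid (sc_Y1_section x)))).
Definition Y2_index n (x : 'I_n.+1 -> oc_idx (sc_X C)) : 'I_n.+1 -> sc_I2 C :=
  proj1_sig (cid (sc_Y2_section x)).
Definition Y2_sec n (x : 'I_n.+1 -> oc_idx (sc_X C)) : sq_X Q -> Y2 :=
  proj1_sig (cid (proj2_sig (cid (sc_Y2_section x)))).

Lemma Y1_secP n (x : 'I_n.+1 -> oc_idx (sc_X C)) :
  [/\ r1 \o Y1_index x = x, {within inter (sc_X C) x, continuous (Y1_sec x)} &
      forall z, inter (sc_X C) x z ->
        pi1 (Y1_sec x z) = z /\ inter (@sc_Y1 Q C) (Y1_index x) (Y1_sec x z)].
Proof.
have [h1 h2 h3] := proj2_sig (cid (proj2_sig (cid (sc_Y1_section x)))).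
by split=> //; apply/funext.
Qed.

Lemma Y2_secP n (x : 'I_n.+1 -> oc_idx (sc_X C)) :
  [/\ r2 \o Y2_index x = x, {within inter (sc_X C) x, continuous (Y2_sec x)} &
      forall z, inter (sc_X C) x z ->
        pi2 (Y2_sec x z) = z /\ inter (@sc_Y2 Q C) (Y2_index x) (Y2_sec x z)].
Proof.
have [h1 h2 h3] := proj2_sig (cid (proj2_sig (cid (sc_Y2_section x)))).
by split=> //; apply/funext.
Qed.

(* sc_W_section for a, phrased for an arbitrary pair of maps (f, g) so that no
   total map into the (possibly empty) fibre product has to be provided. *)
Definition W_lifting n (b1 : 'I_n.+1 -> sc_I1 C) (b2 : 'I_n.+1 -> sc_I2 C)
    (a : 'I_n.+1 -> sc_IW C) : Prop :=
  [/\ q1 \o a = b1, q2 \o a = b2 &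
    forall (Z : topologicalType) (D : set Z) (d : Z -> W) (f : Z -> Y1) (g : Z -> Y2),
      {within D, continuous f} -> {within D, continuous g} ->
      (forall z, D z -> [/\ pi1 (f z) = pi2 (g z), inter (@sc_Y1 Q C) b1 (f z) &
                            inter (@sc_Y2 Q C) b2 (g z)]) ->
      {within D, continuous (fun z => sq_pt (d z) (f z) (g z))} /\
      forall z, D z -> inter (@sc_W Q C) a (sq_pt (d z) (f z) (g z))].

Lemma W_lifting_exists n (b1 : 'I_n.+1 -> sc_I1 C) (b2 : 'I_n.+1 -> sc_I2 C) :
  r1 \o b1 = r2 \o b2 -> exists a, W_lifting b1 b2 a.
Proof.
move=> e; have [|a [s]] := @sc_W_section Q C n b1 b2.
  by move=> k; exact: (congr1 (@^~ k) e).
set S := [set y | _] => -[ab cs sE]; exists a.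
split; [by apply/funext => k; case: (ab k)|by apply/funext => k; case: (ab k)|].
move=> Z D d f g cf cg fg.
have ptE z (y : Defs.fprod pi1 pi2) : D z -> set_val y = (f z, g z) ->
    S y /\ sq_pt (d z) (f z) (g z) = s y.
  move=> Dz yE; have [_ fb gb] := fg z Dz; have Sy : S y by rewrite /S /= yE.
  split=> //; have [sy _] := sE _ Sy.
  have sy' : (p1 (s y), p2 (s y)) = (f z, g z) by rewrite -yE -[in RHS]sy.
  by apply: sq_pt_eq; case: sy'.
split=> [|z Dz]; last first.
  have [fgz _ _] := fg z Dz.
  have [Sy ->] := ptE z (exist _ (f z, g z) (mem_set fgz)) Dz erefl.
  by case: (sE _ Sy).
(* Localization only provides a point [z0] of [D], whose image [y0] is the default value making [y]
   a total map into the fibre product. *)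
apply: within_local => z0 Dz0; exists setT; split=> //; first exact: openT.
rewrite setIT; have [fgz0 _ _] := fg z0 Dz0.
pose y0 : Defs.fprod pi1 pi2 := exist _ (f z0, g z0) (mem_set fgz0).
pose y z : Defs.fprod pi1 pi2 := insubd y0 (f z, g z).
have yE z : D z -> set_val (y z) = (f z, g z).
  by move=> Dz; have [fgz _ _] := fg z Dz; rewrite [set_val _]val_insubd mem_set.
apply: (@within_eq _ _ _ (fun z => s (y z))).
  by move=> z Dz; have [_ ->] := ptE z _ Dz (yE z Dz).
apply: within_comp cs; first by move=> z Dz; case: (ptE z _ Dz (yE z Dz)).
apply: within_val; apply: (@within_eq _ _ _ (fun z => (f z, g z))).
  by move=> z Dz; rewrite yE.
exact: within_pair.
Qed.

Lemma inter_sc_W (p : nat) (a : 'I_p.+1 -> sc_IW C) w : inter (@sc_W Q C) a w ->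
  inter (@sc_Y1 Q C) (q1 \o a) (p1 w) /\ inter (@sc_Y2 Q C) (q2 \o a) (p2 w).
Proof. by move=> Wa; split=> k; case: (sc_W_sub (Wa k)). Qed.

Lemma inter_sc_Y1 (p : nat) (b : 'I_p.+1 -> sc_I1 C) y : inter (@sc_Y1 Q C) b y ->
  inter (sc_X C) (r1 \o b) (pi1 y).
Proof. by move=> Yb k; exact: sc_Y1_sub. Qed.

Lemma inter_sc_Y2 (p : nat) (b : 'I_p.+1 -> sc_I2 C) y : inter (@sc_Y2 Q C) b y ->
  inter (sc_X C) (r2 \o b) (pi2 y).
Proof. by move=> Yb k; exact: sc_Y2_sub. Qed.

Lemma sc_commf (p : nat) (a : 'I_p.+1 -> sc_IW C) : r1 \o (q1 \o a) = r2 \o (q2 \o a).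
Proof. by apply/funext => k; exact: sc_comm. Qed.

Lemma W_lifting_point (p : nat) (b1 : 'I_p.+1 -> sc_I1 C) (b2 : 'I_p.+1 -> sc_I2 C) a y1 y2 :
  W_lifting b1 b2 a -> pi1 y1 = pi2 y2 -> inter (@sc_Y1 Q C) b1 y1 ->
  inter (@sc_Y2 Q C) b2 y2 ->
  exists w, [/\ p1 w = y1, p2 w = y2 & inter (@sc_W Q C) a w].
Proof.
move=> [_ _ h] e Y1b Y2b; have [d _] := sq_lift e.
(* A point is treated as a constant family; [X] is a convenient parameter space because it contains
   [pi1 y1]. *)
have [] := h (sq_X Q) setT (fun=> d) (fun=> y1) (fun=> y2).
- exact: within_cst.
- exact: within_cst.
- by [].
move=> _ /(_ (pi1 y1) I) Wa; exists (sq_pt d y1 y2); split=> //.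
  by case: (sq_ptP d e).
by case: (sq_ptP d e).
Qed.

(** Any two points over the same point of X, with indices over the same indices, lift to W. Hence
    [F1] and [F2] agree on all such pairs, and either one is recovered from [F1] along the chosen
    local section of Y1, which defines [e]. *)
Lemma descend (p : nat) (F1 : cochain Y1 A (sc_I1 C) p) (F2 : cochain Y2 A (sc_I2 C) p) :
  is_cochain (@sc_Y1 Q C) F1 ->
  (forall a w, inter (@sc_W Q C) a w -> F1 (q1 \o a) (p1 w) = F2 (q2 \o a) (p2 w)) ->
  exists e : cochain (sq_X Q) A (oc_idx (sc_X C)) p,
  [/\ is_cochain (sc_X C) e,
      (forall b y, inter (@sc_Y1 Q C) b y -> F1 b y = e (r1 \o b) (pi1 y)) &
      (forall b y, inter (@sc_Y2 Q C) b y -> F2 b y = e (r2 \o b) (pi2 y))].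
Proof.
move=> cF1 FE.
have E b1 b2 y1 y2 : r1 \o b1 = r2 \o b2 -> pi1 y1 = pi2 y2 ->
    inter (@sc_Y1 Q C) b1 y1 -> inter (@sc_Y2 Q C) b2 y2 -> F1 b1 y1 = F2 b2 y2.
  move=> eb ey Yb1 Yb2; have [a ha] := W_lifting_exists eb.
  have [w [<- <- Wa]] := W_lifting_point ha ey Yb1 Yb2.
  by case: ha => <- <- _; exact: FE.
pose e x z := F1 (Y1_index x) (Y1_sec x z).
have E2 b y : inter (@sc_Y2 Q C) b y -> F2 b y = e (r2 \o b) (pi2 y).
  move=> Yb; have [h1 _ h3] := Y1_secP (r2 \o b); have [h4 h5] := h3 _ (inter_sc_Y2 Yb).
  by apply/esym/E.
exists e; split=> //.
  move=> x; have [_ h2 h3] := Y1_secP x.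
  by apply: within_comp (cF1 (Y1_index x)) => // z /h3[].
move=> b y Yb; have [h1 _ h3] := Y2_secP (r1 \o b); have [h4 h5] := h3 _ (inter_sc_Y1 Yb).
by rewrite (E _ _ _ _ (esym h1) (esym h4)) // E2 // h1 h4.
Qed.

Definition mx2 (T : Type) (m00 m01 m10 m11 : T) (ij : 'I_2 * 'I_2) : T :=
  match val ij.1, val ij.2 with
  | 0%N, 0%N => m00 | 0%N, _ => m01 | _, 0%N => m10 | _, _ => m11
  end.

Lemma mx2_is_grid (T T1 T2 : Type) (f1 : T -> T1) (f2 : T -> T2) m00 m01 m10 m11 :
  f1 m00 = f1 m01 -> f1 m10 = f1 m11 -> f2 m00 = f2 m10 -> f2 m01 = f2 m11 ->
  is_grid f1 f2 (mx2 m00 m01 m10 m11).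
Proof.
move=> e0 e1 e2 e3; split.
  by move=> [[|i] ?] [[|j] ?] [[|j'] ?]; rewrite /mx2 /= ?e0 ?e1.
by move=> [[|i] ?] [[|i'] ?] [[|j] ?]; rewrite /mx2 /= ?e2 ?e3.
Qed.

(** The vanishing on 2 x 2 grids says that the last value is the sum of the two off-diagonal values
    minus the first. On the grid spanned by w = (y1, y2) and the chosen sections this reads Gamma
    (y1, y2) = Gamma (y1, s2) + Gamma (s1, y2) - Gamma (s1, s2), which separates the variables. *)
Lemma d1d2_exact (p : nat) (Gamma : cochain W A (sc_IW C) p) :
  is_cochain (@sc_W Q C) Gamma ->
  (forall (a : 'I_p.+1 -> 'I_2 * 'I_2 -> sc_IW C) (w : grid Q 2 2),
    (forall k, sc_grid (a k)) -> inter (@sc_grid_set Q C 2 2) a w ->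
    altsum (fun k : 'I_2 => altsum (fun l : 'I_2 =>
      let ij := (lift k ord0, lift l ord0) in Gamma (fun m => a m ij) (entry w ij))) = 0) ->
  exists (g1 : cochain Y1 A (sc_I1 C) p) (g2 : cochain Y2 A (sc_I2 C) p),
  [/\ is_cochain (@sc_Y1 Q C) g1, is_cochain (@sc_Y2 Q C) g2 &
      forall a w, inter (@sc_W Q C) a w ->
        Gamma a w = g2 (q2 \o a) (p2 w) - g1 (q1 \o a) (p1 w)].
Proof.
move=> cG dG.
have G4 a00 a01 a10 a11 w00 w01 w10 w11 :
    inter (@sc_W Q C) a00 w00 -> inter (@sc_W Q C) a01 w01 ->
    inter (@sc_W Q C) a10 w10 -> inter (@sc_W Q C) a11 w11 ->
    q1 \o a00 = q1 \o a01 -> q1 \o a10 = q1 \o a11 ->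
    q2 \o a00 = q2 \o a10 -> q2 \o a01 = q2 \o a11 ->
    p1 w00 = p1 w01 -> p1 w10 = p1 w11 -> p2 w00 = p2 w10 -> p2 w01 = p2 w11 ->
    Gamma a11 w11 = Gamma a10 w10 + Gamma a01 w01 - Gamma a00 w00.
  move=> W00 W01 W10 W11 e0 e1 e2 e3 f0 f1 f2 f3.
  pose w : grid Q 2 2 := exist _ (mx2 w00 w01 w10 w11) (mem_set (mx2_is_grid f0 f1 f2 f3)).
  pose a k := mx2 (a00 k) (a01 k) (a10 k) (a11 k).
  have ga k : sc_grid (a k).
    by apply: mx2_is_grid; [move: e0|move: e1|move: e2|move: e3] => /(congr1 (@^~ k)).
  have wa : inter (@sc_grid_set Q C 2 2) a w.
    move=> k [[[|i] ?] [[|j] ?]]; [exact: (W00 k)|exact: (W01 k)|exact: (W10 k)|].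
    exact: (W11 k).
  have H : Gamma a11 w11 - Gamma a10 w10 - (Gamma a01 w01 - Gamma a00 w00) = 0.
    by rewrite -(dG a w ga wa) !altsum2.
  by apply/eqP; rewrite -subr_eq0 -H !opprD !opprK !addrA.
have Gi a a' w : inter (@sc_W Q C) a w -> inter (@sc_W Q C) a' w ->
    q1 \o a = q1 \o a' -> q2 \o a = q2 \o a' -> Gamma a w = Gamma a' w.
  by move=> Wa Wa' e1 e2; rewrite (@G4 a' a' a' a w w w w) // addrK.
have idx1 (b : 'I_p.+1 -> sc_I1 C) : exists a, W_lifting b (Y2_index (r1 \o b)) a.
  by apply: W_lifting_exists; case: (Y2_secP (r1 \o b)).
have idx2 (b : 'I_p.+1 -> sc_I2 C) : exists a, W_lifting (Y1_index (r2 \o b)) b a.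
  by apply: W_lifting_exists; case: (Y1_secP (r2 \o b)).
have idx0 (x : 'I_p.+1 -> oc_idx (sc_X C)) :
    exists a, W_lifting (Y1_index x) (Y2_index x) a.
  apply: W_lifting_exists; case: (Y1_secP x) => -> _ _.
  by case: (Y2_secP x) => ->.
have [a1 h1] := boolp.choice idx1; have [a2 h2] := boolp.choice idx2.
have [a0 h0] := boolp.choice idx0.
have [k1 hk1] := boolp.choice sq_over1; have [k2 hk2] := boolp.choice sq_over2.
pose pt1 (b : 'I_p.+1 -> sc_I1 C) y := sq_pt (k1 y) y (Y2_sec (r1 \o b) (pi1 y)).
pose pt2 (b : 'I_p.+1 -> sc_I2 C) y := sq_pt (k2 y) (Y1_sec (r2 \o b) (pi2 y)) y.
(* On the cover this point depends only on the image of [y] in X; it is indexed by Y2 since its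
   value is absorbed into [g2]. *)
pose pt0 (b : 'I_p.+1 -> sc_I2 C) y :=
  sq_pt (k2 y) (Y1_sec (r2 \o b) (pi2 y)) (Y2_sec (r2 \o b) (pi2 y)).
have cs1 x (Z : topologicalType) (D : set Z) (f : Z -> sq_X Q) :
    {within D, continuous f} -> (forall z, D z -> inter (sc_X C) x (f z)) ->
    {within D, continuous (fun z => @Y1_sec p x (f z))}.
  by move=> cf fx; have [_ c _] := Y1_secP x; exact: within_comp fx cf c.
have cs2 x (Z : topologicalType) (D : set Z) (f : Z -> sq_X Q) :
    {within D, continuous f} -> (forall z, D z -> inter (sc_X C) x (f z)) ->
    {within D, continuous (fun z => @Y2_sec p x (f z))}.
  by move=> cf fx; have [_ c _] := Y2_secP x; exact: within_comp fx cf c.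
have P1 b : {within inter (@sc_Y1 Q C) b, continuous (pt1 b)} /\
    forall y, inter (@sc_Y1 Q C) b y -> inter (@sc_W Q C) (a1 b) (pt1 b y).
  have [_ _ H] := h1 b; apply: H; first exact: within_id.
    by apply: cs2 (within_continuous sq_pi1_continuous) _ => y; exact: inter_sc_Y1.
  move=> y Yb; have [_ _ H] := Y2_secP (r1 \o b).
  by have [-> ?] := H _ (inter_sc_Y1 Yb).
have P2 b : {within inter (@sc_Y2 Q C) b, continuous (pt2 b)} /\
    forall y, inter (@sc_Y2 Q C) b y -> inter (@sc_W Q C) (a2 b) (pt2 b y).
  have [_ _ H] := h2 b; apply: H; last first.
  - move=> y Yb; have [_ _ H] := Y1_secP (r2 \o b).
    by have [-> ?] := H _ (inter_sc_Y2 Yb).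
  - exact: within_id.
  by apply: cs1 (within_continuous sq_pi2_continuous) _ => y; exact: inter_sc_Y2.
have P0 b : {within inter (@sc_Y2 Q C) b, continuous (pt0 b)} /\
    forall y, inter (@sc_Y2 Q C) b y -> inter (@sc_W Q C) (a0 (r2 \o b)) (pt0 b y).
  have [_ _ H] := h0 (r2 \o b); apply: H.
  - by apply: cs1 (within_continuous sq_pi2_continuous) _ => y; exact: inter_sc_Y2.
  - by apply: cs2 (within_continuous sq_pi2_continuous) _ => y; exact: inter_sc_Y2.
  move=> y Yb; have [_ _ H] := Y1_secP (r2 \o b); have [_ _ H'] := Y2_secP (r2 \o b).
  by have [-> ?] := H _ (inter_sc_Y2 Yb); have [-> ?] := H' _ (inter_sc_Y2 Yb).
exists (fun b y => - Gamma (a1 b) (pt1 b y)).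
exists (fun b y => Gamma (a2 b) (pt2 b y) - Gamma (a0 (r2 \o b)) (pt0 b y)).
split.
- by move=> b; apply: withinN; apply: within_comp (P1 b).2 (P1 b).1 (cG _).
- move=> b; apply: withinB; first exact: within_comp (P2 b).2 (P2 b).1 (cG _).
  exact: within_comp (P0 b).2 (P0 b).1 (cG _).
move=> a w Wa; rewrite opprK; have [Wa1 Wa2] := inter_sc_W Wa.
have ea := sc_commf a; have ew := sq_comm w.
have [e11 e12 _] := h1 (q1 \o a); have [e21 e22 _] := h2 (q2 \o a).
have [e01 e02 _] := h0 (r2 \o (q2 \o a)).
have [_ _ HY1] := Y1_secP (r2 \o (q2 \o a)); have [_ _ HY2] := Y2_secP (r2 \o (q2 \o a)).
have [z1 _] := HY1 _ (inter_sc_Y2 Wa2); have [z2 _] := HY2 _ (inter_sc_Y2 Wa2).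
have [f11 f12] : p1 (pt1 (q1 \o a) (p1 w)) = p1 w /\
    p2 (pt1 (q1 \o a) (p1 w)) = Y2_sec (r2 \o (q2 \o a)) (pi2 (p2 w)).
  by rewrite /pt1 -ea -ew; apply: sq_ptP; rewrite ea ew z2.
have [f21 f22] := @sq_ptP (k2 (p2 w)) (Y1_sec (r2 \o (q2 \o a)) (pi2 (p2 w))) (p2 w) z1.
have [f01 f02] := @sq_ptP (k2 (p2 w)) (Y1_sec (r2 \o (q2 \o a)) (pi2 (p2 w)))
  (Y2_sec (r2 \o (q2 \o a)) (pi2 (p2 w))) (etrans z1 (esym z2)).
rewrite (G4 _ _ _ _ _ _ _ w ((P0 _).2 _ Wa2) ((P2 _).2 _ Wa2) ((P1 _).2 _ Wa1) Wa) //.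
- by rewrite [RHS]addrC addrA.
- by rewrite e01 e21.
- by rewrite e02 e12 ea.
- by rewrite f01 f21.
- by rewrite f02 f12.
Qed.

(** The grid [m] bordered by a new row 0, a new column 0 and the corner [m00]. *)
Definition ext2 (T : Type) n (m00 : T) (m0 m1 : 'I_n -> T) (m : 'I_n * 'I_n -> T)
    (ij : 'I_n.+1 * 'I_n.+1) : T :=
  match unlift ord0 ij.1, unlift ord0 ij.2 with
  | None, None => m00
  | None, Some j => m0 j
  | Some i, None => m1 i
  | Some i, Some j => m (i, j)
  end.

Lemma ext2_is_grid (T T1 T2 : Type) (f1 : T -> T1) (f2 : T -> T2) n m00
    (m0 m1 : 'I_n -> T) (m : 'I_n * 'I_n -> T) :
  (forall j, f1 (m0 j) = f1 m00) -> (forall i j, f1 (m (i, j)) = f1 (m1 i)) ->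
  (forall i, f2 (m1 i) = f2 m00) -> (forall i j, f2 (m (i, j)) = f2 (m0 j)) ->
  is_grid f1 f2 (ext2 m00 m0 m1 m).
Proof.
move=> h1 h2 h3 h4; split=> [i j j'|i i' j]; rewrite /ext2 /=.
  by case: (unlift _ i) => [?|]; case: (unlift _ j) => [?|];
    case: (unlift _ j') => [?|]; rewrite ?h1 ?h2.
by case: (unlift _ i) => [?|]; case: (unlift _ i') => [?|];
  case: (unlift _ j) => [?|]; rewrite ?h3 ?h4.
Qed.

Lemma ext2_omit (T : Type) n m00 (m0 m1 : 'I_n.+1 -> T) (m : 'I_n.+1 * 'I_n.+1 -> T) k l :
  omit1 (lift ord0 k) (omit2 (lift ord0 l) (ext2 m00 m0 m1 m)) =
  ext2 m00 (m0 \o lift l) (m1 \o lift k) (omit1 k (omit2 l m)).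
Proof.
have L0 (h : 'I_n.+1) : lift (lift ord0 h) ord0 = ord0 :> 'I_n.+2 by exact: val_inj.
have L1 (h : 'I_n.+1) (i : 'I_n) :
    lift (lift ord0 h) (lift ord0 i) = lift ord0 (lift h i) :> 'I_n.+2.
  by apply: val_inj; rewrite /= /bump /= !add1n ltnS addnS.
apply/funext => -[i j]; rewrite /omit1 /omit2 /ext2 /=.
by case: (unliftP ord0 i) => [i' ->|->]; case: (unliftP ord0 j) => [j' ->|->];
  rewrite ?L0 ?L1 ?liftK ?unlift_none.
Qed.

Lemma ext2_omit0 (T : Type) n m00 (m0 m1 : 'I_n -> T) (m : 'I_n * 'I_n -> T) :
  omit1 ord0 (omit2 ord0 (ext2 m00 m0 m1 m)) = m.
Proof. by apply/funext => -[i j]; rewrite /omit1 /omit2 /ext2 /= !liftK. Qed.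

(* An index over (b1, b2) satisfying W_lifting, with a default for indices b1
   and b2 over different indices of the cover of X. *)
Definition W_idx (d : sc_IW C) (b1 : sc_I1 C) (b2 : sc_I2 C) : sc_IW C :=
  match pselect (exists a, @W_lifting 0 (fun=> b1) (fun=> b2) (fun=> a)) with
  | left e => proj1_sig (cid e)
  | right _ => d
  end.

Lemma W_idxP d b1 b2 : r1 b1 = r2 b2 ->
  @W_lifting 0 (fun=> b1) (fun=> b2) (fun=> W_idx d b1 b2).
Proof.
move=> e; rewrite /W_idx; case: pselect => [h|[]]; first exact: proj2_sig (cid h).
have [|a ha] := @W_lifting_exists 0 (fun=> b1) (fun=> b2); first exact/funext.
exists (a ord0); rewrite (_ : (fun=> a ord0) = a) //.
by apply/funext => i; rewrite (ord1 i).
Qed.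

Lemma W_idx_q d b1 b2 : r1 b1 = r2 b2 -> q1 (W_idx d b1 b2) = b1 /\ q2 (W_idx d b1 b2) = b2.
Proof.
by move=> /(W_idxP d)[/(congr1 (@^~ ord0)) h1 /(congr1 (@^~ ord0)) h2 _].
Qed.

Lemma W_idx_eq d d' b1 b2 : r1 b1 = r2 b2 -> W_idx d b1 b2 = W_idx d' b1 b2.
Proof.
move=> e; have := W_idxP d e; rewrite /W_idx; case: pselect => // ne h; case: ne.
by exists d.
Qed.

Lemma W_idx_continuous a b1 b2 (Z : topologicalType) (D : set Z) (d : Z -> W)
    (f : Z -> Y1) (g : Z -> Y2) : r1 b1 = r2 b2 ->
  {within D, continuous f} -> {within D, continuous g} ->
  (forall z, D z -> [/\ pi1 (f z) = pi2 (g z), sc_Y1 b1 (f z) & sc_Y2 b2 (g z)]) ->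
  {within D, continuous (fun z => sq_pt (d z) (f z) (g z))} /\
  forall z, D z -> sc_W (W_idx a b1 b2) (sq_pt (d z) (f z) (g z)).
Proof.
move=> e cf cg fg; have [_ _ H] := W_idxP a e.
have [z Dz|c h] := H Z D d f g cf cg; first by have [? ? ?] := fg z Dz; split.
by split=> // z /h/(_ ord0).
Qed.

Lemma W_idx_pt a d b1 b2 y1 y2 : r1 b1 = r2 b2 -> pi1 y1 = pi2 y2 ->
  sc_Y1 b1 y1 -> sc_Y2 b2 y2 -> sc_W (W_idx a b1 b2) (sq_pt d y1 y2).
Proof.
move=> eb ey Yb1 Yb2.
have [_ h] := @W_idx_continuous a b1 b2 (sq_X Q) setT (fun=> d) (fun=> y1) (fun=> y2)
  eb (@within_cst _ _ _ _) (@within_cst _ _ _ _) (fun _ _ => And3 ey Yb1 Yb2).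
exact: h (pi1 y1) I.
Qed.

Definition ext_index n b1 b2 (a : 'I_n.+1 * 'I_n.+1 -> sc_IW C) :=
  ext2 (W_idx (a (ord0, ord0)) b1 b2)
    (fun j => W_idx (a (ord0, ord0)) b1 (q2 (a (ord0, j))))
    (fun i => W_idx (a (ord0, ord0)) (q1 (a (i, ord0))) b2) a.

Definition ext_point n y1 y2 (w : 'I_n.+1 * 'I_n.+1 -> W) :=
  ext2 (sq_pt (w (ord0, ord0)) y1 y2)
    (fun j => sq_pt (w (ord0, ord0)) y1 (p2 (w (ord0, j))))
    (fun i => sq_pt (w (ord0, ord0)) (p1 (w (i, ord0))) y2) w.

Lemma sc_grid_r m n (a : 'I_m.+1 * 'I_n.+1 -> sc_IW C) ij : sc_grid a ->
  r1 (q1 (a ij)) = r1 (q1 (a (ord0, ord0))).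
Proof.
case: ij => i j [g1 g2]; rewrite (g1 i j ord0) !sc_comm.
by rewrite (g2 i ord0 ord0).
Qed.

Lemma is_grid_pi m n (w : 'I_m.+1 * 'I_n.+1 -> W) ij : is_grid p1 p2 w ->
  pi1 (p1 (w ij)) = pi1 (p1 (w (ord0, ord0))).
Proof.
case: ij => i j [g1 g2]; rewrite (g1 i j ord0) !sq_comm.
by rewrite (g2 i ord0 ord0).
Qed.

Lemma ext_index_grid n b1 b2 (a : 'I_n.+1 * 'I_n.+1 -> sc_IW C) : sc_grid a ->
  r1 b1 = r2 b2 -> r1 b1 = r1 (q1 (a (ord0, ord0))) -> sc_grid (ext_index b1 b2 a).
Proof.
move=> ga e e'.
have c0 j : r1 b1 = r2 (q2 (a (ord0, j))) by rewrite -sc_comm (sc_grid_r _ ga).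
have c1 i : r1 (q1 (a (i, ord0))) = r2 b2 by rewrite (sc_grid_r _ ga) -e'.
apply: ext2_is_grid => [j|i j|i|i j].
- by rewrite (W_idx_q _ (c0 j)).1 (W_idx_q _ e).1.
- by rewrite (W_idx_q _ (c1 i)).1 (ga.1 i j ord0).
- by rewrite (W_idx_q _ (c1 i)).2 (W_idx_q _ e).2.
- by rewrite (W_idx_q _ (c0 j)).2 (ga.2 i ord0 j).
Qed.

Lemma ext_point_grid n y1 y2 (w : 'I_n.+1 * 'I_n.+1 -> W) : is_grid p1 p2 w ->
  pi1 y1 = pi2 y2 -> pi1 y1 = pi1 (p1 (w (ord0, ord0))) ->
  is_grid p1 p2 (ext_point y1 y2 w).
Proof.
move=> ga e e'.
have c0 j : pi1 y1 = pi2 (p2 (w (ord0, j))) by rewrite -sq_comm (is_grid_pi _ ga).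
have c1 i : pi1 (p1 (w (i, ord0))) = pi2 y2 by rewrite (is_grid_pi _ ga) -e'.
apply: ext2_is_grid => [j|i j|i|i j].
- by rewrite (sq_ptP _ (c0 j)).1 (sq_ptP _ e).1.
- by rewrite (sq_ptP _ (c1 i)).1 (ga.1 i j ord0).
- by rewrite (sq_ptP _ (c1 i)).2 (sq_ptP _ e).2.
- by rewrite (sq_ptP _ (c0 j)).2 (ga.2 i ord0 j).
Qed.

Lemma ext_point_set n b1 b2 y1 y2 (a : 'I_n.+1 * 'I_n.+1 -> sc_IW C)
    (w : 'I_n.+1 * 'I_n.+1 -> W) : sc_grid a -> is_grid p1 p2 w ->
  (forall ij, sc_W (a ij) (w ij)) ->
  r1 b1 = r2 b2 -> r1 b1 = r1 (q1 (a (ord0, ord0))) ->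
  pi1 y1 = pi2 y2 -> pi1 y1 = pi1 (p1 (w (ord0, ord0))) -> sc_Y1 b1 y1 -> sc_Y2 b2 y2 ->
  forall ij, sc_W (ext_index b1 b2 a ij) (ext_point y1 y2 w ij).
Proof.
move=> ga gw wa e e' f f' Yb1 Yb2 [i j]; rewrite /ext_index /ext_point /ext2 /=.
case: (unlift ord0 i) => [i'|]; case: (unlift ord0 j) => [j'|] //.
- apply: W_idx_pt => //.
  + by rewrite (sc_grid_r _ ga) -e'.
  + by rewrite (is_grid_pi _ gw) -f'.
  + exact: (sc_W_sub (wa (i', ord0))).1.
- apply: W_idx_pt => //.
  + by rewrite -sc_comm (sc_grid_r _ ga).
  + by rewrite -sq_comm (is_grid_pi _ gw).
  + exact: (sc_W_sub (wa (ord0, j'))).2.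
- exact: W_idx_pt.
Qed.

(** Omission changes the default index and the entries from which the row and column indices are
    read, but in a grid these indices stay the same, and by [W_idx_eq] the default does not
    matter. *)
Lemma ext_index_omit n b1 b2 (a : 'I_n.+2 * 'I_n.+2 -> sc_IW C) k l : sc_grid a ->
  r1 b1 = r2 b2 -> r1 b1 = r1 (q1 (a (ord0, ord0))) ->
  omit1 (lift ord0 k) (omit2 (lift ord0 l) (ext_index b1 b2 a)) =
  ext_index b1 b2 (omit1 k (omit2 l a)).
Proof.
move=> ga e e'; rewrite /ext_index ext2_omit /omit1 /omit2 /=.
congr (ext2 _ _ _ _); first exact: W_idx_eq.
  apply/funext => j /=; rewrite (ga.2 (lift k ord0) ord0); apply: W_idx_eq.
  by rewrite -sc_comm (sc_grid_r _ ga).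
apply/funext => i /=; rewrite (ga.1 _ (lift l ord0) ord0); apply: W_idx_eq.
by rewrite (sc_grid_r _ ga) -e'.
Qed.

Lemma ext_point_omit n y1 y2 (w : 'I_n.+2 * 'I_n.+2 -> W) k l : is_grid p1 p2 w ->
  pi1 y1 = pi2 y2 -> pi1 y1 = pi1 (p1 (w (ord0, ord0))) ->
  omit1 (lift ord0 k) (omit2 (lift ord0 l) (ext_point y1 y2 w)) =
  ext_point y1 y2 (omit1 k (omit2 l w)).
Proof.
move=> gw e e'; rewrite /ext_point ext2_omit /omit1 /omit2 /=.
have pt_eq d d' z1 z2 : pi1 z1 = pi2 z2 -> sq_pt d z1 z2 = sq_pt d' z1 z2.
  by move=> h; have [h1 h2] := sq_ptP d' h; exact: sq_pt_eq.
congr (ext2 _ _ _ _); first exact: pt_eq.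
  apply/funext => j /=; rewrite (gw.2 (lift k ord0) ord0); apply: pt_eq.
  by rewrite -sq_comm (is_grid_pi _ gw).
apply/funext => i /=; rewrite (gw.1 _ (lift l ord0) ord0); apply: pt_eq.
by rewrite (is_grid_pi _ gw) -e'.
Qed.

Lemma const_is_grid m n (w : W) : is_grid p1 p2 (fun _ : 'I_m * 'I_n => w).
Proof. by []. Qed.

Definition to_grid (w0 : W) m n (w : 'I_m * 'I_n -> W) : grid Q m n :=
  insubd (exist _ (fun=> w0) (mem_set (const_is_grid m n w0)) : grid Q m n)
    (w : {ptws ('I_m * 'I_n)%type -> W}).

Lemma entry_to_grid w0 m n (w : 'I_m * 'I_n -> W) : is_grid p1 p2 w ->
  entry (to_grid w0 w) = w.
Proof. by move=> gw; rewrite /entry [set_val _]val_insubd mem_set. Qed.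

Lemma grid_inj m n (w w' : grid Q m n) : entry w = entry w' -> w = w'.
Proof. by move=> e; apply: val_inj. Qed.

(* v a w is u on the grid with last entry w and all other entries given by the
   chosen sections; comparing u a w with these four values takes place on the
   3x3 grid obtained from w by adjoining a row and a column of sections. *)
Lemma d1d2_lift (u : ('I_2 * 'I_2 -> sc_IW C) -> grid Q 2 2 -> A) :
  (forall a, sc_grid a -> {within @sc_grid_set Q C 2 2 a, continuous (u a)}) ->
  (forall (a : 'I_3 * 'I_2 -> sc_IW C) w, sc_grid a -> sc_grid_set a w ->
    altsum (fun k => u (omit1 k a) (face1 k w)) = 0) ->
  (forall (a : 'I_2 * 'I_3 -> sc_IW C) w, sc_grid a -> sc_grid_set a w ->
    altsum (fun k => u (omit2 k a) (face2 k w)) = 0) ->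
  exists v : sc_IW C -> W -> A,
  (forall a, {within @sc_W Q C a, continuous (v a)}) /\
  forall a w, sc_grid a -> sc_grid_set a w ->
    u a w = altsum (fun k : 'I_2 => altsum (fun l : 'I_2 =>
      let ij := (lift k ord0, lift l ord0) in v (a ij) (entry w ij))).
Proof.
move=> cu d1u d2u.
pose b1 x := @Y1_index 0 (fun=> x) ord0; pose b2 x := @Y2_index 0 (fun=> x) ord0.
pose y1 x := @Y1_sec 0 (fun=> x); pose y2 x := @Y2_sec 0 (fun=> x).
have b1E x : r1 (b1 x) = x.
  by have [/(congr1 (@^~ ord0)) h _ _] := @Y1_secP 0 (fun=> x).
have b2E x : r2 (b2 x) = x.
  by have [/(congr1 (@^~ ord0)) h _ _] := @Y2_secP 0 (fun=> x).
have bE x : r1 (b1 x) = r2 (b2 x) by rewrite b1E b2E.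
have y1E x z : sc_X C x z -> pi1 (y1 x z) = z /\ sc_Y1 (b1 x) (y1 x z).
  by move=> xz; have [_ _ h] := @Y1_secP 0 (fun=> x); have [//|h1 h2] := h z; split=> //; exact: h2.
have y2E x z : sc_X C x z -> pi2 (y2 x z) = z /\ sc_Y2 (b2 x) (y2 x z).
  by move=> xz; have [_ _ h] := @Y2_secP 0 (fun=> x); have [//|h1 h2] := h z; split=> //; exact: h2.
have cy1 x : {within sc_X C x, continuous (y1 x)}.
  have [_ c _] := @Y1_secP 0 (fun=> x); apply: within_subset c.
  by move=> z xz k.
have cy2 x : {within sc_X C x, continuous (y2 x)}.
  have [_ c _] := @Y2_secP 0 (fun=> x); apply: within_subset c.
  by move=> z xz k.
have WX a w : sc_W a w -> sc_X C (r1 (q1 a)) (pi1 (p1 w)).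
  by move=> /sc_W_sub[/sc_Y1_sub].
pose idx a := @ext_index 0 (b1 (r1 (q1 a))) (b2 (r1 (q1 a))) (fun=> a).
pose pnt a w := let z := pi1 (p1 w) in
  @ext_point 0 (y1 (r1 (q1 a)) z) (y2 (r1 (q1 a)) z) (fun=> w).
pose v a w := u (idx a) (to_grid w (pnt a w)).
have pntE a w : sc_W a w -> entry (to_grid w (pnt a w)) = pnt a w.
  move=> aw; apply: entry_to_grid; have [e1 _] := y1E _ _ (WX _ _ aw).
  have [e2 _] := y2E _ _ (WX _ _ aw); apply: ext_point_grid; rewrite ?e1 ?e2 //; exact: const_is_grid.
exists v; split.
  move=> a; have ga : sc_grid (idx a) by apply: ext_index_grid; rewrite ?b1E.
  apply: within_comp (cu _ ga).
    move=> w aw ij; rewrite pntE //; have [e1 h1] := y1E _ _ (WX _ _ aw).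
    have [e2 h2] := y2E _ _ (WX _ _ aw).
    by apply: ext_point_set; rewrite ?b1E ?b2E // e1 // e2.
  have cpi : {within sc_W a, continuous (fun w => pi1 (p1 w))}.
    apply: within_comp_continuous sq_pi1_continuous _.
    exact: within_continuous sq_p1_continuous.
  have cyy1 : {within sc_W a, continuous (fun w => y1 (r1 (q1 a)) (pi1 (p1 w)))}.
    exact: within_comp (WX a) cpi (cy1 _).
  have cyy2 : {within sc_W a, continuous (fun w => y2 (r1 (q1 a)) (pi1 (p1 w)))}.
    exact: within_comp (WX a) cpi (cy2 _).
  apply: within_val.
  apply: (@within_eq _ _ _ (fun w => pnt a w : {ptws ('I_2 * 'I_2)%type -> W})).
    by move=> w aw; rewrite -[RHS]/(entry _) pntE.
  apply: within_ptws => -[i j]; rewrite /pnt /ext_point /ext2 /=.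
  case: (unlift ord0 i) => [_|]; case: (unlift ord0 j) => [_|].
  - exact: within_id.
  - have [||//|w aw|c _] := @W_idx_continuous a (q1 a) (b2 (r1 (q1 a))) W (sc_W a) id p1
      (fun w => y2 (r1 (q1 a)) (pi1 (p1 w))); last exact: c.
    + by rewrite b2E.
    + exact: within_continuous sq_p1_continuous.
    + have [e2 h2] := y2E _ _ (WX _ _ aw).
      by rewrite e2; split=> //; case: (sc_W_sub aw).
  - have [|//||w aw|c _] := @W_idx_continuous a (b1 (r1 (q1 a))) (q2 a) W (sc_W a) id
      (fun w => y1 (r1 (q1 a)) (pi1 (p1 w))) p2; last exact: c.
    + by rewrite b1E sc_comm.
    + exact: within_continuous sq_p2_continuous.
    + have [e1 h1] := y1E _ _ (WX _ _ aw).
      by split=> //; [rewrite e1 sq_comm|case: (sc_W_sub aw)].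
  - have [//|//|//|w aw|c _] := @W_idx_continuous a (b1 (r1 (q1 a))) (b2 (r1 (q1 a))) W
      (sc_W a) id (fun w => y1 (r1 (q1 a)) (pi1 (p1 w))) (fun w => y2 (r1 (q1 a)) (pi1 (p1 w)));
      last exact: c.
    have [e1 h1] := y1E _ _ (WX _ _ aw).
    by have [e2 h2] := y2E _ _ (WX _ _ aw); rewrite e1 e2.
move=> a w ga aw; have gw := entryP w.
pose o : 'I_2 * 'I_2 := (ord0, ord0).
pose x := r1 (q1 (a o)); pose z := pi1 (p1 (entry w o)).
have xz : sc_X C x z by apply: WX; exact: aw.
have [e1 h1] := y1E x z xz; have [e2 h2] := y2E x z xz.
pose a3 := ext_index (b1 x) (b2 x) a.
pose m3 := ext_point (y1 x z) (y2 x z) (entry w).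
have g3 : sc_grid a3 by apply: ext_index_grid => //; rewrite b1E.
have gm3 : is_grid p1 p2 m3 by apply: ext_point_grid; rewrite // e1 // e2.
pose w3 := to_grid (entry w o) m3.
have w3E : entry w3 = m3 by exact: entry_to_grid.
have s3 : sc_grid_set a3 w3.
  by move=> ij; rewrite w3E; apply: ext_point_set; rewrite ?b1E // e1 // e2.
(* The values of [u] on the nine 2 x 2 grids inside the bordered 3 x 3 grid; [H1] and [H2] are the
   relations along its columns and rows. *)
pose U k l := u (omit1 k (omit2 l a3)) (face1 k (face2 l w3)).
have H1 l : altsum (U^~ l) = 0.
  by apply: d1u; [split=> *; [exact: g3.1|exact: g3.2]|move=> ij; exact: s3].
have H2 k : altsum (U k) = 0.
  rewrite -(d2u (omit1 k a3) (face1 k w3)).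
  - by apply: eq_altsum => l; congr u; exact: grid_inj.
  - by split=> *; [exact: g3.1|exact: g3.2].
  - by move=> ij; exact: s3.
have U00 : U ord0 ord0 = u a w.
  rewrite /U /a3 /ext_index ext2_omit0; congr u; apply: grid_inj.
  rewrite -[LHS]/(omit1 ord0 (omit2 ord0 (entry w3))) w3E; exact: ext2_omit0.
have cstE (T : Type) (f : 'I_2 * 'I_2 -> T) k l :
    omit1 k (omit2 l f) = fun=> f (lift k ord0, lift l ord0).
  by apply/funext => -[i j]; rewrite /omit1 /omit2 /= (ord1 i) (ord1 j).
have Ukl (k l : 'I_2) : U (lift ord0 k) (lift ord0 l) =
    v (a (lift k ord0, lift l ord0)) (entry w (lift k ord0, lift l ord0)).
  rewrite /U /a3 ext_index_omit ?b1E // cstE /v /idx (sc_grid_r _ ga); congr u.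
  apply: grid_inj; rewrite pntE; last exact: aw.
  rewrite -[LHS]/(omit1 (lift ord0 k) (omit2 (lift ord0 l) (entry w3))) w3E.
  rewrite /m3 ext_point_omit ?e1 ?e2 // cstE /pnt (sc_grid_r _ ga).
  by rewrite (is_grid_pi _ gw).
(* The relation in column 0 expresses [U ord0 ord0] through the two other values in that column, and
   the row relations express those through the four grids that keep the adjoined row and column. On
   these, [u] is [v] of the single remaining point. *)
rewrite -U00; move: (H1 ord0); rewrite altsum_recl => /eqP; rewrite subr_eq0 => /eqP ->.
apply: eq_altsum => k; move: (H2 (lift ord0 k)).
rewrite altsum_recl => /eqP; rewrite subr_eq0 => /eqP ->.
by apply: eq_altsum => l; exact: Ukl.
Qed.

End SquareCoverExactness.

(** * Uniqueness of the class on a fixed square cover *)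

Section RepresentsClassUnique.
Variables (R : realType) (Q : square) (L : line_data R (grid Q 2 2)).
Variables (s1 : grid Q 3 2 -> ('I_3 -> L) -> Cstar R)
          (s2 : grid Q 2 3 -> ('I_3 -> L) -> Cstar R).
Hypothesis Qsplit : locally_split_square Q.
Hypothesis pair_inj : forall w w' : sq_W Q,
  sq_p1 w = sq_p1 w' -> sq_p2 w = sq_p2 w' -> w = w'.
Hypothesis Lb : is_line_bundle L.
Hypothesis s1T : trivializing_section (fun k : 'I_3 => face1 k) s1.
Hypothesis s2T : trivializing_section (fun k : 'I_3 => face2 k) s2.
Variable C : square_cover Q.

Let comparison_identity (M : zmodType) (d d' v v' : M) :
  - d' + v' = v - d -> d' - d - (v' - v) = 0.
Proof.
move=> /(congr1 (+%R d')); rewrite addrA subrr add0r => ->.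
apply/eqP; rewrite subr_eq0 subr_eq; apply/eqP.
by rewrite addrA [_ - d - v]addrAC addrK subrK.
Qed.

Let difference_identity (M : zmodType) (x x' y y' g h : M) :
  x' - y' - (x - y) = g - h -> y' - y - h = x' - x - g.
Proof.
rewrite opprB [y - x]addrC addrACA [- y' + y]addrC -[y - y']opprB => /eqP; rewrite subr_eq => /eqP ->.
by rewrite [_ - g]addrAC [g - h - g]addrAC subrr sub0r addrC.
Qed.

Let dd (F : ('I_2 * 'I_2) -> Cstar R) : Cstar R :=
  altsum (fun k : 'I_2 => altsum (fun l : 'I_2 => F (lift k ord0, lift l ord0))).

Let ddB F G : dd (fun ij => F ij - G ij) = dd F - dd G.
Proof. by rewrite /dd -altsumB; apply: eq_altsum => k; rewrite altsumB. Qed.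

Lemma represents_class_unique alpha alpha' :
  represents_class s1 s2 (C := C) alpha -> represents_class s1 s2 (C := C) alpha' ->
  cohomologous (Cech alpha) (Cech alpha').
Proof.
move=> [ca [t [ga [be1 [be2 [[ct ft t1 t2] [cga cb1 cb2] cL dga [db1 db2]]]]]]].
move=> [ca' [t' [ga' [be1' [be2' [[ct' ft' t1' t2'] [cga' cb1' cb2'] cL' dga' [db1' db2']]]]]]].
pose u a w := frame_ratio (t' a w) (t a w).
have uE a w : sc_grid a -> sc_grid_set a w -> t a w = cs_scale (u a w) (t' a w).
  by move=> g h; rewrite (frame_ratioP Lb (ft' _ _ g h) (ft _ _ g h)).
have om1 (a : 'I_3 * 'I_2 -> sc_IW C) k : sc_grid a -> sc_grid (omit1 k a).
  by move=> [g1 g2]; split=> *; [exact: g1|exact: g2].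
have om2 (a : 'I_2 * 'I_3 -> sc_IW C) k : sc_grid a -> sc_grid (omit2 k a).
  by move=> [g1 g2]; split=> *; [exact: g1|exact: g2].
have [v [cv vE]] : exists v : sc_IW C -> sq_W Q -> Cstar R,
    (forall a, {within @sc_W Q C a, continuous (v a)}) /\
    forall a w, sc_grid a -> sc_grid_set a w -> u a w = dd (fun ij => v (a ij) (entry w ij)).
  apply: (d1d2_lift Qsplit pair_inj).
  - move=> a g; apply: (within_frame_ratio Lb) (ct' _ g) (ct _ g) => w h.
      exact: ft'.
    exact: ft.
  - move=> a w g h; have hk k : sc_grid_set (omit1 k a) (face1 k w) by move=> ij; exact: h.
    (* The coordinates of [s1] in the frames built from [t] and from [t'] are both 0; by homogeneity
       they differ by the alternating sum of [u], which therefore vanishes. *)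
    have := t1 a w g h; rewrite (_ : (fun k => t (omit1 k a) (face1 k w)) =
      fun k => cs_scale (u (omit1 k a) (face1 k w)) (t' (omit1 k a) (face1 k w))); last first.
      by apply/funext => k; rewrite -uE //; exact: om1.
    rewrite s1T.1 => [|k]; last by apply: ft' => //; exact: om1.
    by rewrite t1' // sub0r => /eqP; rewrite oppr_eq0 => /eqP.
  - move=> a w g h; have hk k : sc_grid_set (omit2 k a) (face2 k w) by move=> ij; exact: h.
    have := t2 a w g h; rewrite (_ : (fun k => t (omit2 k a) (face2 k w)) =
      fun k => cs_scale (u (omit2 k a) (face2 k w)) (t' (omit2 k a) (face2 k w))); last first.
      by apply/funext => k; rewrite -uE //; exact: om2.
    rewrite s2T.1 => [|k]; last by apply: ft' => //; exact: om2.
    by rewrite t2' // sub0r => /eqP; rewrite oppr_eq0 => /eqP.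
pose v0 : cochain (sq_W Q) (Cstar R) (sc_IW C) 0 := fun a w => v (a ord0) w.
have cv0 : is_cochain (@sc_W Q C) v0.
  by move=> a; apply: within_subset (cv (a ord0)) => w; exact.
have dv0 a w : cdiff v0 a w = v (a ord_max) w - v (a ord0) w.
  by rewrite /cdiff altsum2 /v0 /=; congr (v (a _) w - v (a _) w); exact: val_inj.
(* The change of local sections alters gamma by the coboundary of [v0]; after this correction the
   difference is killed by d_1 d_2. *)
pose Ga : cochain (sq_W Q) (Cstar R) (sc_IW C) 1 :=
  fun a w => ga' a w - ga a w - cdiff v0 a w.
have [||g1 [g2 [cg1 cg2 gE]]] := @d1d2_exact Q C (Cstar R) Qsplit pair_inj 1 Ga.
- move=> a; apply: withinB; last exact: is_cochain_cdiff.
  by apply: withinB.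
- move=> a w g h; rewrite -[LHS]/(dd (fun ij => Ga (fun m => a m ij) (entry w ij))).
  rewrite /Ga !ddB.
  have fr k := ft _ _ (g k) (h k); have fr' k := ft' _ _ (g k) (h k).
  (* Both sides are the ratio from [t' (a ord0)] to [t (a ord_max)], computed once through
     [t' (a ord_max)] and once through [t (a ord0)]. *)
  have H : - d1d2 ga' a w + u (a ord_max) w = u (a ord0) w - d1d2 ga a w.
    rewrite -cL // -cL' // -(frame_ratioD Lb (fr' ord0) (fr' ord_max) (fr ord_max)).
    by rewrite (frame_ratioD Lb (fr' ord0) (fr ord0) (fr ord_max)).
  rewrite (_ : dd (fun ij => cdiff v0 _ _) =
    dd (fun ij => v (a ord_max ij) (entry w ij)) - dd (fun ij => v (a ord0 ij) (entry w ij))).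
    by apply: comparison_identity; rewrite -!vE.
  by rewrite -ddB; congr dd; apply/funext => ij; exact: dv0.
(* Corrected by the coboundaries of [g1] and [g2], the differences of the betas agree on W, so they
   descend to a cochain [e] on X. *)
pose F1 : cochain (sq_Y1 Q) (Cstar R) (sc_I1 C) 2 := fun b y => be1' b y - be1 b y - cdiff g1 b y.
pose F2 : cochain (sq_Y2 Q) (Cstar R) (sc_I2 C) 2 := fun b y => be2' b y - be2 b y - cdiff g2 b y.
have cF1 : is_cochain (@sc_Y1 Q C) F1.
  move=> b; apply: withinB; last exact: is_cochain_cdiff.
  by apply: withinB.
have [|e [ce eE _]] := descend Qsplit pair_inj cF1 (F2 := F2).
  move=> a w Wa.
  have : cdiff Ga a w = cdiff g2 (@sc_q2 Q C \o a) (sq_p2 w) - cdiff g1 (@sc_q1 Q C \o a) (sq_p1 w).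
    rewrite /cdiff -altsumB; apply: eq_altsum => k; apply: gE.
    exact: inter_comp Wa.
  have -> : cdiff Ga a w = cdiff ga' a w - cdiff ga a w.
    rewrite {1}/cdiff /Ga !altsumB -/(cdiff ga a w) -/(cdiff ga' a w).
    by rewrite -[X in _ - X]/(cdiff (cdiff v0) a w) cdiff_cdiff subr0.
  rewrite dga // dga' // /F1 /F2 => H.
  by apply: difference_identity; rewrite -H.
apply: (cohomologous_cdiff ca ca' ce) => i x ix.
(* The coboundary of [e] is evaluated along a local section of Y1, where it is that of [F1], namely
   [alpha' - alpha]. *)
have [h1 _ h3] := Y1_secP i; have [zE Yb] := h3 _ ix.
have : cdiff F1 (Y1_index i) (Y1_sec i x) = cdiff e i x.
  rewrite /cdiff; apply: eq_altsum => k; rewrite eE; last exact: inter_comp Yb.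
  by rewrite zE -[in RHS]h1.
rewrite {1}/cdiff /F1 !altsumB -[X in _ - X]/(cdiff (cdiff g1) _ _) cdiff_cdiff subr0.
rewrite -[X in X - _]/(cdiff be1' _ _) -[X in _ - X]/(cdiff be1 _ _) db1 // db1' //.
by rewrite zE h1 => <-; rewrite addrC subrK.
Qed.

End RepresentsClassUnique.

(** * The canonical representative on a fine square cover *)

Section ChernData.
Variables (R : realType) (X : topologicalType) (Y : circle_bundle R X).

(** The Chern cocycle obtained from real instead of complex logarithms, so that cup products with it
    can be formed among real cochains. *)
Definition chern_data (U : open_cover X) (sigma : oc_idx U -> X -> Y)
    (a : cochain X R (oc_idx U) 1) (n : cochain X zdisc (oc_idx U) 2) : Prop :=
  [/\ (forall i, {within U i, continuous sigma i}) /\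
      (forall i x, U i x -> cb_proj (sigma i x) = x),
      is_cochain U a,
      (forall i x, inter U i x ->
         difference (sigma (i ord0) x) (sigma (i ord_max) x) = u1_cis (a i x)),
      is_cocycle U n &
      (forall i x, inter U i x -> cdiff a i x = (n i x : int)%:~R)].

Lemma Re_altsum n (f : 'I_n -> R[i]) :
  complex.Re (altsum f) = altsum (fun k => complex.Re (f k)).
Proof.
elim: n f => [|n IH] f; first by rewrite !altsum0.
by rewrite !altsum_recl -IH; case: (f ord0) => ? ?; case: (altsum _).
Qed.

Lemma real_complex_altsum n (f : 'I_n -> R) :
  (altsum f)%:C = altsum (fun k => (f k)%:C) :> R[i].
Proof.
elim: n f => [|n IH] f; first by rewrite !altsum0.
by rewrite !altsum_recl -IH rmorphB.
Qed.

Lemma chern_class_data (alpha : cech_class X zdisc 2) : chern_class Y alpha ->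
  exists (U : open_cover X) (sigma : oc_idx U -> X -> Y) (a : cochain X R (oc_idx U) 1)
    (n : cochain X zdisc (oc_idx U) 2), chern_data sigma a n /\ alpha = class_of (Cech n).
Proof.
move=> [U [sigma [n [hs cn -> [a [ca ga da]]]]]].
(* Real parts suffice: transition functions have modulus 1, and taking real parts commutes with
   coboundaries. *)
exists U, sigma, (fun i x => complex.Re (a i x)), n; split=> //; split=> //.
- move=> i; exact: within_comp_continuous (@Re_continuous R) (ca i).
- by move=> i x ix; apply: u1_cs_cexp; exact: ga.
- move=> i x ix; rewrite -[LHS]Re_altsum -[altsum _]/(cdiff a i x) da //.
  by rewrite -(rmorph_int (real_complex R)).
Qed.

Lemma chern_data_refine (U V : open_cover X) (f : oc_idx V -> oc_idx U) sigma a n :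
  (forall j, V j `<=` U (f j)) -> chern_data (U := U) sigma a n ->
  chern_data (U := V) (sigma \o f) (fun i => a (f \o i)) (fun i => n (f \o i)).
Proof.
move=> VU [[cs ps] ca ga cn da]; split.
- split=> [i|i x Vx]; first exact: within_subset (VU i) (cs (f i)).
  by apply: ps; exact: VU.
- exact: is_cochain_refine ca.
- by move=> i x ix; exact: (ga (f \o i) x (inter_refine VU ix)).
- exact: is_cocycle_refine cn.
- by move=> i x ix; exact: (da (f \o i) x (inter_refine VU ix)).
Qed.

(* l b y is a logarithm of the coordinate of y in the frame sigma (r b). *)
Definition log_system (U : open_cover X) (sigma : oc_idx U -> X -> Y) (I : Type)
    (V : I -> set Y) (r : I -> oc_idx U) (l : I -> Y -> R) : Prop :=
  [/\ (forall b y, V b y -> U (r b) (cb_proj y)),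
      (forall b, {within V b, continuous (l b)}) &
      (forall b y, V b y -> cb_act (u1_cis (l b y)) (sigma (r b) (cb_proj y)) = y)].

Section Winding.
Variables (U : open_cover X) (sigma : oc_idx U -> X -> Y)
  (a : cochain X R (oc_idx U) 1) (n : cochain X zdisc (oc_idx U) 2).
Hypothesis data : chern_data sigma a n.
Variables (I : Type) (V : I -> set Y) (r : I -> oc_idx U) (l : I -> Y -> R).
Hypothesis logs : log_system sigma V r l.

Definition log_cochain : cochain Y R I 0 := fun b y => l (b ord0) y.

Definition winding : cochain Y R I 1 :=
  fun b y => cdiff log_cochain b y + a (r \o b) (cb_proj y).

Lemma cdiff_log b y : cdiff log_cochain b y = l (b ord_max) y - l (b ord0) y.
Proof.
rewrite /cdiff altsum2 /log_cochain /=.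
by congr (l (b _) y - l (b _) y); exact: val_inj.
Qed.

Lemma inter_logs p (b : 'I_p -> I) y : inter V b y -> inter U (r \o b) (cb_proj y).
Proof. by case: logs => h _ _ Vb k; exact: h. Qed.

Lemma within_proj (q : nat) (c : cochain X R (oc_idx U) q) (b : 'I_q.+1 -> I) : is_cochain U c ->
  {within inter V b, continuous (fun y => c (r \o b) (cb_proj y))}.
Proof.
move=> cc; apply: within_comp (cc (r \o b)); first exact: inter_logs.
by apply: within_continuous; exact: cb_proj_continuous.
Qed.

Lemma log_cochain_cochain : is_cochain V log_cochain.
Proof.
by case: logs => _ cl _ b; apply: within_subset (cl (b ord0)) => y; exact.
Qed.

Lemma winding_cochain : is_cochain V winding.
Proof.
case: data => _ ca _ _ _ b; apply: withinD; last exact: within_proj.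
by apply: is_cochain_cdiff; exact: log_cochain_cochain.
Qed.

Lemma winding_int b y : inter V b y -> winding b y \is a Num.int.
Proof.
case: logs => [Vr _ lE]; case: data => [[_ ps] _ ga _ _] Vb.
have ix := inter_logs Vb.
set y0 := sigma (r (b ord0)) (cb_proj y); set y1 := sigma (r (b ord_max)) (cb_proj y).
have e : cb_proj y0 = cb_proj y1 by rewrite !ps //; exact: ix.
have := difference_spec e; rewrite (ga (r \o b)) //= => d.
(* Both elements carry [y0] to [y]: one directly, the other through the second section value
   [y1]. *)
have /u1_cis_inj[m mE] : u1_cis (l (b ord_max) y + a (r \o b) (cb_proj y)) = u1_cis (l (b ord0) y).
  apply: (@cb_act_inj _ _ _ _ _ y0); rewrite u1_cisD cb_actM d !lE //; exact: Vb.
apply/intrP; exists m; rewrite /winding cdiff_log addrAC mE.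
by rewrite addrC addrA addNr add0r.
Qed.

Lemma cdiff_winding b y : cdiff winding b y = cdiff a (r \o b) (cb_proj y).
Proof.
rewrite {1}/cdiff altsumD -[X in X + _]/(cdiff (cdiff log_cochain) b y).
by rewrite cdiff_cdiff add0r.
Qed.

Lemma cdiff_log_winding b y :
  cdiff log_cochain b y = winding b y - a (r \o b) (cb_proj y).
Proof. by rewrite /winding addrK. Qed.

Lemma cdiff_a_int i x : inter U i x -> cdiff a i x \is a Num.int.
Proof. by case: data => _ _ _ _ h ix; rewrite h //; exact: intr_int. Qed.

Lemma difference_log b b' y y' : V b y -> V b' y' -> r b = r b' ->
  cb_proj y = cb_proj y' -> difference y y' = u1_cis (l b' y' - l b y).
Proof.
case: logs => [_ _ lE] Vy Vy' er ey; have := lE _ _ Vy; have := lE _ _ Vy'.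
rewrite -ey -er; move: (sigma _ _) (l b y) (l b' y') => s u u' <- <-.
by rewrite -{1}(subrK u u') [u1_cis (_ + u)]u1_cisD cb_actM difference_act.
Qed.

End Winding.

End ChernData.

Section RealCup.
Variables (R : realType) (I : Type).

Definition rcup p q (F : ('I_p.+1 -> I) -> R) (G : ('I_q.+1 -> I) -> R)
    (i : 'I_(p + q).+1 -> I) : R :=
  F (fun k => i (inord k)) * G (fun k => i (inord (p + k))).

Lemma altsum_rcup p q (F : ('I_p.+1 -> I) -> R) (G : ('I_q.+1 -> I) -> R)
    (i : 'I_(p + q).+2 -> I) :
  altsum (fun k : 'I_(p + q).+2 => rcup F G (i \o lift k)) =
  altsum (fun k : 'I_p.+2 => F ((fun a : 'I_p.+2 => i (inord a)) \o lift k)) *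
    G (fun b => i (inord (p.+1 + b))) +
  (F (fun a => i (inord a)) *
   altsum (fun k : 'I_q.+2 => G ((fun b : 'I_q.+2 => i (inord (p + b))) \o lift k)))
  *~ (-1) ^+ p.
Proof. exact: (altsum_cup F G i). Qed.

End RealCup.

Lemma ccis_Rint (R : realType) (r : R) : r \is a Num.int -> ccis r = 0.
Proof. by move=> /intrP[n ->]; exact: ccis_int. Qed.

Section CupRepresentative.
Variables (R : realType) (X : topologicalType) (U : open_cover X)
  (a1 a2 : cochain X R (oc_idx U) 1).

(** [cdiff a2] stands for n_2, with which it agrees on the cover, so that the product is taken in
    [R] before exponentiating. *)
Definition cup_rep : cochain X (Cstar R) (oc_idx U) 3 :=
  fun i x => ccis (rcup (p := 1) (q := 2) (a1^~ x) (fun j => cdiff a2 j x) i).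

Variables (Y1 Y2 : circle_bundle R X) (sigma1 : oc_idx U -> X -> Y1)
  (sigma2 : oc_idx U -> X -> Y2) (n1 n2 : cochain X zdisc (oc_idx U) 2).
Hypothesis data1 : chern_data sigma1 a1 n1.
Hypothesis data2 : chern_data sigma2 a2 n2.

(** The coboundary of a_1 cup (delta a_2) is (delta a_1) cup (delta a_2), which is integral and
    disappears under [ccis]. *)
Lemma cup_rep_cocycle : is_cocycle U (cup_rep).
Proof.
have [_ ca1 _ _ _] := data1; have [_ ca2 _ _ _] := data2.
split=> [i|i x ix].
  apply: within_ccis; apply: (@withinM _ _ R).
    by apply: within_subset (ca1 _) => x ix k; exact: ix.
  have cda2 : is_cochain U (cdiff a2) by exact: is_cochain_cdiff.
  by apply: within_subset (cda2 _) => x ix k; exact: ix.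
rewrite /cdiff /cup_rep -ccis_altsum (@altsum_rcup _ _ 1 2) -[altsum (fun k => a1 _ x)]/(cdiff a1 _ x).
rewrite -[altsum (fun k => cdiff a2 _ x)]/(cdiff (cdiff a2) _ x) cdiff_cdiff mulr0 mul0rz addr0.
apply/ccis_Rint/rpredM; [apply: (cdiff_a_int data1)|apply: (cdiff_a_int data2)];
  by move=> k; exact: ix.
Qed.

(** The real cochain a_1 cup (delta a_2) is itself a logarithm of the cocycle, and its coboundary is
    n_1 cup n_2 exactly. *)
Lemma cup_rep_bockstein : bockstein_cochain cup_rep (cup_cochain n1 n2).
Proof.
have [_ ca1 _ _ da1] := data1; have [_ ca2 _ _ da2] := data2.
exists (fun i x => (rcup (p := 1) (q := 2) (a1^~ x) (fun j => cdiff a2 j x) i)%:C); split.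
- move=> i; apply: within_comp_continuous (@real_complex_continuous R) _.
  apply: (@withinM _ _ R).
    by apply: within_subset (ca1 _) => x ix k; exact: ix.
  have cda2 : is_cochain U (cdiff a2) by exact: is_cochain_cdiff.
  by apply: within_subset (cda2 _) => x ix k; exact: ix.
- by move=> i x ix; rewrite cexp_real.
- move=> i x ix; rewrite /cdiff -real_complex_altsum (@altsum_rcup _ _ 1 2).
  rewrite -[altsum (fun k => a1 _ x)]/(cdiff a1 _ x).
  rewrite -[altsum (fun k => cdiff a2 _ x)]/(cdiff (cdiff a2) _ x) cdiff_cdiff mulr0 mul0rz addr0.
  rewrite da1 => [|k]; last exact: ix.
  rewrite -[X in _ * X]/(cdiff a2 (fun b => i (inord (2 + b))) x).
  rewrite da2 => [|k]; last exact: ix.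
  by rewrite -intrM rmorph_int.
Qed.

End CupRepresentative.

(** * Local sections, gamma and the betas built from logarithms *)

Section CupRepresents.
Variables (R : realType) (X : topologicalType) (Y1 Y2 : circle_bundle R X).
Local Notation Q := (bundle_square Y1 Y2).
Variables (C : square_cover Q).
Local Notation U := (sc_X C).
Variables (sigma1 : oc_idx U -> X -> Y1) (sigma2 : oc_idx U -> X -> Y2)
  (a1 a2 : cochain X R (oc_idx U) 1) (n1 n2 : cochain X zdisc (oc_idx U) 2).
Hypothesis data1 : chern_data sigma1 a1 n1.
Hypothesis data2 : chern_data sigma2 a2 n2.
Variables (l1 : sc_I1 C -> Y1 -> R) (l2 : sc_I2 C -> Y2 -> R).
Hypothesis logs1 : log_system sigma1 (@sc_Y1 Q C) (@sc_r1 Q C) l1.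
Hypothesis logs2 : log_system sigma2 (@sc_Y2 Q C) (@sc_r2 Q C) l2.
Local Notation q1 := (@sc_q1 Q C).
Local Notation q2 := (@sc_q2 Q C).
Local Notation r1 := (@sc_r1 Q C).
Local Notation r2 := (@sc_r2 Q C).
Local Notation p1 := (@sq_p1 Q).
Local Notation p2 := (@sq_p2 Q).
Local Notation N1 := (winding a1 r1 l1).
Local Notation N2 := (winding a2 r2 l2).

(** The logarithm of Y_1 is taken at the first index because the exponent of the transition from
    chart a_0 to chart a_1 is the row shift in chart a_0 times the change of the column winding. *)
Definition cup_gamma : cochain (sq_W Q) (Cstar R) (sc_IW C) 1 := fun a w =>
  ccis (rcup (p := 0) (q := 1) (fun i => log_cochain l1 (q1 \o i) (p1 w))
    (fun j => N2 (q2 \o j) (p2 w)) a).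

Definition cup_beta1 : cochain (sq_Y1 Q) (Cstar R) (sc_I1 C) 2 := fun b y =>
  - ccis (rcup (p := 0) (q := 2) (fun i => log_cochain l1 i y)
    (fun j => cdiff a2 (r1 \o j) (cb_proj y)) b).

Definition cup_beta2 : cochain (sq_Y2 Q) (Cstar R) (sc_I2 C) 2 := fun c y =>
  - ccis (rcup (p := 1) (q := 1) (fun i => a1 (r2 \o i) (cb_proj y))
    (fun j => N2 j y) c).

Let cl1 : is_cochain (@sc_Y1 Q C) (log_cochain l1).
Proof. exact: log_cochain_cochain logs1. Qed.

Let cN2 : is_cochain (@sc_Y2 Q C) N2.
Proof. by move=> i; exact: (winding_cochain data2 logs2). Qed.

Lemma cup_gamma_cochain : is_cochain (@sc_W Q C) cup_gamma.
Proof.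
move=> a.
have c1 : {within inter (@sc_W Q C) a, continuous
    (fun w => log_cochain l1 (fun k => q1 (a (inord k))) (p1 w))}.
  apply: within_comp (@cl1 (fun k => q1 (a (inord k)))).
    by move=> w aw k; case: (sc_W_sub (aw (inord k))).
  by apply: within_fst; apply: within_continuous; exact: set_val_continuous.
have c2 : {within inter (@sc_W Q C) a, continuous
    (fun w => N2 (fun k => q2 (a (inord (0 + k)))) (p2 w))}.
  apply: within_comp (@cN2 (fun k => q2 (a (inord (0 + k))))).
    by move=> w aw k; case: (sc_W_sub (aw (inord (0 + k)))).
  by apply: within_snd; apply: within_continuous; exact: set_val_continuous.
by apply: within_ccis; exact: (@withinM _ _ R _ _ c1 c2).
Qed.

Lemma cup_beta1_cochain : is_cochain (@sc_Y1 Q C) cup_beta1.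
Proof.
move=> b; apply: withinN; apply: within_ccis; apply: (@withinM _ _ R).
  by apply: within_subset (@cl1 _) => y yb k; exact: yb.
have [_ ca2 _ _ _] := data2.
have cda2 : is_cochain U (cdiff a2) by exact: is_cochain_cdiff.
apply: within_subset (@within_proj _ _ _ _ _ _ _ _ _ logs1 _ _ _ cda2) => y yb k; exact: yb.
Qed.

Lemma cup_beta2_cochain : is_cochain (@sc_Y2 Q C) cup_beta2.
Proof.
have [_ ca1 _ _ _] := data1.
move=> b; apply: withinN; apply: within_ccis; apply: (@withinM _ _ R).
  by apply: within_subset (@within_proj _ _ _ _ _ _ _ _ _ logs2 _ _ _ ca1) => y yb k; exact: yb.
by apply: within_subset (@cN2 _) => y yb k; exact: yb.
Qed.

(** By Leibniz, delta (l_1 cup N_2) = (N_1 - a_1) cup N_2 + l_1 cup (delta a_2), and N_1 cup N_2 is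
    integral. What remains is beta_2 - beta_1. *)
Lemma cdiff_cup_gamma a w : inter (@sc_W Q C) a w ->
  cdiff cup_gamma a w = cup_beta2 (q2 \o a) (p2 w) - cup_beta1 (q1 \o a) (p1 w).
Proof.
move=> aw; rewrite /cdiff /cup_gamma -ccis_altsum (@altsum_rcup _ _ 0 1) expr0 mulr1z.
rewrite -[altsum (fun k => log_cochain _ _ _)]/(cdiff (log_cochain l1)
  (q1 \o (fun a0 : 'I_2 => a (inord a0))) (p1 w)).
rewrite -[altsum (fun k => N2 _ _)]/(cdiff N2 (q2 \o (fun b : 'I_3 => a (inord (0 + b)))) (p2 w)).
rewrite (cdiff_log_winding a1 r1) cdiff_winding mulrBl ccisD ccisB.
rewrite (ccis_Rint (r := N1 _ _ * _)); last first.
  apply: rpredM; [apply: (winding_int data1 logs1)|apply: (winding_int data2 logs2)].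
    by move=> k; case: (sc_W_sub (aw (inord k))).
  by move=> k; case: (sc_W_sub (aw (inord (1 + k)))).
rewrite sub0r /cup_beta1 /cup_beta2 opprK; congr (- ccis (_ * _) + ccis (_ * _)).
- rewrite -[cb_proj (p2 w)](sq_comm w); congr (a1 _ _).
  by apply/funext => k; exact: sc_comm.
- rewrite -[cb_proj (p2 w)](sq_comm w); congr (cdiff a2 _ _).
  by apply/funext => k; rewrite /= sc_comm.
Qed.

(** - delta (l_1 cup delta a_2) = - (N_1 - a_1) cup (delta a_2), and the product with N_1 is
    integral. *)
Lemma cdiff_cup_beta1 b y : inter (@sc_Y1 Q C) b y ->
  cdiff cup_beta1 b y = cup_rep a1 a2 (r1 \o b) (cb_proj y).
Proof.
move=> yb; rewrite /cdiff /cup_beta1 altsumN -ccis_altsum (@altsum_rcup _ _ 0 2).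
rewrite -[altsum (fun k => log_cochain _ _ _)]/(cdiff (log_cochain l1)
  (fun a0 : 'I_2 => b (inord a0)) y).
rewrite -[altsum (fun k => cdiff a2 _ _)]/(cdiff (cdiff a2)
  (r1 \o (fun b0 : 'I_4 => b (inord (0 + b0)))) (cb_proj y)).
rewrite cdiff_cdiff mulr0 mul0rz addr0 (cdiff_log_winding a1 r1) mulrBl ccisB.
rewrite (ccis_Rint (r := N1 _ _ * _)) ?sub0r ?opprK //.
apply: rpredM; [apply: (winding_int data1 logs1)|apply: (cdiff_a_int data2)].
  by move=> k; exact: yb.
by move=> k; apply: sc_Y1_sub; exact: yb.
Qed.

(** - delta (a_1 cup N_2) = - (delta a_1) cup N_2 + a_1 cup (delta a_2), and the first product is
    integral. *)
Lemma cdiff_cup_beta2 b y : inter (@sc_Y2 Q C) b y ->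
  cdiff cup_beta2 b y = cup_rep a1 a2 (r2 \o b) (cb_proj y).
Proof.
move=> yb; rewrite /cdiff /cup_beta2 altsumN -ccis_altsum (@altsum_rcup _ _ 1 1) expr1.
rewrite -[altsum (fun k => a1 _ _)]/(cdiff a1
  (r2 \o (fun b0 : 'I_3 => b (inord b0))) (cb_proj y)).
rewrite -[altsum (fun k => N2 _ _)]/(cdiff N2 (fun b0 : 'I_3 => b (inord (1 + b0))) y).
rewrite cdiff_winding mulrNz mulr1z ccisB.
rewrite (ccis_Rint (r := cdiff a1 _ _ * _)) ?sub0r ?opprK //.
apply: rpredM; [apply: (cdiff_a_int data1)|apply: (winding_int data2 logs2)].
  by move=> k; apply: sc_Y2_sub; exact: yb.
by move=> k; exact: yb.
Qed.

Definition u1_log (u : U1 R) : R := xget 0 [set x | u1_cis x = u].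

Lemma u1_logK u : u1_cis (u1_log u) = u.
Proof.
have [x xu] := u1_cis_surj u; rewrite /u1_log; case: xgetP => [y _ //|/(_ x)].
by case.
Qed.

(** Supplies a default vector for [cup_section] off the cover, where the shifts need not be lifts of
    [chi12 w]. *)
Lemma cup_default_subproof (w : grid Q 2 2) : chi12 w =
  lb_proj (Sclass (u1_log (chi12 w).1, u1_log (chi12 w).2, 1) : Sbundle R).
Proof. by rewrite [RHS]Sproj_class; case: (chi12 w) => u v; rewrite /= !u1_logK. Qed.

Definition row_shift (a : 'I_2 * 'I_2 -> sc_IW C) (w : grid Q 2 2) : R :=
  l1 (q1 (a (ord_max, ord0))) (grow w ord_max) - l1 (q1 (a (ord0, ord0))) (grow w ord0).

Definition col_shift (a : 'I_2 * 'I_2 -> sc_IW C) (w : grid Q 2 2) : R :=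
  l2 (q2 (a (ord0, ord_max))) (gcol w ord_max) - l2 (q2 (a (ord0, ord0))) (gcol w ord0).

Definition cup_section (a : 'I_2 * 'I_2 -> sc_IW C) (w : grid Q 2 2) : cup_bundle Y1 Y2 :=
  insubd (exist _ (w, _) (mem_set (cup_default_subproof w)) :
      pull_tot (@chi12 R X Y1 Y2) (Sbundle R))
    (w, Sclass (row_shift a w, col_shift a w, 1) : Sbundle R).

Section OnGrid.
Variables (m n : nat) (a : 'I_m.+1 * 'I_n.+1 -> sc_IW C) (w : grid Q m.+1 n.+1).
Hypothesis ag : sc_grid a.
Hypothesis aw : sc_grid_set a w.

Lemma grow_set i j : sc_Y1 (q1 (a (i, j))) (grow w i).
Proof. by rewrite -(growE w i j); case: (sc_W_sub (aw (i, j))). Qed.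

Lemma gcol_set i j : sc_Y2 (q2 (a (i, j))) (gcol w j).
Proof. by rewrite -(gcolE w i j); case: (sc_W_sub (aw (i, j))). Qed.

Lemma grow_difference i i' : difference (grow w i) (grow w i') =
  u1_cis (l1 (q1 (a (i', ord0))) (grow w i') - l1 (q1 (a (i, ord0))) (grow w i)).
Proof.
apply: (difference_log logs1); [exact: grow_set|exact: grow_set| |].
  by rewrite !(sc_grid_r _ ag).
exact: grow_proj_eq.
Qed.

Lemma gcol_difference j j' : difference (gcol w j) (gcol w j') =
  u1_cis (l2 (q2 (a (ord0, j'))) (gcol w j') - l2 (q2 (a (ord0, j))) (gcol w j)).
Proof.
apply: (difference_log logs2); [exact: gcol_set|exact: gcol_set| |].
  by rewrite -!sc_comm !(sc_grid_r _ ag).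
exact: gcol_proj_eq.
Qed.

End OnGrid.

Lemma chi12_shift a w : sc_grid a -> sc_grid_set a w ->
  chi12 w = (u1_cis (row_shift a w), u1_cis (col_shift a w)).
Proof. by move=> ag aw; rewrite chi12E (grow_difference ag aw) (gcol_difference ag aw). Qed.

Lemma cup_sectionE a w : sc_grid a -> sc_grid_set a w ->
  set_val (cup_section a w : pull_tot (@chi12 R X Y1 Y2) (Sbundle R)) =
  (w, Sclass (row_shift a w, col_shift a w, 1)).
Proof.
move=> ag aw; rewrite [set_val _]val_insubd mem_set //=.
by rewrite (chi12_shift ag aw); exact/esym/Sproj_class.
Qed.

Lemma pull_cup_section a w : sc_grid a -> sc_grid_set a w ->
  pull_vector (cup_section a w) = Sclass (row_shift a w, col_shift a w, csval 0).
Proof. by move=> ag aw; rewrite /pull_vector cup_sectionE. Qed.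

Lemma frame_cup_section a w : sc_grid a -> sc_grid_set a w -> frame w (cup_section a w).
Proof.
move=> ag aw; split; first by rewrite /= /pull_proj cup_sectionE.
move=> /(congr1 (@pull_vector _ _ _ _ _)).
rewrite -[LHS]/(lb_scale 0 (pull_vector (cup_section a w))) pull_cup_section //.
by case: (Sclass_frame (row_shift a w) (col_shift a w) 0).
Qed.

Lemma cup_section_continuous a : sc_grid a ->
  {within @sc_grid_set Q C 2 2 a, continuous (cup_section a)}.
Proof.
move=> ag; set D := sc_grid_set a.
have [_ c1 _] := logs1; have [_ c2 _] := logs2.
have row i : {within D, continuous (fun w => l1 (q1 (a (i, ord0))) (grow w i))}.
  apply: within_comp (c1 (q1 (a (i, ord0)))); first by move=> w aw; exact: grow_set.
  by apply: within_continuous; exact: grow_continuous.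
have col j : {within D, continuous (fun w => l2 (q2 (a (ord0, j))) (gcol w j))}.
  apply: within_comp (c2 (q2 (a (ord0, j)))); first by move=> w aw; exact: gcol_set.
  by apply: within_continuous; exact: gcol_continuous.
have cs : {within D, continuous (fun w => (row_shift a w, col_shift a w, 1 : R[i]^o) : Scover R)}.
  apply: within_pair; last exact: within_cst.
  by apply: within_pair; apply: (@withinB _ _ R).
have cS := within_comp_continuous (@Sclass_continuous R) cs.
apply: within_val; apply: within_eq (within_pair (@within_id _ D) cS).
by move=> w aw; rewrite cup_sectionE.
Qed.

(** The lifts over the three faces are gaps of one family of logarithms, hence add up exactly, and
    each vector has coordinate 1 there, which is 0 in the additive notation. *)
Lemma cup_local_sections :
  local_sections (@cup_triv1 R X Y1 Y2) (@cup_triv2 R X Y1 Y2) cup_section.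
Proof.
split; [exact: cup_section_continuous|exact: frame_cup_section| |].
- move=> a w ag aw.
  have ok k : sc_grid (omit1 k a) by split=> *; [exact: ag.1|exact: ag.2].
  have wk k : sc_grid_set (omit1 k a) (face1 k w) by move=> ij; exact: aw.
  pose xi i := l1 (q1 (a (i, ord0))) (grow w i).
  pose y := l2 (q2 (a (ord0, ord_max))) (gcol w ord_max) - l2 (q2 (a (ord0, ord0))) (gcol w ord0).
  have yE k : col_shift (omit1 k a) (face1 k w) = y.
    rewrite /col_shift !gcol_face1 /omit1 /=.
    by rewrite (ag.2 (lift k ord0) ord0 ord_max) (ag.2 (lift k ord0) ord0 ord0).
  have hw k : chi12 (face1 k w) = (u1_cis (gap xi k), u1_cis y).
    by rewrite (chi12_shift (ok k) (wk k)) yE.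
  rewrite (cup_triv1E hw) => [|k]; last exact: frame_cup_section.
  rewrite altsum_eq0 ?oppr0 // => k; rewrite pull_cup_section // yE.
  exact: Scs_class.
- move=> a w ag aw.
  have ok k : sc_grid (omit2 k a) by split=> *; [exact: ag.1|exact: ag.2].
  have wk k : sc_grid_set (omit2 k a) (face2 k w) by move=> ij; exact: aw.
  pose eta j := l2 (q2 (a (ord0, j))) (gcol w j).
  pose x := l1 (q1 (a (ord_max, ord0))) (grow w ord_max) - l1 (q1 (a (ord0, ord0))) (grow w ord0).
  have xE k : row_shift (omit2 k a) (face2 k w) = x.
    rewrite /row_shift !grow_face2 /omit2 /=.
    by rewrite (ag.1 ord_max (lift k ord0) ord0) (ag.1 ord0 (lift k ord0) ord0).
  have hw k : chi12 (face2 k w) = (u1_cis x, u1_cis (gap eta k)).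
    by rewrite (chi12_shift (ok k) (wk k)) xE.
  rewrite (cup_triv2E hw) => [|k]; last exact: frame_cup_section.
  rewrite altsum_eq0 ?oppr0 // => k; rewrite pull_cup_section // xE.
  exact: Scs_class.
Qed.

Lemma rcup01 (I : Type) (F : ('I_1 -> I) -> R) (G : ('I_2 -> I) -> R) i :
  rcup (p := 0) (q := 1) F G i = F (fun=> i ord0) * G i.
Proof.
rewrite /rcup; congr (F _ * G _); apply/funext => k.
  by rewrite (ord1 k); congr i; apply: val_inj; rewrite /= inordK.
by congr i; apply: val_inj; rewrite /= inordK //; exact: ltn_ord.
Qed.

Lemma frame_ratio_cup_section (a : 'I_2 -> 'I_2 * 'I_2 -> sc_IW C) w :
  (forall p, sc_grid (a p)) -> inter (@sc_grid_set Q C 2 2) a w ->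
  frame_ratio (cup_section (a ord0) w) (cup_section (a ord_max) w) = - d1d2 cup_gamma a w.
Proof.
move=> ag aw.
pose A1 i p := a p (i, ord0) : sc_IW C; pose A2 j p := a p (ord0, j) : sc_IW C.
pose M1 i := N1 (fun p => q1 (a p (i, ord0))) (grow w i).
pose M2 j := N2 (fun p => q2 (a p (ord0, j))) (gcol w j).
have M1i i : M1 i \is a Num.int.
  by apply: (winding_int data1 logs1) => p; exact: grow_set (aw p) i ord0.
have M2i j : M2 j \is a Num.int.
  by apply: (winding_int data2 logs2) => p; exact: gcol_set (aw p) ord0 j.
(* A change of charts moves the lift by integers: all rows lie over the same point and the same
   indices of X, so the terms [a1] of the two windings cancel. *)
have rowE : row_shift (a ord_max) w = row_shift (a ord0) w + (M1 ord_max - M1 ord0).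
  rewrite /M1 /winding !cdiff_log /= /row_shift (grow_proj_eq w ord_max ord0).
  have -> : r1 \o (fun p => q1 (a p (ord_max, ord0))) = r1 \o (fun p => q1 (a p (ord0, ord0))).
    by apply/funext => p /=; rewrite (sc_grid_r _ (ag p)).
  move: (a1 _ _) (l1 _ _) (l1 _ _) (l1 _ _) (l1 _ _) => ? ? ? ? ?; ring.
have colE : col_shift (a ord_max) w = col_shift (a ord0) w + (M2 ord_max - M2 ord0).
  rewrite /M2 /winding !cdiff_log /= /col_shift (gcol_proj_eq w ord_max ord0).
  have -> : r2 \o (fun p => q2 (a p (ord0, ord_max))) = r2 \o (fun p => q2 (a p (ord0, ord0))).
    by apply/funext => p /=; rewrite -!sc_comm (sc_grid_r _ (ag p)).
  move: (a2 _ _) (l2 _ _) (l2 _ _) (l2 _ _) (l2 _ _) => ? ? ? ? ?; ring.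
(* The logarithm depends only on the row and the winding only on the column, so the double
   difference of their products factors. *)
have ddE : d1d2 cup_gamma a w = ccis (row_shift (a ord0) w * (M2 ord_max - M2 ord0)).
  pose l i := l1 (q1 (a ord0 (i, ord0))) (grow w i).
  have gE i j : cup_gamma (fun p => a p (i, j)) (entry w (i, j)) = ccis (l i * M2 j).
    rewrite /cup_gamma rcup01 /log_cochain /=.
    rewrite (growE w i j) (gcolE w i j) ((ag ord0).1 i j ord0).
    congr (ccis (_ * N2 _ _)); apply/funext => p /=; exact: (ag p).2.
  rewrite /d1d2 !altsum2 /= !gE -!ccisB; congr ccis.
  have e1 : lift ord0 ord0 = ord_max :> 'I_2 by exact: val_inj.
  have e2 : lift ord_max ord0 = ord0 :> 'I_2 by exact: val_inj.
  rewrite e1 e2 /row_shift -/(l ord0) -/(l ord_max); ring.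
have /intrP[n nE] : M1 ord_max - M1 ord0 \is a Num.int by apply: rpredB.
have /intrP[k kE] : M2 ord_max - M2 ord0 \is a Num.int by apply: rpredB.
have f0 := frame_cup_section (ag ord0) (aw ord0).
rewrite ddE kE; set c := RHS.
suff -> : cup_section (a ord_max) w = cs_scale c (cup_section (a ord0) w).
  apply: (frame_ratio_eq (cup_bundle_line_bundle Y1 Y2) f0).
  by apply: frame_scale => //; exact: cup_bundle_line_bundle.
apply: pullback_inj.
  by rewrite lb_scale_proj (frame_cup_section (ag _) (aw _)).1 f0.1.
rewrite pull_vector_scale !pull_cup_section // cs_scale_Sclass rowE colE nE kE.
(* Acting by [(n, k)] contributes e^{2 pi i k x}, with x the row shift in the first chart, and [c]
   is its inverse; this is the origin of the sign in - d_1 d_2 gamma. *)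
rewrite -[RHS](Sclass_act n k); congr (Sclass (_, _, _)).
have -> : csval c = cis (- (row_shift (a ord0) w * k%:~R)) by rewrite /c -ccisN.
by rewrite [RHS]mulrA -cisD /= [k%:~R * _]mulrC subrr cis0 mul1r.
Qed.

Lemma cup_represents : represents_class (@cup_triv1 R X Y1 Y2) (@cup_triv2 R X Y1 Y2)
  (C := C) (cup_rep a1 a2).
Proof.
split; first exact: cup_rep_cocycle data1 data2.
exists cup_section, cup_gamma, cup_beta1, cup_beta2; split.
- exact: cup_local_sections.
- by split; [exact: cup_gamma_cochain|exact: cup_beta1_cochain|exact: cup_beta2_cochain].
- exact: frame_ratio_cup_section.
- exact: cdiff_cup_gamma.
- by split; [exact: cdiff_cup_beta1|exact: cdiff_cup_beta2].
Qed.

End CupRepresents.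

(** * Arbitrarily fine square covers *)

Section LogCover.
Variables (R : realType) (X : topologicalType) (Y : circle_bundle R X).
Variables (U : open_cover X) (sigma : oc_idx U -> X -> Y)
  (a : cochain X R (oc_idx U) 1) (n : cochain X zdisc (oc_idx U) 2).
Hypothesis data : chern_data sigma a n.

Definition log_chart (V : set Y) : Prop := open V /\
  exists (i : oc_idx U) (l : Y -> R), [/\ V `<=` @cb_proj R X Y @^-1` U i,
    {within V, continuous l} &
    forall y, V y -> cb_act (u1_cis (l y)) (sigma i (cb_proj y)) = y].

Lemma log_chart_cover (y : Y) : exists V : {V : set Y | log_chart V}, sval V y.
Proof.
have [[cs ps] _ _ _ _] := data.
have [i Ui] := oc_cover U (cb_proj y).
pose D := @cb_proj R X Y @^-1` U i.
have oD : open D.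
  by apply: open_comp; [move=> ? _; exact: cb_proj_continuous|exact: oc_open].
pose u y' := difference (sigma i (cb_proj y')) y'.
have cu : {within D, continuous u}.
  apply: within_difference; first by move=> z Dz; rewrite ps.
    apply: within_comp (cs i) => //.
    by apply: within_continuous; exact: cb_proj_continuous.
  exact: within_id.
have [B [oB Bu [l cl hl]]] := u1_local_log (u y).
have hV : log_chart (D `&` u @^-1` B).
  split; first exact: open_preimage_within.
  exists i, (l \o u); split; first by move=> z [].
    apply: within_comp cl; first by move=> z [].
    by apply: within_subset cu => z [].
  by move=> z [Dz Bz]; rewrite /= hl // difference_spec // ps.
by exists (exist _ _ hV).
Qed.

(** Indexed by all open sets that carry a logarithm relative to some section; by restriction, every
    member of a finer cover carries one too. *)
Definition log_cover : open_cover Y :=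
  @OpenCover Y {V : set Y | log_chart V} sval (fun V => (svalP V).1) log_chart_cover.

Lemma log_system_exists (W : open_cover X) (f : oc_idx W -> oc_idx U) (I : Type)
    (V : I -> set Y) (r : I -> oc_idx W) :
  (forall j, W j `<=` U (f j)) -> (forall b y, V b y -> W (r b) (cb_proj y)) ->
  finer V log_cover -> exists l, log_system (U := W) (sigma \o f) V r l.
Proof.
move=> WU VW fin; have [[_ ps] ca ga _ _] := data.
have [b|l hl] := @boolp.choice I (Y -> R) (fun b l => {within V b, continuous l} /\
  forall y, V b y -> cb_act (u1_cis (l y)) (sigma (f (r b)) (cb_proj y)) = y); last first.
  by exists l; split=> // b; have [h1 h2] := hl b; [exact: h1|exact: h2].
have [[V' [oV' [i [l [VU cl hl]]]]] /= VV'] := fin b.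
(* The available logarithm refers to a section [i] unrelated to the prescribed section [f (r b)];
   the transition logarithm of this pair of indices corrects it. *)
pose ij (k : 'I_2) := if k == ord0 then f (r b) else i.
have Vij y : V b y -> inter U ij (cb_proj y).
  move=> Vy k; rewrite /ij; case: ifP => _; first by apply: WU; exact: VW.
  by apply: VU; exact: VV'.
exists (fun y => l y + a ij (cb_proj y)); split.
  apply: (@withinD _ _ R); first exact: within_subset cl.
  apply: within_comp (ca ij) => //.
  by apply: within_continuous; exact: cb_proj_continuous.
move=> y Vy; have Vy' := Vij y Vy.
have e : cb_proj (sigma (f (r b)) (cb_proj y)) = cb_proj (sigma i (cb_proj y)).
  by rewrite !ps //; [exact: (Vy' ord_max)|exact: (Vy' ord0)].
by rewrite u1_cisD -ga // cb_actM [X in cb_act _ X](difference_spec e) hl //; exact: VV'.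
Qed.

End LogCover.

Section FineCovers.

Lemma finer_prod (X : topologicalType) (J : Type) (V : J -> set X) (A B : open_cover X) :
  finer V (prod_cover A B) -> finer V A /\ finer V B.
Proof.
move=> h; split=> j; have [[i i'] hi] := h j.
  by exists i => x /hi[].
by exists i' => x /hi[].
Qed.

Lemma open_inter (X : topologicalType) (U : open_cover X) n (i : 'I_n -> oc_idx U) :
  open (inter U i).
Proof.
rewrite openE => x ix; apply: (@filter_forall _ _ (fun k => U (i k)) (nbhs x) _) => k.
by apply: open_nbhs_nbhs; split; [exact: oc_open|exact: ix].
Qed.

Variables (R : realType) (X : topologicalType) (Y1 Y2 : circle_bundle R X).
Local Notation Q := (bundle_square Y1 Y2).
Variables (UX : open_cover X) (UY1 : open_cover Y1) (UY2 : open_cover Y2).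

Definition small_section (Y : circle_bundle R X) (UY : open_cover Y) (V : set X)
    (j : oc_idx UY) (s : X -> Y) : Prop :=
  {within V, continuous s} /\ forall x, V x -> cb_proj (s x) = x /\ UY j (s x).

Lemma small_section_exists (Y : circle_bundle R X) (UY : open_cover Y) (x : X) :
  exists V j s, [/\ open V, V x & small_section (UY := UY) V j s].
Proof.
have [_ _ /(_ x)[V [oV Vx [s cs hs]]]] := cb_locally_split Y.
have [j sj] := oc_cover UY (s x).
exists (V `&` s @^-1` UY j), j, s; split=> //.
  by apply: open_preimage_within => //; exact: oc_open.
split; first by apply: within_subset cs => z [].
by move=> z [Vz sz]; split=> //; exact: hs.
Qed.

(** Over such a [V] each bundle has a section inside a single member of the prescribed cover, as
    needed to find sections with values in the members of the refined covers. *)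
Definition small_base (V : set X) : Prop := open V /\
  [/\ exists i, V `<=` UX i, exists j s, small_section (UY := UY1) V j s &
      exists j s, small_section (UY := UY2) V j s].

Lemma small_base_cover x : exists V : {V : set X | small_base V}, sval V x.
Proof.
have [i Ui] := oc_cover UX x.
have [V1 [j1 [s1 [opV1 V1x [c1 h1]]]]] := small_section_exists UY1 x.
have [V2 [j2 [s2 [opV2 V2x [c2 h2]]]]] := small_section_exists UY2 x.
have hV : small_base (UX i `&` V1 `&` V2).
  split; first by apply: openI => //; apply: openI => //; exact: oc_open.
  split; first by exists i => z [[]].
    exists j1, s1; split; first by apply: within_subset c1 => z [[]].
    by move=> z [[_ /h1]].
  exists j2, s2; split; first by apply: within_subset c2 => z [].
  by move=> z [_ /h2].
by exists (exist _ _ hV).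
Qed.

Definition fine_X : open_cover X :=
  @OpenCover X {V : set X | small_base V} sval (fun V => (svalP V).1) small_base_cover.

(* All sufficiently small open sets over a member of the cover of X are used,
   so that a small section over that member lies in members over every other. *)
Definition small_set (Y : circle_bundle R X) (UY : open_cover Y)
    (xV : oc_idx fine_X * set Y) : Prop :=
  [/\ open xV.2, xV.2 `<=` @cb_proj R X Y @^-1` fine_X xV.1 & exists j, xV.2 `<=` UY j].

Definition fine_I (Y : circle_bundle R X) (UY : open_cover Y) : Type :=
  {xV : oc_idx fine_X * set Y | small_set UY xV}.

Lemma fine_cover (Y : circle_bundle R X) (UY : open_cover Y) (x : oc_idx fine_X) (y : Y) :
  fine_X x (cb_proj y) -> exists2 b : fine_I UY, (sval b).1 = x & (sval b).2 y.
Proof.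
move=> xy; have [j yj] := oc_cover UY y.
have hV : small_set UY (x, UY j `&` @cb_proj R X Y @^-1` fine_X x).
  split=> /=; last by exists j => z [].
    apply: openI; first exact: oc_open.
    apply: open_comp; first by move=> ? _; exact: cb_proj_continuous.
    exact: (@oc_open _ fine_X x).
  by move=> z [].
by exists (exist _ _ hV).
Qed.

Lemma fine_section (Y : circle_bundle R X) (UY : open_cover Y) n
    (x : 'I_n.+1 -> oc_idx fine_X) :
  (exists j s, small_section (UY := UY) (fine_X (x ord0)) j s) ->
  exists (b : 'I_n.+1 -> fine_I UY) (s : X -> Y),
  [/\ (forall k, (sval (b k)).1 = x k), {within inter fine_X x, continuous s} &
      forall z, inter fine_X x z ->
        cb_proj (s z) = z /\ inter (fun b : fine_I UY => (sval b).2) b (s z)].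
Proof.
move=> [j [s [cs hs]]].
(* The same small open set is used for every [k], labelled by the different indices [x k]; only the
   section over the first member is needed. *)
have hV k : small_set UY (x k, UY j `&` @cb_proj R X Y @^-1` inter fine_X x).
  split=> /=; last by exists j => z [].
    apply: openI; first exact: oc_open.
    apply: open_comp; first by move=> ? _; exact: cb_proj_continuous.
    exact: (@open_inter _ fine_X).
  by move=> z [_ /(_ k)].
exists (fun k => exist _ _ (hV k)), s; split=> //.
  by apply: within_subset cs => z; exact.
move=> z xz; have [e sj] := hs _ (xz ord0).
by split=> // k; split=> //=; rewrite e.
Qed.

Definition fine_IW : Type :=
  {b : fine_I UY1 * fine_I UY2 | (sval b.1).1 = (sval b.2).1}.

Definition fine_W (a : fine_IW) : set (sq_W Q) :=
  @sq_p1 Q @^-1` (sval (sval a).1).2 `&` @sq_p2 Q @^-1` (sval (sval a).2).2.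

Lemma fine_W_open a : open (fine_W a).
Proof.
apply: openI; apply: open_comp.
- by move=> w _; exact: (sq_p1_continuous (bundle_square_locally_split Y1 Y2)).
- by case: (svalP (sval a).1).
- by move=> w _; exact: (sq_p2_continuous (bundle_square_locally_split Y1 Y2)).
- by case: (svalP (sval a).2).
Qed.

Lemma fine_W_cover (b1 : fine_I UY1) (b2 : fine_I UY2) (w : sq_W Q) :
  (sval b1).1 = (sval b2).1 -> (sval b1).2 (sq_p1 w) -> (sval b2).2 (sq_p2 w) ->
  exists a : fine_IW, [/\ (sval a).1 = b1, (sval a).2 = b2 & fine_W a w].
Proof. by move=> e h1 h2; exists (exist _ (b1, b2) e). Qed.

Lemma bundle_pairK (y : bundle_fprod Y1 Y2) : @sq_pair Q y = y.
Proof. by case: y => [[a b] h]; exact: val_inj. Qed.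

Lemma bundle_pair_inj (w w' : sq_W Q) :
  sq_p1 w = sq_p1 w' -> sq_p2 w = sq_p2 w' -> w = w'.
Proof.
by case: w w' => [[a b] h] [[a' b'] h'] e1 e2; apply: val_inj; exact: (congr2 pair e1 e2).
Qed.

Lemma fine_W_section n (b1 : 'I_n.+1 -> fine_I UY1) (b2 : 'I_n.+1 -> fine_I UY2) :
  (forall k, (sval (b1 k)).1 = (sval (b2 k)).1) ->
  exists (a : 'I_n.+1 -> fine_IW) (s : Defs.fprod (@sq_pi1 Q) (@sq_pi2 Q) -> sq_W Q),
    let D := [set y | inter (fun b : fine_I UY1 => (sval b).2) b1 (set_val y).1 /\
                      inter (fun b : fine_I UY2 => (sval b).2) b2 (set_val y).2] in
    [/\ (forall k, (sval (a k)).1 = b1 k /\ (sval (a k)).2 = b2 k),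
        {within D, continuous s} &
        forall y, D y -> sq_pair (s y) = y /\ inter fine_W a (s y)].
Proof.
move=> e; exists (fun k => exist _ (b1 k, b2 k) (e k)), id; split=> //.
  exact: within_id.
move=> y [h1 h2]; split; first exact: bundle_pairK.
by move=> k; split; [exact: h1|exact: h2].
Qed.

Definition fine_square_cover : square_cover Q :=
  @SquareCover Q fine_X (fine_I UY1) (fine_I UY2) fine_IW
    (fun b => (sval b).2) (fun b => (sval b).2) fine_W
    (fun b => (sval b).1) (fun b => (sval b).1)
    (fun a => (sval a).1) (fun a => (sval a).2) (fun a => svalP a)
    (fun b => let: And3 h _ _ := svalP b in h) (fun b => let: And3 h _ _ := svalP b in h)
    fine_W_open
    (fun b => let: And3 _ h _ := svalP b in h) (fun b => let: And3 _ h _ := svalP b in h)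
    (fun a w h => h) (@fine_cover Y1 UY1) (@fine_cover Y2 UY2) fine_W_cover
    (fun n x => fine_section (let: conj _ (And3 _ h _) := svalP (x ord0) in h))
    (fun n x => fine_section (let: conj _ (And3 _ _ h) := svalP (x ord0) in h))
    fine_W_section.

Lemma fine_square_coverP : [/\ finer (sc_X fine_square_cover) UX,
  finer (@sc_Y1 Q fine_square_cover) UY1 & finer (@sc_Y2 Q fine_square_cover) UY2].
Proof.
split=> [V|b|b] /=; first by case: (svalP V) => _ [].
  by case: (svalP b).
by case: (svalP b).
Qed.

End FineCovers.

(** * The characteristic class as a cup product *)

Section CharacteristicClassOfCup.
Variables (R : realType) (X : topologicalType) (Y1 Y2 : circle_bundle R X).
Local Notation Q := (bundle_square Y1 Y2).
Variables (U : open_cover X) (sigma1 : oc_idx U -> X -> Y1)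
  (sigma2 : oc_idx U -> X -> Y2) (a1 a2 : cochain X R (oc_idx U) 1)
  (n1 n2 : cochain X zdisc (oc_idx U) 2).
Hypothesis data1 : chern_data sigma1 a1 n1.
Hypothesis data2 : chern_data sigma2 a2 n2.

Lemma cup_represents_fine (C : square_cover Q) : finer (sc_X C) U ->
  finer (@sc_Y1 Q C) (log_cover data1) -> finer (@sc_Y2 Q C) (log_cover data2) ->
  exists alpha, represents_class (@cup_triv1 R X Y1 Y2) (@cup_triv2 R X Y1 Y2) (C := C) alpha /\
    cohomologous (Cech (cup_rep a1 a2)) (Cech alpha).
Proof.
move=> /boolp.choice[f fU] fin1 fin2.
have [l1 hl1] := log_system_exists fU (@sc_Y1_sub Q C) fin1.
have [l2 hl2] := log_system_exists fU (@sc_Y2_sub Q C) fin2.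
have d1 := chern_data_refine fU data1; have d2 := chern_data_refine fU data2.
exists (fun i => cup_rep a1 a2 (f \o i)); split; first by have := cup_represents d1 d2 hl1 hl2; exact.
exact: (@cohomologous_refine _ _ 2 U (sc_X C) f _ fU (cup_rep_cocycle data1 data2)).
Qed.

(** On each fine square cover an arbitrary representative is compared with the restriction of
    [cup_rep a1 a2], whose class comes from [U] and does not depend on the square cover. *)
Lemma cup_dd_class : dd_class (@cup_triv1 R X Y1 Y2) (@cup_triv2 R X Y1 Y2)
  (class_of (Cech (cup_rep a1 a2))).
Proof.
split.
  exists U, (log_cover data1), (log_cover data2) => C alpha fX f1 f2 hal.
  have [alpha' [hal' coh]] := cup_represents_fine fX f1 f2.
  apply: class_of_eq; apply: cohomologous_trans coh _.
  apply: represents_class_unique hal' hal.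
  - exact: bundle_square_locally_split.
  - exact: bundle_pair_inj.
  - exact: cup_bundle_line_bundle.
  - exact: cup_triv1_trivializing.
  - exact: cup_triv2_trivializing.
move=> UX UY1 UY2.
have [fX f1 f2] := fine_square_coverP (prod_cover UX U)
  (prod_cover UY1 (log_cover data1)) (prod_cover UY2 (log_cover data2)).
have [fX1 fX2] := finer_prod fX; have [f11 f12] := finer_prod f1.
have [f21 f22] := finer_prod f2.
have [alpha [hal _]] := cup_represents_fine fX2 f12 f22.
by exists (fine_square_cover (prod_cover UX U) (prod_cover UY1 (log_cover data1))
  (prod_cover UY2 (log_cover data2))), alpha.
Qed.

End CharacteristicClassOfCup.

Lemma cup_characteristic_class (R : realType) (X : topologicalType)
    (Y1 Y2 : circle_bundle R X) (alpha1 alpha2 : cech_class X zdisc 2) :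
  chern_class Y1 alpha1 -> chern_class Y2 alpha2 ->
  characteristic_class (@cup_triv1 R X Y1 Y2) (@cup_triv2 R X Y1 Y2) (cup alpha1 alpha2).
Proof.
move=> /chern_class_data[U1 [s1 [a1 [n1 [d1 ->]]]]] /chern_class_data[U2 [s2 [a2 [n2 [d2 ->]]]]].
(* The two Chern classes are represented over unrelated covers; over [P] their cochain product is
   the [cross] product, whose class [cup_class] identifies with the cup product. *)
pose P := prod_cover U1 U2.
have e1 := @chern_data_refine R X Y1 U1 P fst s1 a1 n1 (fun j x => @proj1 _ _) d1.
have e2 := @chern_data_refine R X Y2 U2 P snd s2 a2 n2 (fun j x => @proj2 _ _) d2.
exists (class_of (Cech (cup_rep (U := P) (fun i => a1 (fst \o i)) (fun i => a2 (snd \o i))))).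
  exact: cup_dd_class e1 e2.
have [_ _ _ cn1 _] := d1; have [_ _ _ cn2 _] := d2.
exists P, (cup_rep (U := P) (fun i => a1 (fst \o i)) (fun i => a2 (snd \o i))),
  (cup_cochain (fun i => n1 (fst \o i)) (fun i => n2 (snd \o i))); split=> //.
- exact: cup_rep_cocycle e1 e2.
- exact: (cross_cocycle (z := Cech n1) (z' := Cech n2) cn1 cn2).
- exact: (cup_class (z := Cech n1) (z' := Cech n2) cn1 cn2).
- exact: cup_rep_bockstein e1 e2.
Qed.

Theorem proposition5p2 (R : realType) (X : topologicalType)
    (Y1 Y2 : circle_bundle R X)
    (hX : cg_hausdorff X) (hY1 : cg_hausdorff Y1) (hY2 : cg_hausdorff Y2)
    (alpha1 alpha2 : cech_class X zdisc 2)
    (halpha1 : cohomology alpha1) (halpha2 : cohomology alpha2)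
    (hrep1 : chern_class Y1 alpha1) (hrep2 : chern_class Y2 alpha2) :
  bigerbe (@cup_triv1 R X Y1 Y2) (@cup_triv2 R X Y1 Y2) /\
  characteristic_class (@cup_triv1 R X Y1 Y2) (@cup_triv2 R X Y1 Y2)
    (cup alpha1 alpha2).

Proof.
split; first exact: cup_bigerbe.
exact: cup_characteristic_class.
Qed.
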